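(* Let $k$ be a number field and let $E_0$ be an elliptic curve defined over $k$, given by a homogeneous cubic equation $F(x,y,z)=0$ in $\mathbf{P}^2$ such that the origin $O$ of $E_0$ is one of its inflection points. Let $\mathcal{E}_t$ be the pencil of cubic curves defined by $$\mathcal{E}_t:\ F(x,y,z)+t\,\det\bigl(F''(x,y,z)/2!\bigr)=0.$$ Then the identity map $(x:y:z)\mapsto(x:y:z)$ gives a symplectic isomorphism $E_0[3]\to\mathcal{E}_t[3]$ for each $t$ such that $\mathcal{E}_t$ is an elliptic curve. Moreover, any elliptic curve $E$ over $k$ with a symplectic isomorphism $\phi:E_0[3]\to E[3]$ is (isomorphic over $k$ to) a member of the pencil $\mathcal{E}_t$.
   Context: $F''(x,y,z)$ denotes the $3\times3$ matrix of second partial derivatives of $F$ (the Hessian matrix). The parameter $t$ of the pencil runs over $\mathbf{P}^1(k)$, where $t=\infty$ corresponds to the Hessian curve $\det F''=0$ itself. A nonsingular member $\mathcal{E}_t$ is regarded as an elliptic curve with origin $O$ (a base point of the pencil). For an elliptic curve $E$ over $k$, $E[3]$ denotes the group of $3$-torsion points of $E(\bar k)$, viewed as a $\mathrm{Gal}(\bar k/k)$-module, and $e_{E,3}$ is the Weil pairing on it. An isomorphism of Galois modules $\phi:E_0[3]\to E[3]$ is called symplectic if $e_{E,3}(\phi(P),\phi(Q))=e_{E_0,3}(P,Q)$ for all $P,Q\in E_0[3]$. *)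

(* Defs.v *)
From HB Require Import structures.
From mathcomp Require Import all_boot all_order all_algebra all_field.
From mathcomp Require Import mpoly.

Set Implicit Arguments.
Unset Strict Implicit.
Unset Printing Implicit Defensive.

Import GRing.Theory.
Local Open Scope ring_scope.

(* A point of P^2(K) is represented by its unique representative whose first
   nonzero coordinate is 1, so that equality of points is Leibniz equality. *)
Definition normalized (K : fieldType) (v : 'rV[K]_3) : bool :=
  [exists i, (v 0 i == 1) && [forall j : 'I_3, (j < i)%N ==> (v 0 j == 0)]].

Record P2 (K : fieldType) := Point {
  coords : 'rV[K]_3;
  coords_normalized : normalized coords }.

HB.instance Definition _ (K : fieldType) := [isSub for @coords K].
HB.instance Definition _ (K : fieldType) := [Choice of P2 K by <:].

Lemma normalized_map (K L : fieldType) (f : {rmorphism K -> L})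
  (v : 'rV[K]_3) : normalized v -> normalized (map_mx f v).
Proof.
case/existsP=> i /andP[/eqP vi /forallP v0]; apply/existsP; exists i.
rewrite mxE vi rmorph1 eqxx /=; apply/forallP=> j; apply/implyP=> ji.
by have:= v0 j; rewrite ji /= mxE => /eqP->; rewrite rmorph0.
Qed.

Definition map_P2 (K L : fieldType) (f : {rmorphism K -> L}) (P : P2 K) :
    P2 L :=
  Point (normalized_map f (coords_normalized P)).

Section PlaneCubics.
Variable K : fieldType.
Implicit Types (F : {mpoly K[3]}) (P Q R S T W : P2 K) (l : 'rV[K]_3).

Definition on_curve F P : bool := F.@[coords P 0] == 0.

Definition nonsingular F : Prop :=
  forall P, on_curve F P -> exists i : 'I_3, (F^`M(i)).@[coords P 0] != 0.

(* [l] is the linear form  l_0 x + l_1 y + l_2 z. *)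
Definition lin_eval l P : K := \sum_(i < 3) l 0 i * coords P 0 i.
Definition on_line l P : bool := lin_eval l P == 0.

(* The polynomial  F(T + X W)  in one variable X. *)
Definition restrict_line F T W : {poly K} :=
  mmap (@polyC K) (fun i => (coords T 0 i)%:P + coords W 0 i *: 'X) F.

(* The intersection multiplicity at T of the line l (through T) and F = 0
   is n; the line is parametrised near T by T + X W for any other point W
   of l.  Since [mup 0 0 = 0], a line contained in F = 0 has multiplicity 0
   everywhere, hence never satisfies [line_section] below. *)
Definition line_mult F l T (n : nat) : Prop :=
  forall W, on_line l W -> W != T -> mup 0 (restrict_line F T W) = n.

(* The line l cuts F = 0 in the divisor (P) + (Q) + (R). *)
Definition line_section F l P Q R : Prop :=
  [/\ l != 0, on_line l P, on_line l Q, on_line l R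
    & forall T, on_line l T -> line_mult F l T (count_mem T [:: P; Q; R])].

Definition is_flex F P : Prop := exists l, line_section F l P P P.

End PlaneCubics.

Record pointed_cubic (K : fieldType) := PointedCubic {
  cubic_form : {mpoly K[3]};
  origin : P2 K }.

Definition base_change (K L : fieldType) (f : {rmorphism K -> L})
    (E : pointed_cubic K) : pointed_cubic L :=
  PointedCubic (map_mpoly f (cubic_form E)) (map_P2 f (origin E)).

Section GroupLaw.
Variables (K : fieldType) (E : pointed_cubic K).
Local Notation F := (cubic_form E).
Local Notation O := (origin E).
Implicit Types (P Q R S : P2 K) (l : 'rV[K]_3).

(* Chord and tangent law, as a relation: P + Q = R. *)
Definition ec_add P Q R : Prop :=
  exists l l' S, line_section F l P Q S /\ line_section F l' S O R.

(* 3 P = O *)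
Definition torsion3 P : Prop :=
  on_curve F P /\ exists Q, ec_add P P Q /\ ec_add Q P O.

(* The rational function l / m, for linear forms l and m. *)
Definition lin_ratio (l m : 'rV[K]_3) P : K := lin_eval l P / lin_eval m P.

(* e_{E,3}(P, Q) = z, when the origin O is a flex and P, Q are 3-torsion
   points.  If lO, lP, lQ are linear forms cutting E in 3(O), 3(P), 3(Q), then
   f_P = lP / lO and f_Q = lQ / lO are the functions, unique up to constants,
   with div f_P = 3(P) - 3(O) and div f_Q = 3(Q) - 3(O), and
     e_{E,3}(P, Q) = (f_P (Q + S) / f_P S) / (f_Q (P - S) / f_Q (- S))
   for an auxiliary point S at which no zero or pole occurs; this does not
   depend on S.  Below QS = Q + S, NS = - S and PS = P - S. *)
Definition weil3 P Q (z : K) : Prop :=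
  exists (lO lP lQ : 'rV[K]_3) (S QS NS PS : P2 K),
  [/\ [/\ line_section F lO O O O, line_section F lP P P P
        & line_section F lQ Q Q Q],
      [/\ ec_add Q S QS, ec_add S NS O & ec_add P NS PS],
      [/\ ~~ on_line lP QS, ~~ on_line lO QS, ~~ on_line lP S
        & ~~ on_line lO S],
      [/\ ~~ on_line lQ PS, ~~ on_line lO PS, ~~ on_line lQ NS
        & ~~ on_line lO NS]
    & z = (lin_ratio lP lO QS / lin_ratio lP lO S)
          / (lin_ratio lQ lO PS / lin_ratio lQ lO NS)].

End GroupLaw.

Section Hessian.
Variable k : fieldType.

(* det (F'' / 2!) *)
Definition hessian (F : {mpoly k[3]}) : {mpoly k[3]} :=
  \det (\matrix_(i < 3, j < 3) ((2%:R : k)^-1 *: (F^`M(i))^`M(j))).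

(* [option k] is P^1(k), with [None] for t = oo. *)
Definition pencil (E : pointed_cubic k) (t : option k) : pointed_cubic k :=
  PointedCubic
    (if t is Some a then cubic_form E + a *: hessian (cubic_form E)
     else hessian (cubic_form E))
    (origin E).

End Hessian.

(* [algC] with the embedding [iota] is an algebraic closure of the number field
   k.  The elements of Gal(algC / k) are the ring endomorphisms of algC fixing
   iota k; these are automatically bijective, algC being algebraic. *)
Section NumberField.
Variables (k : fieldExtType rat) (iota : {rmorphism k -> algC}).
Implicit Types E : pointed_cubic k.
Local Notation "E %:bar" := (base_change iota E) (at level 2).

(* An elliptic curve over k is a geometrically nonsingular plane cubic with a
   k-rational flex as its origin. *)
Definition elliptic E : Prop :=
  [/\ cubic_form E \is 3.-homog, nonsingular (cubic_form E%:bar)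
    & is_flex (cubic_form E%:bar) (origin E%:bar)].

(* phi restricts to a symplectic isomorphism of Galois modules from E[3] to
   E'[3]; its values outside E[3] are irrelevant. *)
Definition symplectic_iso3 E E' (phi : P2 algC -> P2 algC) : Prop :=
  [/\ [/\ forall P, torsion3 E%:bar P -> torsion3 E'%:bar (phi P),
          forall P Q, torsion3 E%:bar P -> torsion3 E%:bar Q ->
            phi P = phi Q -> P = Q
        & forall P', torsion3 E'%:bar P' ->
            exists2 P, torsion3 E%:bar P & phi P = P'],
      forall P Q R, torsion3 E%:bar P -> torsion3 E%:bar Q ->
        torsion3 E%:bar R -> ec_add E%:bar P Q R ->
        ec_add E'%:bar (phi P) (phi Q) (phi R),
      forall sigma : {rmorphism algC -> algC}, sigma \o iota =1 iota ->
        forall P, torsion3 E%:bar P ->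
        phi (map_P2 sigma P) = map_P2 sigma (phi P)
    & forall P Q, torsion3 E%:bar P -> torsion3 E%:bar Q ->
        exists z, weil3 E%:bar P Q z /\ weil3 E'%:bar (phi P) (phi Q) z].

Definition eval_forms (h : 'I_3 -> {mpoly k[3]}) (P : P2 algC) : 'rV[algC]_3 :=
  \row_i (map_mpoly iota (h i)).@[coords P 0].

(* f restricts to a morphism over k from E to E': near each point it is given
   by three forms of the same degree with coefficients in k. *)
Definition is_morphism E E' (f : P2 algC -> P2 algC) : Prop :=
  forall P, on_curve (cubic_form E%:bar) P ->
    on_curve (cubic_form E'%:bar) (f P) /\
    exists (d : nat) (h : 'I_3 -> {mpoly k[3]}),
      [/\ forall i, h i \is d.-homog, eval_forms h P != 0
        & forall Q, on_curve (cubic_form E%:bar) Q -> eval_forms h Q != 0 ->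
            exists c : algC, eval_forms h Q = c *: coords (f Q)].

(* Isomorphism over k of curves, preserving the origins. *)
Definition isomorphic E E' : Prop :=
  exists f g : P2 algC -> P2 algC,
    [/\ is_morphism E E' f, is_morphism E' E g,
        forall P, on_curve (cubic_form E%:bar) P -> g (f P) = P,
        forall P, on_curve (cubic_form E'%:bar) P -> f (g P) = P
      & f (origin E%:bar) = origin E'%:bar].

End NumberField.

(* Main.v *)
Require Import Defs.
From HB Require Import structures.
From mathcomp Require Import all_boot all_order all_algebra all_field.
From mathcomp Require Import mpoly.
From mathcomp Require Import ring.

(** Over an algebraically closed field a nonsingular plane cubic with a flex has,
    in suitable coordinates, the Hesse equation
    x^3 + y^3 + z^3 = 3 c x y z with the flex at (0 : 1 : -1)
    ([hesse_frame_exists]).  The reduction passes through the Weierstrass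
    equation; a root of the 3-division polynomial gives the tangents at three
    collinear flexes, and from these the Hesse coordinates are explicit.

    In Hesse coordinates everything about the 3-torsion is independent of c.
    The flexes are the nine base points of the Hesse pencil, and they form the
    3-torsion ([frame_torsion]).  Translation by a flex is induced by a matrix
    [heis i j], a product of the cyclic shift and of a diagonal matrix of cube
    roots of unity, because inversion is the linear map exchanging y and z and
    the third point of a chord through a flex is a conjugate of it
    ([frame_add]).  The Weil pairing of two flexes is the commutator of their
    translation matrices ([frame_weil_val], [frame_weil]).  As the Hessian of a
    cubic of the Hesse pencil is again a combination of x^3 + y^3 + z^3 and
    x y z, and the formation of the Hessian commutes with linear
    substitutions, all nonsingular members of the pencil of a cubic F and its
    Hessian are brought to Hesse form by the same matrix, and the identity is
    a symplectic isomorphism ([pencil_symplectic]).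

    For the converse let phi be a symplectic isomorphism from E0[3] to E[3].
    The Hessian group, which preserves the Hesse pencil, induces all of
    SL_2(Z/3) on the 3-torsion ([hessian_rep_sl2]).  Hence the Hesse coordinates
    of E can be changed so that phi becomes the identity in coordinates: phi is
    induced by a matrix N ([symplectic_linear]), and N pulls the equation of E
    back to a combination of F and its Hessian.  A projective transformation is
    determined by its values at the flexes ([flexes_scalar]), so the
    conjugates of N are proportional to N, as phi commutes with the Galois
    group; therefore N may be scaled to have entries in k ([rational_matrix]),
    and the coefficients of the combination are in k as well.

    Line sections are handled through factorizations ([cuts]) instead of
    multiplicities ([line_sectionP] relates the two), which makes changes of
    coordinates and tangent lines harmless. *)

Set Implicit Arguments.
Unset Strict Implicit.
Unset Printing Implicit Defensive.

Import GRing.Theory Num.Theory.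
Local Open Scope ring_scope.

(** * Vectors with three coordinates *)

Definition i0 : 'I_3 := @Ordinal 3 0 isT.
Definition i1 : 'I_3 := @Ordinal 3 1 isT.
Definition i2 : 'I_3 := @Ordinal 3 2 isT.

Lemma ord3P (P : 'I_3 -> Prop) : P i0 -> P i1 -> P i2 -> forall i, P i.
Proof.
move=> h0 h1 h2 [[|[|[|//]]] h].
- by rewrite (_ : Ordinal h = i0) //; apply: val_inj.
- by rewrite (_ : Ordinal h = i1) //; apply: val_inj.
- by rewrite (_ : Ordinal h = i2) //; apply: val_inj.
Qed.

Lemma sum3 (V : nmodType) (f : 'I_3 -> V) :
  \sum_(i < 3) f i = f i0 + f i1 + f i2.
Proof.
rewrite !big_ord_recl big_ord0 addr0 addrA.
by congr (f _ + f _ + f _); apply: val_inj.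
Qed.

Section Vectors.
Variable K : fieldType.
Implicit Types (u v w p q r n l : 'rV[K]_3) (M : 'M[K]_3).

Definition row3 (x y z : K) : 'rV[K]_3 := \row_(i < 3) [:: x; y; z]`_i.

Lemma row3E x y z :
  (row3 x y z 0 i0 = x) * (row3 x y z 0 i1 = y) * (row3 x y z 0 i2 = z).
Proof. by rewrite !mxE. Qed.

Lemma row3_eta v : v = row3 (v 0 i0) (v 0 i1) (v 0 i2).
Proof. by apply/rowP; apply: ord3P; rewrite row3E. Qed.

Lemma row3P (P : 'rV[K]_3 -> Prop) :
  (forall x y z, P (row3 x y z)) -> forall v, P v.
Proof. by move=> h v; rewrite [v]row3_eta. Qed.

Lemma row3_inj x y z x' y' z' :
  row3 x y z = row3 x' y' z' -> [/\ x = x', y = y' & z = z'].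
Proof.
by move=> /rowP e; split; [have := e i0 | have := e i1 | have := e i2];
  rewrite !row3E.
Qed.

Lemma row3D x y z x' y' z' :
  row3 x y z + row3 x' y' z' = row3 (x + x') (y + y') (z + z').
Proof. by apply/rowP; apply: ord3P; rewrite !mxE. Qed.

Lemma row3Z a x y z : a *: row3 x y z = row3 (a * x) (a * y) (a * z).
Proof. by apply/rowP; apply: ord3P; rewrite !mxE. Qed.

Lemma row3_0 : 0 = row3 0 0 0.
Proof. by apply/rowP; apply: ord3P; rewrite !mxE. Qed.

Lemma row3_neq0 x y z :
  (row3 x y z != 0) = [|| x != 0, y != 0 | z != 0].
Proof.
apply/idP/idP => [|h].
  apply: contraNT; rewrite !negb_or !negbK => /and3P[/eqP-> /eqP-> /eqP->].
  by rewrite -row3_0.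
by apply/eqP; rewrite row3_0 => /row3_inj[x0 y0 z0]; rewrite x0 y0 z0 !eqxx in h.
Qed.

Definition mat3 r0 r1 r2 : 'M[K]_3 :=
  \matrix_(i < 3) [:: r0; r1; r2]`_i.

Lemma mat3E r0 r1 r2 :
  (row i0 (mat3 r0 r1 r2) = r0) * (row i1 (mat3 r0 r1 r2) = r1)
  * (row i2 (mat3 r0 r1 r2) = r2).
Proof. by rewrite !rowK. Qed.

Lemma mat3_eta M : M = mat3 (row i0 M) (row i1 M) (row i2 M).
Proof. by apply/row_matrixP; apply: ord3P; rewrite mat3E. Qed.

Lemma row3_mul x y z M :
  row3 x y z *m M = x *: row i0 M + y *: row i1 M + z *: row i2 M.
Proof. by rewrite mulmx_sum_row sum3 !row3E. Qed.

Lemma row3_mat3 x y z r0 r1 r2 :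
  row3 x y z *m mat3 r0 r1 r2 = x *: r0 + y *: r1 + z *: r2.
Proof. by rewrite row3_mul !mat3E. Qed.

Definition lin l v : K := \sum_(i < 3) l 0 i * v 0 i.

Lemma lin3 x y z x' y' z' :
  lin (row3 x y z) (row3 x' y' z') = x * x' + y * y' + z * z'.
Proof. by rewrite /lin sum3 !row3E. Qed.

Lemma linE l v : lin l v = (v *m l^T) 0 0.
Proof. by rewrite mxE; apply: eq_bigr => i _; rewrite mxE mulrC. Qed.

Lemma linDr l v w : lin l (v + w) = lin l v + lin l w.
Proof. by rewrite !linE mulmxDl mxE. Qed.

Lemma linZr l a v : lin l (a *: v) = a * lin l v.
Proof. by rewrite !linE -scalemxAl mxE. Qed.

Lemma linZl l a v : lin (a *: l) v = a * lin l v.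
Proof. by rewrite !linE linearZ -scalemxAr mxE. Qed.

Lemma lin_mul l v M : lin (l *m M^T) v = lin l (v *m M).
Proof. by rewrite !linE trmx_mul trmxK mulmxA. Qed.

Lemma lin_neq0 l : l != 0 -> exists n, lin l n != 0.
Proof.
elim/row3P: l => x y z; rewrite row3_neq0 => /or3P[] h.
- by exists (row3 1 0 0); rewrite lin3 mulr1 !mulr0 !addr0.
- by exists (row3 0 1 0); rewrite lin3 mulr1 !mulr0 addr0 add0r.
- by exists (row3 0 0 1); rewrite lin3 mulr1 !mulr0 !add0r.
Qed.

Definition cross u v : 'rV[K]_3 :=
  row3 (u 0 i1 * v 0 i2 - u 0 i2 * v 0 i1)
       (u 0 i2 * v 0 i0 - u 0 i0 * v 0 i2)
       (u 0 i0 * v 0 i1 - u 0 i1 * v 0 i0).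

Lemma cross3 x y z x' y' z' :
  cross (row3 x y z) (row3 x' y' z') =
  row3 (y * z' - z * y') (z * x' - x * z') (x * y' - y * x').
Proof. by rewrite /cross !row3E. Qed.

Definition det3 u v w : K := lin (cross u v) w.

Lemma det33 x y z x' y' z' x'' y'' z'' :
  det3 (row3 x y z) (row3 x' y' z') (row3 x'' y'' z'') =
  (y * z' - z * y') * x'' + (z * x' - x * z') * y'' + (x * y' - y * x') * z''.
Proof. by rewrite /det3 cross3 lin3. Qed.

Lemma det_mat3 u v w : \det (mat3 u v w) = det3 u v w.
Proof.
elim/row3P: u => a b c; elim/row3P: v => a' b' c'; elim/row3P: w => a'' b'' c''.
rewrite det33 (expand_det_row _ ord0) sum3 /cofactor.
rewrite !(expand_det_row _ ord0) !big_ord_recl !big_ord0 /cofactor !det_mx11.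
rewrite !mxE /= /bump /= !exprS !expr0.
ring.
Qed.

Lemma det3_mul u v w M : det3 (u *m M) (v *m M) (w *m M) = det3 u v w * \det M.
Proof.
rewrite -!det_mat3 -det_mulmx; congr (\det _); apply/row_matrixP.
by apply: ord3P; rewrite row_mul !mat3E.
Qed.

Lemma det3Zl a u v w : det3 (a *: u) v w = a * det3 u v w.
Proof.
elim/row3P: u => x y z; elim/row3P: v => x' y' z'; elim/row3P: w => x'' y'' z''.
by rewrite row3Z !det33; ring.
Qed.

Lemma det3_sum x y u v w n : det3 w (x *: u + y *: v) n = x * det3 w u n + y * det3 w v n.
Proof.
elim/row3P: u => u0 u1 u2; elim/row3P: v => v0 v1 v2.
elim/row3P: w => w0 w1 w2; elim/row3P: n => n0 n1 n2.
by rewrite !row3Z row3D !det33; ring.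
Qed.

Lemma det3_uu u n : det3 u u n = 0.
Proof.
by elim/row3P: u => u0 u1 u2; elim/row3P: n => n0 n1 n2; rewrite det33; ring.
Qed.

Lemma det3_sym u v n : det3 u v n = - det3 v u n.
Proof.
elim/row3P: u => u0 u1 u2; elim/row3P: n => n0 n1 n2.
by elim/row3P: v => v0 v1 v2; rewrite !det33; ring.
Qed.

Lemma det3_comb x y x' y' u v n :
  det3 (x *: u + y *: v) (x' *: u + y' *: v) n = (x * y' - y * x') * det3 u v n.
Proof.
elim/row3P: u => u0 u1 u2; elim/row3P: v => v0 v1 v2.
by elim/row3P: n => n0 n1 n2; rewrite !row3Z !row3D !det33; ring.
Qed.

(** Because of this identity [det3 p q n], for a fixed [n] off the line [l],
    plays the part of the 2 by 2 determinant of the points [p] and [q] of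
    [l]: it vanishes exactly when they coincide in the plane. *)
Lemma lin_cross l p q n : lin l p = 0 -> lin l q = 0 ->
  lin l n *: cross p q = det3 p q n *: l.
Proof.
elim/row3P: l => l0 l1 l2; elim/row3P: p => p0 p1 p2.
elim/row3P: q => q0 q1 q2; elim/row3P: n => n0 n1 n2.
rewrite !lin3 det33 cross3 !row3Z => hp hq.
congr row3; apply/eqP; rewrite -subr_eq0; apply/eqP.
- transitivity ((q1 * n2 - q2 * n1) * - (l0 * p0 + l1 * p1 + l2 * p2)
     + (p1 * n2 - p2 * n1) * (l0 * q0 + l1 * q1 + l2 * q2)); first by ring.
  by rewrite hp hq oppr0 !mulr0 addr0.
- transitivity ((q2 * n0 - q0 * n2) * - (l0 * p0 + l1 * p1 + l2 * p2)
     + (p2 * n0 - p0 * n2) * (l0 * q0 + l1 * q1 + l2 * q2)); first by ring.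
  by rewrite hp hq oppr0 !mulr0 addr0.
- transitivity ((q0 * n1 - q1 * n0) * - (l0 * p0 + l1 * p1 + l2 * p2)
     + (p0 * n1 - p1 * n0) * (l0 * q0 + l1 * q1 + l2 * q2)); first by ring.
  by rewrite hp hq oppr0 !mulr0 addr0.
Qed.

Lemma lin_crossl u v : lin (cross u v) u = 0.
Proof.
by elim/row3P: u => u0 u1 u2; elim/row3P: v => v0 v1 v2; rewrite cross3 lin3; ring.
Qed.

Lemma lin_crossr u v : lin (cross u v) v = 0.
Proof.
by elim/row3P: u => u0 u1 u2; elim/row3P: v => v0 v1 v2; rewrite cross3 lin3; ring.
Qed.

Lemma linC u v : lin u v = lin v u.
Proof. by apply: eq_bigr => i _; rewrite mulrC. Qed.

(** Equality in projective space. *)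
Definition sim m (v w : 'M[K]_(m, 3)) : Prop := exists2 a, a != 0 & v = a *: w.
Local Notation "v =~ w" := (sim v w) (at level 70).

Lemma sim_refl m (v : 'M[K]_(m, 3)) : v =~ v.
Proof. by exists 1; rewrite ?oner_neq0 ?scale1r. Qed.

Lemma sim_sym m (v w : 'M[K]_(m, 3)) : v =~ w -> w =~ v.
Proof.
by case=> a a0 ->; exists a^-1; rewrite ?invr_eq0 // scalerA mulVf // scale1r.
Qed.

Lemma sim_trans m (v u w : 'M[K]_(m, 3)) : u =~ v -> v =~ w -> u =~ w.
Proof.
by move=> [a a0 ->] [b b0 ->]; exists (a * b); rewrite ?mulf_neq0 // scalerA.
Qed.

Lemma simZl m a (v : 'M[K]_(m, 3)) : a != 0 -> a *: v =~ v.
Proof. by move=> a0; exists a. Qed.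

Lemma sim_mulr m (v w : 'M[K]_(m, 3)) M : v =~ w -> v *m M =~ w *m M.
Proof. by case=> a a0 ->; exists a; rewrite ?scalemxAl. Qed.

Lemma sim_mull m k (v w : 'M[K]_(m, 3)) (M : 'M[K]_(k, m)) : v =~ w -> M *m v =~ M *m w.
Proof. by case=> a a0 ->; exists a; rewrite ?scalemxAr. Qed.

Lemma sim_neq0 m (v w : 'M[K]_(m, 3)) : v =~ w -> w != 0 -> v != 0.
Proof. by case=> a a0 -> w0; rewrite scaler_eq0 negb_or a0. Qed.

Lemma sim_lin0 l v w : v =~ w -> lin l w = 0 -> lin l v = 0.
Proof. by case=> a a0 -> h; rewrite linZr h mulr0. Qed.

Lemma mulmx_neq0 v M : M \in unitmx -> v != 0 -> v *m M != 0.
Proof.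
by move=> uM; apply: contraNneq => h; rewrite -(mulmxK uM v) h mul0mx.
Qed.

Lemma cross_eq0 u v : u != 0 -> v != 0 -> cross u v = 0 -> u =~ v.
Proof.
elim/row3P: u => x y z; elim/row3P: v => x' y' z' u0 v0.
rewrite cross3 row3_0 => /row3_inj[/eqP hx /eqP hy /eqP hz].
move: hx hy hz; rewrite !subr_eq0 => /eqP hx /eqP hy /eqP hz.
suff [a e] : exists a, row3 x y z = a *: row3 x' y' z'.
  exists a => //; apply: contraNneq u0 => a0.
  by rewrite e a0 scale0r.
move: v0; rewrite row3_neq0 => /or3P[] h.
- by exists (x / x'); rewrite row3Z divfK // ![x / x' * _]mulrAC hz -hy !mulfK.
- by exists (y / y'); rewrite row3Z divfK // ![y / y' * _]mulrAC -hz hx !mulfK.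
- by exists (z / z'); rewrite row3Z divfK // ![z / z' * _]mulrAC hy -hx !mulfK.
Qed.

Lemma on_line_sim l p q n : lin l n != 0 -> lin l p = 0 -> lin l q = 0 ->
  p != 0 -> q != 0 -> det3 p q n = 0 -> p =~ q.
Proof.
move=> ln lp lq p0 q0 d0; apply: cross_eq0 => //.
have := lin_cross n lp lq; rewrite d0 scale0r => /eqP.
by rewrite scaler_eq0 (negPf ln) => /eqP.
Qed.

Lemma lines_sim l m : l != 0 -> m != 0 ->
  (forall v, lin l v = 0 -> lin m v = 0) -> m =~ l.
Proof.
move=> l0 m0 h; apply: cross_eq0 => //.
apply/rowP => i; rewrite [RHS]mxE.
have -> : cross m l 0 i = lin (cross m l) (\row_j (j == i)%:R).
  rewrite /lin (bigD1 i) //= mxE eqxx mulr1 big1 ?addr0 // => j ji.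
  by rewrite mxE (negPf ji) mulr0.
set e := \row_j _; have := h (cross l e); rewrite linC lin_crossl => /(_ erefl).
elim/row3P: l {l0 h} => l0 l1 l2; elim/row3P: m {m0} => m0 m1 m2.
elim/row3P: e => e0 e1 e2; by rewrite !cross3 !lin3 => hm; rewrite -[RHS]hm; ring.
Qed.

End Vectors.

Notation "v =~ w" := (sim v w) (at level 70).

(** * Points of the projective plane *)

Section Points.
Variable K : fieldType.
Implicit Types (P Q : P2 K) (v w : 'rV[K]_3).

Definition lead v : K :=
  if v 0 i0 != 0 then v 0 i0 else if v 0 i1 != 0 then v 0 i1 else v 0 i2.

Lemma normalized3 (x y z : K) : normalized (row3 x y z) =
  [|| x == 1, (x == 0) && (y == 1) | [&& x == 0, y == 0 & z == 1]].
Proof.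
apply/existsP/idP => [[i]|].
  elim/ord3P: i; rewrite row3E => /andP[/eqP-> /forallP h].
  - by rewrite eqxx.
  - by have := h i0; rewrite row3E /= => ->; rewrite eqxx orbT.
  - have := h i0; have := h i1; rewrite !row3E /= => -> ->.
    by rewrite eqxx !orbT.
case/or3P => [/eqP->|/andP[/eqP-> /eqP->]|/and3P[/eqP-> /eqP-> /eqP->]].
- exists i0; rewrite row3E eqxx /=; apply/forallP; apply: ord3P => //.
- by exists i1; rewrite row3E eqxx /=; apply/forallP; apply: ord3P; rewrite ?row3E ?eqxx.
- by exists i2; rewrite row3E eqxx /=; apply/forallP; apply: ord3P; rewrite ?row3E ?eqxx.
Qed.

Lemma lead_neq0 v : v != 0 -> lead v != 0.
Proof.
elim/row3P: v => x y z; rewrite row3_neq0 /lead !row3E.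
by have [->|] := eqVneq x 0; have [->|] := eqVneq y 0; rewrite ?eqxx.
Qed.

Lemma normalized_lead v : v != 0 -> normalized ((lead v)^-1 *: v).
Proof.
move=> v0; have := lead_neq0 v0; move: v0; elim/row3P: v => x y z.
rewrite row3_neq0 /lead !row3E row3Z normalized3.
have [->|x0] := eqVneq x 0; have [->|y0] := eqVneq y 0 => /= h l0;
  by rewrite ?mulVf ?mulr0 ?eqxx ?orbT.
Qed.

Lemma lead_normalized v : normalized v -> lead v = 1.
Proof.
elim/row3P: v => x y z; rewrite normalized3 /lead !row3E.
by case/or3P => [/eqP->|/andP[/eqP-> /eqP->]|/and3P[/eqP-> /eqP-> /eqP->]];
  rewrite ?eqxx ?oner_neq0.
Qed.

Lemma leadZ a v : a != 0 -> lead (a *: v) = a * lead v.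
Proof.
elim/row3P: v => x y z a0; rewrite row3Z /lead !row3E !mulf_eq0 (negPf a0) /=.
by case: eqP => // _; case: eqP.
Qed.

Lemma normalized_neq0 v : normalized v -> v != 0.
Proof.
move=> nv; have := lead_normalized nv; have [->|//] := eqVneq v 0.
by rewrite /lead row3_0 !row3E eqxx => /eqP; rewrite eq_sym oner_eq0.
Qed.

Lemma coords_neq0 P : coords P != 0.
Proof. exact: normalized_neq0 (coords_normalized P). Qed.

Lemma coords_inj : injective (@coords K).
Proof. exact: val_inj. Qed.

Lemma coords_sim P Q : coords P =~ coords Q -> P = Q.
Proof.
case=> a a0 e; apply: coords_inj; rewrite e.
suff -> : a = 1 by rewrite scale1r.
have := lead_normalized (coords_normalized P).
by rewrite e leadZ // (lead_normalized (coords_normalized Q)) mulr1.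
Qed.

Lemma normalized100 : normalized (row3 1 0 0 : 'rV[K]_3).
Proof. by rewrite normalized3 eqxx. Qed.

(** The value at [v = 0] is arbitrary. *)
Definition proj v : P2 K := insubd (Point normalized100) ((lead v)^-1 *: v).

Lemma coords_proj v : v != 0 -> coords (proj v) =~ v.
Proof.
move=> v0; exists (lead v)^-1; first by rewrite invr_eq0 lead_neq0.
by rewrite /proj -[coords _]/(val _) insubdK //; exact: normalized_lead.
Qed.

End Points.

(** * Ternary cubic forms *)

Section CubicForms.
Variable K : fieldType.

Local Notation X := ('X_i0 : {mpoly K[3]}).
Local Notation Y := ('X_i1 : {mpoly K[3]}).
Local Notation Z := ('X_i2 : {mpoly K[3]}).

Definition cubic_poly (a : nat -> K) : {mpoly K[3]} :=
  a 0%N *: (X * X * X) + a 1%N *: (X * X * Y) + a 2%N *: (X * X * Z)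
  + a 3%N *: (X * Y * Y) + a 4%N *: (X * Y * Z) + a 5%N *: (X * Z * Z)
  + a 6%N *: (Y * Y * Y) + a 7%N *: (Y * Y * Z) + a 8%N *: (Y * Z * Z)
  + a 9%N *: (Z * Z * Z).

Lemma homog3_cubic (F : {mpoly K[3]}) :
  F \is 3.-homog -> exists a, F = cubic_poly a.
Proof.
move=> /dhomogP hF.
pose e i j k : 'X_{1..3} := (U_(i0) *+ i + U_(i1) *+ j + U_(i2) *+ k)%MM.
pose s := [:: e 3 0 0; e 2 1 0; e 2 0 1; e 1 2 0; e 1 1 1; e 1 0 2; e 0 3 0;
  e 0 2 1; e 0 1 2; e 0 0 3]%N.
have us : uniq s.
  apply: (@map_uniq _ _ (fun m : 'X_{1..3} => (m i0, m i1))).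
  by rewrite /= /e !mnmDE !mulmnE !mnm1E /=.
have sub : {subset msupp F <= s}.
  move=> m /hF /=; rewrite mdegE sum3 => hm.
  have -> : m = e (m i0) (m i1) (m i2).
    by apply/mnmP; apply: ord3P; rewrite !mnmDE !mulmnE !mnm1E /= ?mul0n ?mul1n ?addn0.
  move: hm.
  case: (m i0) => [|[|[|[|?]]]]; case: (m i1) => [|[|[|[|?]]]] //;
  case: (m i2) => [|[|[|[|?]]]] // _; by rewrite !inE eqxx ?orbT.
exists (fun i => F@_(nth 0%MM s i)).
transitivity (\sum_(m <- s) F@_m *: 'X_[m]).
  rewrite [LHS]mpolyE [RHS](bigID (mem (msupp F))) /= [X in _ = _ + X]big1 ?addr0; last first.
    by move=> m /memN_msupp_eq0 ->; rewrite scale0r.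
  rewrite -[RHS]big_filter; apply: perm_big; apply: uniq_perm.
  - exact: msupp_uniq.
  - exact: filter_uniq.
  - by move=> m; rewrite mem_filter; case: (boolP (m \in _)) => // /sub ->.
rewrite /s !big_cons big_nil addr0 /cubic_poly /=.
rewrite /e !mulm0n !addm0 !add0m !mulmS !mulm0n !addm0 !mpolyXD !addrA !mulrA.
by [].
Qed.

Definition fval (F : {mpoly K[3]}) (v : 'rV[K]_3) : K := F.@[v 0].

Definition cubic_val (a : nat -> K) (x y z : K) : K :=
  a 0%N * (x * x * x) + a 1%N * (x * x * y) + a 2%N * (x * x * z)
  + a 3%N * (x * y * y) + a 4%N * (x * y * z) + a 5%N * (x * z * z)
  + a 6%N * (y * y * y) + a 7%N * (y * y * z) + a 8%N * (y * z * z)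
  + a 9%N * (z * z * z).

Definition cubic (f : 'rV[K]_3 -> K) : Prop :=
  exists a, forall x y z, f (row3 x y z) = cubic_val a x y z.

Lemma fval_cubic_poly a x y z :
  fval (cubic_poly a) (row3 x y z) = cubic_val a x y z.
Proof.
rewrite /fval /cubic_poly !mevalD !mevalZ !mevalM !mevalXU !row3E /cubic_val.
reflexivity.
Qed.

Lemma fval_cubic F : F \is 3.-homog -> cubic (fval F).
Proof.
by move=> /homog3_cubic[a ->]; exists a => x y z; rewrite fval_cubic_poly.
Qed.

Lemma horner_restrict_line F (T W : P2 K) x : F \is 3.-homog ->
  (restrict_line F T W).[x] = fval F (coords T + x *: coords W).
Proof.
move=> /homog3_cubic[a ->]; rewrite /restrict_line /cubic_poly.
move: (coords T) (coords W); elim/row3P => t0 t1 t2; elim/row3P => w0 w1 w2.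
rewrite row3Z row3D fval_cubic_poly.
rewrite !mmapD !mmapZ !rmorphM /= !mmapX !mmap1U !row3E /cubic_val.
by rewrite !(mulrC x) !(hornerD, hornerM, hornerC, hornerZ, hornerX).
Qed.

(** Six times the symmetric trilinear form whose diagonal is the cubic [f].
    First and second partial derivatives are values of this form, which makes
    their behaviour under linear substitutions immediate. *)
Definition pol (f : 'rV[K]_3 -> K) u v w : K :=
  f (u + v + w) - f (u + v) - f (u + w) - f (v + w) + f u + f v + f w.

End CubicForms.

Section Polarization.
Variable C : numClosedFieldType.
Implicit Types (F : {mpoly C[3]}) (f : 'rV[C]_3 -> C) (p u v w : 'rV[C]_3).

Lemma pol_ext f g u v w : f =1 g -> pol f u v w = pol g u v w.
Proof. by move=> e; rewrite /pol !e. Qed.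

Lemma polZ a f u v w : pol (fun v => a * f v) u v w = a * pol f u v w.
Proof. by rewrite /pol; ring. Qed.

Lemma pol_mul f M u v w :
  pol (fun v => f (v *m M)) u v w = pol f (u *m M) (v *m M) (w *m M).
Proof. by rewrite /pol !mulmxDl. Qed.

Lemma cubic_expand f u v w x y z : cubic f ->
  f (x *: u + y *: v + z *: w) =
    f u * x ^+ 3 + pol f u u v / 2 * (x ^+ 2 * y) + pol f u u w / 2 * (x ^+ 2 * z)
  + pol f u v v / 2 * (x * y ^+ 2) + pol f u v w * (x * y * z)
  + pol f u w w / 2 * (x * z ^+ 2)
  + f v * y ^+ 3 + pol f v v w / 2 * (y ^+ 2 * z) + pol f v w w / 2 * (y * z ^+ 2)
  + f w * z ^+ 3.
Proof.
case=> a fE; elim/row3P: u => u0 u1 u2; elim/row3P: v => v0 v1 v2.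
elim/row3P: w => w0 w1 w2; rewrite /pol !row3Z !row3D !fE /cubic_val.
by field.
Qed.

Lemma cubicZ f a v : cubic f -> f (a *: v) = a ^+ 3 * f v.
Proof.
case=> b fE; elim/row3P: v => x y z; rewrite row3Z !fE /cubic_val; ring.
Qed.

Lemma cubic0 f : cubic f -> f 0 = 0.
Proof. by move=> cf; rewrite -[0 in LHS](scale0r 0) cubicZ // expr0n mul0r. Qed.

Lemma cubic_line f u v x y : cubic f ->
  f (x *: u + y *: v) = f u * x ^+ 3 + pol f u u v / 2 * (x ^+ 2 * y)
    + pol f u v v / 2 * (x * y ^+ 2) + f v * y ^+ 3.
Proof.
move=> cf; have := cubic_expand u v 0 x y 0 cf.
by rewrite scaler0 addr0 => ->; rewrite !expr0n /= !mulr0 !addr0.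
Qed.

Lemma pol_sum3 f s u v w x y z t : cubic f ->
  pol f t s (x *: u + y *: v + z *: w) = x * pol f t s u + y * pol f t s v + z * pol f t s w.
Proof.
case=> a fE; elim/row3P: u => u0 u1 u2; elim/row3P: v => v0 v1 v2.
elim/row3P: w => w0 w1 w2; elim/row3P: t => t0 t1 t2; elim/row3P: s => s0 s1 s2.
rewrite /pol !row3Z !row3D !fE /cubic_val.
by ring.
Qed.

Lemma pol_sym f u v w : pol f u v w = pol f u w v.
Proof. by rewrite /pol [u + v + w]addrAC [w + v]addrC; ring. Qed.

Lemma pol_rot f u v w : pol f u v w = pol f v w u.
Proof. by rewrite /pol [v + w + u]addrC addrA [v + u]addrC [w + u]addrC; ring. Qed.

Lemma polZl f a u v w : cubic f -> pol f (a *: u) v w = a * pol f u v w.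
Proof.
move=> cf; rewrite ![pol f _ v w]pol_rot.
have := pol_sum3 w u 0 0 a 0 0 v cf.
by rewrite !scaler0 !addr0 => ->; rewrite !mul0r !addr0.
Qed.

Lemma pol_delta f s t w : cubic f ->
  pol f t s w = \sum_i w 0 i * pol f t s (delta_mx 0 i).
Proof.
move=> cf; rewrite {1}(row_sum_delta w) !sum3; exact: pol_sum3.
Qed.

Lemma pol_cube_coord (a b c : 'I_3) u v w :
  pol (fun t => t 0 a * t 0 b * t 0 c) u v w =
    u 0 a * (v 0 b * w 0 c + w 0 b * v 0 c)
  + v 0 a * (u 0 b * w 0 c + w 0 b * u 0 c)
  + w 0 a * (u 0 b * v 0 c + v 0 b * u 0 c).
Proof. by rewrite /pol !mxE; ring. Qed.

(** Identities that are linear in the form need only be checked on products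
    of three variables. *)
Lemma cubic_form_ind (P : {mpoly C[3]} -> Prop) :
  (forall F G, P F -> P G -> P (F + G)) -> (forall a F, P F -> P (a *: F)) ->
  (forall a b c, P ('X_a * 'X_b * 'X_c)) ->
  forall F, F \is 3.-homog -> P F.
Proof.
move=> PD PZ PX F /homog3_cubic[a ->].
by do 9![apply: (PD); last by apply: (PZ); apply: (PX)]; apply: PZ; apply: PX.
Qed.

Lemma mderiv_var (i j : 'I_3) : ('X_j : {mpoly C[3]})^`M(i) = ((j == i)%:R)%:MP.
Proof.
rewrite mderivX mnm1E; case: eqP => [->|_]; last by rewrite scale0r mpolyC0.
rewrite scale1r (_ : (U_(i) - U_(i) = 0)%MM) ?mpolyX0 //.
by apply/mnmP => k; rewrite mnmBE subnn mnmE.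
Qed.

Lemma mderiv_pol F i p : F \is 3.-homog ->
  (F^`M(i)).@[p 0] = pol (fval F) p p (delta_mx 0 i) / 2.
Proof.
move=> hF; move: F hF; apply: cubic_form_ind => [F G hF hG|a F hF|a b c].
- by rewrite mderivD mevalD hF hG /pol /fval !mevalD; field.
- by rewrite mderivZ mevalZ hF /pol /fval !mevalZ; field.
rewrite (@pol_ext _ (fun t => t 0 a * t 0 b * t 0 c)); last first.
  by move=> v; rewrite /fval !mevalM !mevalXU.
rewrite pol_cube_coord !(mderivM, mderiv_var) !(mevalD, mevalM, mevalC, mevalXU).
by rewrite !mxE /=; field.
Qed.

Lemma mderiv2_pol F i j p : F \is 3.-homog ->
  (F^`M(i)^`M(j)).@[p 0] = pol (fval F) p (delta_mx 0 i) (delta_mx 0 j).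
Proof.
move=> hF; move: F hF; apply: cubic_form_ind => [F G hF hG|a F hF|a b c].
- by rewrite !mderivD mevalD hF hG /pol /fval !mevalD; field.
- by rewrite !mderivZ mevalZ hF /pol /fval !mevalZ; field.
rewrite (@pol_ext _ (fun t => t 0 a * t 0 b * t 0 c)); last first.
  by move=> v; rewrite /fval !mevalM !mevalXU.
rewrite pol_cube_coord !(mderivM, mderivD, mderiv_var, mderivC).
rewrite !(mevalD, mevalM, mevalC, mevalXU, meval0).
by rewrite !mxE /=; ring.
Qed.

(** Nonsingularity of the curve [f = 0]; [pol f v v w / 2] is the derivative
    of [f] at [v] in the direction [w]. *)
Definition nonsing f : Prop :=
  forall v, v != 0 -> f v = 0 -> exists w, pol f v v w != 0.

Lemma nonsingularP F : F \is 3.-homog -> nonsingular F <-> nonsing (fval F).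
Proof.
move=> hF; have cF := fval_cubic hF; split=> [ns v v0 fv | ns P].
  have [a a0 pv] := coords_proj v0.
  have [|i] := ns (proj v); first by rewrite /on_curve -/(fval _ _) pv cubicZ // fv mulr0.
  rewrite mderiv_pol // => h; exists (delta_mx 0 i); apply: contraNneq h => h.
  by rewrite pv polZl // pol_rot polZl // -pol_rot h !mulr0 mul0r.
move=> /eqP cP; have [w] := ns _ (coords_neq0 P) cP.
case: (pickP (fun i => (F^`M(i)).@[coords P 0] != 0)) => [i hi _|h0].
  by exists i.
rewrite pol_delta // big1 ?eqxx // => i _.
have /negbFE := h0 i; rewrite mderiv_pol // mulf_eq0 invr_eq0 pnatr_eq0 orbF.
by move/eqP->; rewrite mulr0.
Qed.

Lemma nonsing_mul f (M : 'M[C]_3) a : M \in unitmx -> a != 0 ->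
  nonsing f -> nonsing (fun v => a * f (v *m M)).
Proof.
move=> uM a0 ns v v0 /eqP; rewrite mulf_eq0 (negPf a0) => /eqP fv.
have [w hw] := ns _ (mulmx_neq0 uM v0) fv; exists (w *m invmx M).
by rewrite polZ pol_mul mulmxKV // mulf_neq0.
Qed.

(** The counterpart of [hessian] for a cubic given as a function. *)
Definition fhess f p : C :=
  \det (\matrix_(i < 3, j < 3) (2^-1 * pol f p (delta_mx 0 i) (delta_mx 0 j))).

Lemma fval_hessian F p : F \is 3.-homog -> fval (hessian F) p = fhess (fval F) p.
Proof.
move=> hF; rewrite /fval /hessian -det_map_mx; congr (\det _).
by apply/matrixP => i j; rewrite !mxE /= mevalZ mderiv2_pol.
Qed.

Lemma fhess_ext f g p : f =1 g -> fhess f p = fhess g p.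
Proof.
by move=> e; congr (\det _); apply/matrixP => i j; rewrite !mxE (pol_ext _ _ _ e).
Qed.

Lemma fhessZ a f p : fhess (fun v => a * f v) p = a ^+ 3 * fhess f p.
Proof.
rewrite /fhess -detZ; congr (\det _); apply/matrixP => i j.
by rewrite !mxE polZ mulrCA.
Qed.

(** The second derivatives at [p] of a substituted form are obtained from
    those of [f] by a congruence. *)
Lemma fhess_mul f (M : 'M[C]_3) p : cubic f ->
  fhess (fun v => f (v *m M)) p = \det M ^+ 2 * fhess f (p *m M).
Proof.
move=> cf; rewrite expr2 mulrAC -{2}det_tr -!det_mulmx; congr (\det _).
apply/matrixP => i j; rewrite !mxE pol_mul -!rowE.
rewrite pol_delta // mulr_sumr; apply: eq_bigr => k _.
rewrite !mxE pol_sym pol_delta // mulrCA mulr_sumr [LHS]mulrC; congr (_ * _).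
by apply: eq_bigr => l _; rewrite !mxE pol_sym mulrCA.
Qed.

End Polarization.

(** * Line sections of a cubic *)

Section LineBasis.
Variable K : fieldType.
Implicit Types (l n p q v w : 'rV[K]_3).

(** The vector [w] is the cross product of [l] with a vector not orthogonal
    to [p], so that [p] and [w] span the line. *)
Lemma line_second l p : l != 0 -> p != 0 -> lin l p = 0 ->
  exists w e, [/\ e != 0, lin l w = 0 & cross p w = e *: l].
Proof.
move=> l0 p0 lp; have [m pm] := lin_neq0 p0; exists (cross l m), (lin p m).
split=> //; first by rewrite linC lin_crossl.
elim/row3P: l {l0} lp => l0 l1 l2; elim/row3P: p {p0 pm} => x y z.
elim/row3P: m => m0 m1 m2; rewrite !cross3 !lin3 row3Z => lp.
by congr row3; apply/eqP; rewrite -subr_eq0; apply/eqP;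
  [rewrite -[RHS](mulr0 (- m0)) | rewrite -[RHS](mulr0 (- m1))
  | rewrite -[RHS](mulr0 (- m2))]; rewrite -lp; ring.
Qed.

Lemma line_coord l p w e n v : e != 0 -> cross p w = e *: l -> lin l n != 0 ->
  lin l v = 0 ->
  v = (det3 v w n / (e * lin l n)) *: p + (det3 p v n / (e * lin l n)) *: w.
Proof.
move=> e0 cpw ln lv; have d0 : e * lin l n != 0 by rewrite mulf_neq0.
apply: (scalerI d0); rewrite scalerDr !scalerA ![_ * (_ / _)]mulrC !divfK //.
have : lin (cross p w) v = 0 by rewrite cpw linZl lv mulr0.
rewrite -linZl -cpw -/(det3 p w n).
elim/row3P: p {cpw} => p0 p1 p2; elim/row3P: w => w0 w1 w2.
elim/row3P: n {ln d0} => n0 n1 n2; elim/row3P: v {lv} => v0 v1 v2.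
rewrite cross3 lin3 !det33 !row3Z row3D => h.
by congr row3; apply/eqP; rewrite -subr_eq0; apply/eqP;
  [rewrite -[RHS](mulr0 n0) | rewrite -[RHS](mulr0 n1)
  | rewrite -[RHS](mulr0 n2)]; rewrite -h; ring.
Qed.

End LineBasis.

Section Cuts.
Variable C : numClosedFieldType.
Implicit Types (F : {mpoly C[3]}) (f : 'rV[C]_3 -> C) (l n p q r u v w : 'rV[C]_3).
Implicit Types (s : seq 'rV[C]_3) (P Q R T W : P2 C).

(** The cubic [f] cuts the line [l] in the divisor [s].  The divisor is read
    off a factorization rather than multiplicities: on the line, [f] is up to
    a constant the product of the forms [det3 p _ n] vanishing at the points
    [p] of [s]; the factor [lin l n ^+ 3] makes this independent of the point
    [n] off the line.  Linear changes of coordinates act on this description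
    directly. *)
Definition cuts f l s : Prop :=
  [/\ l != 0, all (fun p => (p != 0) && (lin l p == 0)) s
    & exists2 k, k != 0 & forall v n, lin l v = 0 ->
        lin l n ^+ 3 * f v = k * \prod_(p <- s) det3 p v n].

Lemma cuts_ext f g l s : f =1 g -> cuts f l s -> cuts g l s.
Proof.
by move=> e [l0 hs [k k0 h]]; split=> //; exists k => // v n lv; rewrite -e h.
Qed.

Lemma cuts_perm f l s s' : perm_eq s s' -> cuts f l s -> cuts f l s'.
Proof.
move=> ss' [l0 hs [k k0 h]]; split=> //; first by rewrite -(perm_all _ ss').
by exists k => // v n lv; rewrite h // (perm_big _ ss').
Qed.

Lemma cuts_sim_line f l l' s : l =~ l' -> cuts f l s -> cuts f l' s.
Proof.
move=> /sim_sym[a a0 ->] [l0 hs [k k0 h]]; split.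
- by rewrite scaler_eq0 negb_or a0.
- by apply: sub_all hs => p; rewrite linZl mulf_eq0 (negPf a0).
exists (a ^+ 3 * k); first by rewrite mulf_neq0 ?expf_neq0.
move=> v n /eqP; rewrite !linZl mulf_eq0 (negPf a0) => /eqP lv.
by rewrite exprMn -[RHS]mulrA -h // mulrA.
Qed.

Lemma cuts_sim f l p q s : p =~ q -> cuts f l (p :: s) -> cuts f l (q :: s).
Proof.
move=> pq [l0 /=]; have [a a0 eq] := sim_sym pq.
move=> /andP[/andP[p0 /eqP lp] hs] [k k0 h]; split=> //=.
  by rewrite hs andbT (sim_neq0 (sim_sym pq)) // eq linZr lp mulr0 eqxx.
exists (k / a); first by rewrite mulf_neq0 ?invr_eq0.
move=> v n lv; rewrite h // !big_cons eq det3Zl; field.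
exact: a0.
Qed.

Lemma cuts_rot f l p q r : cuts f l [:: p; q; r] -> cuts f l [:: q; r; p].
Proof. by apply: cuts_perm; rewrite (perm_catC [:: p] [:: q; r]). Qed.

Lemma cuts_swap f l p q r : cuts f l [:: p; q; r] -> cuts f l [:: p; r; q].
Proof. by apply: cuts_perm; rewrite perm_cons (perm_catC [:: q] [:: r]). Qed.

Lemma cuts_sim3 f l l' p p' q q' r r' : l =~ l' -> p =~ p' -> q =~ q' -> r =~ r' ->
  cuts f l [:: p; q; r] -> cuts f l' [:: p'; q'; r'].
Proof.
move=> hl hp hq hr /(cuts_sim_line hl)/(cuts_sim hp)/cuts_rot.
by move=> /(cuts_sim hq)/cuts_rot/(cuts_sim hr)/cuts_rot.
Qed.

Lemma cuts_mul f (M : 'M[C]_3) a l s : M \in unitmx -> a != 0 ->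
  cuts f l [seq p *m M | p <- s] -> cuts (fun v => a * f (v *m M)) (l *m M^T) s.
Proof.
move=> uM a0 [l0 hs [k k0 h]]; have uMt : M^T \in unitmx by rewrite unitmx_tr.
split; first exact: mulmx_neq0.
  move: hs; rewrite all_map; apply: sub_all => p /=; rewrite lin_mul.
  by case/andP => pM0 ->; rewrite andbT; apply: contraNneq pM0 => ->; rewrite mul0mx.
exists (a * k * \det M ^+ size s).
  by rewrite !mulf_neq0 ?expf_neq0 // -unitfE -unitmxE.
move=> v n; rewrite !lin_mul => lv; rewrite mulrCA h // -!mulrA; do 2!congr (_ * _).
rewrite big_map; elim: s {hs h} => [|p s IHs] /=; first by rewrite !big_nil mulr1.
by rewrite !big_cons IHs det3_mul exprS; ring.
Qed.

Lemma cuts_mulV f (M : 'M[C]_3) a l s : M \in unitmx -> a != 0 ->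
  cuts (fun v => a * f (v *m M)) l s ->
  cuts f (l *m (invmx M)^T) [seq p *m M | p <- s].
Proof.
move=> uM a0 h.
apply: (@cuts_ext (fun v => a^-1 * (a * f (v *m invmx M *m M)))).
  by move=> v; rewrite mulKf // mulmxKV.
apply: (@cuts_mul (fun v => a * f (v *m M))); rewrite ?unitmx_inv ?invr_eq0 //.
by rewrite -map_comp map_id_in // => p _ /=; rewrite mulmxK.
Qed.

Lemma cuts_on f l p s : cuts f l s -> p \in s -> [/\ p != 0, lin l p = 0 & f p = 0].
Proof.
case=> l0 hs [k k0 h] ps; have /andP[p0 /eqP lp] := allP hs p ps.
split=> //; have [n ln] := lin_neq0 l0; have := h p n lp.
rewrite (perm_big _ (perm_to_rem ps)) big_cons /= det3_uu mul0r mulr0 => /eqP.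
by rewrite mulf_eq0 expf_eq0 (negPf ln) /= => /eqP.
Qed.

(** One root of the dehomogenized cubic and one of the quadratic quotient are
    chosen; the third follows from the sum of the roots. *)
Lemma cubic_roots (b c d : C) : exists z1 z2 z3, forall x y,
  x ^+ 3 + b * (x ^+ 2 * y) + c * (x * y ^+ 2) + d * y ^+ 3 =
  (x - z1 * y) * (x - z2 * y) * (x - z3 * y).
Proof.
have [z1] := @solve_monicpoly C 3 (nth 0 [:: - d; - c; - b]) isT.
rewrite !big_ord_recl big_ord0 /= /bump /= => h1.
have [z2] := @solve_monicpoly C 2
  (nth 0 [:: - (c + z1 * (b + z1)); - (b + z1)]) isT.
rewrite !big_ord_recl big_ord0 /= /bump /= => h2.
exists z1, z2, (- (b + z1) - z2) => x y.
have -> : d = - (z1 ^+ 3 + b * z1 ^+ 2 + c * z1) by rewrite h1; ring.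
have -> : c = - (z2 ^+ 2 + (b + z1) * z2) - z1 * (b + z1) by rewrite h2; ring.
ring.
Qed.

Lemma det3_line l p q r : l != 0 -> lin l p = 0 -> lin l q = 0 -> lin l r = 0 ->
  det3 p q r = 0.
Proof.
move=> l0 lp lq lr; have [m lm] := lin_neq0 l0; apply: (mulfI lm).
by rewrite /det3 -linZl (lin_cross m lp lq) linZl lr !mulr0.
Qed.

(** The restriction of [f] to the line is a binary cubic, which splits into
    linear factors. *)
Lemma cuts_exists f l u : cubic f -> l != 0 -> lin l u = 0 -> f u != 0 ->
  exists p q r, cuts f l [:: p; q; r].
Proof.
move=> cf l0 lu fu; have u0 : u != 0.
  by apply: contraNneq fu => ->; rewrite cubic0.
have [w [e [e0 lw cuw]]] := line_second l0 u0 lu.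
have [z1 [z2 [z3 hz]]] := cubic_roots (pol f u u w / 2 / f u)
  (pol f u w w / 2 / f u) (f w / f u).
pose pt z := z *: u + 1 *: w.
have lpt z : lin l (pt z) = 0 by rewrite linDr !linZr lu lw !mulr0 addr0.
have pt0 z : pt z != 0.
  apply: contraNneq l0 => h; have := scaler_eq0 e l; rewrite (negPf e0) -cuw /= => <-.
  have -> : w = - z *: u.
    by apply/eqP; rewrite scaleNr -addr_eq0 addrC -[w]scale1r; apply/eqP.
  elim/row3P: u {lu fu u0 cuw hz h lpt pt} => x y t; rewrite row3Z cross3.
  by rewrite [X in _ == X]row3_0; apply/eqP; congr row3; ring.
exists (pt z1), (pt z2), (pt z3); split=> //=; first by rewrite !lpt !pt0 !eqxx.
exists (- f u / e ^+ 3); first by rewrite mulf_neq0 ?oppr_eq0 ?invr_eq0 ?expf_neq0.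
move=> v n lv; have [ln|ln] := eqVneq (lin l n) 0.
  by rewrite ln expr0n mul0r big_cons (det3_line l0 (lpt z1) lv ln) mul0r mulr0.
have := line_coord e0 cuw ln lv; move: (_ / _) (_ / _) => y x ->.
have duw : det3 u w n = e * lin l n by rewrite /det3 cuw linZl.
have dE z : det3 (pt z) (x *: u + y *: w) n = (z * y - x) * (e * lin l n).
  rewrite det3_sum ![det3 (pt z) _ _]det3_sym !det3_sum !det3_uu.
  by rewrite [det3 w u n]det3_sym duw; ring.
rewrite cubic_line // !big_cons big_nil !dE.
transitivity (lin l n ^+ 3 * f u * ((x - z1 * y) * (x - z2 * y) * (x - z3 * y))).
  by rewrite -hz; field.
by field.
Qed.

(** ** Comparison with the divisor given by multiplicities *)

Lemma poly_nonroot (p : {poly C}) : p != 0 -> exists x, p.[x] != 0.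
Proof.
move=> p0; pose rs := [seq i%:R : C | i <- iota 0 (size p)].
have urs : uniq rs.
  by rewrite map_inj_uniq ?iota_uniq // => i j /eqP; rewrite eqr_nat => /eqP.
case: (boolP (all (root p) rs)) => [h|/allPn[x _ hx]]; last by exists x.
by have := max_poly_roots p0 h urs; rewrite size_map size_iota ltnn.
Qed.

Lemma poly_ext (p q : {poly C}) : (forall x, p.[x] = q.[x]) -> p = q.
Proof.
move=> h; apply/eqP; rewrite -subr_eq0; apply/negPn/negP => /poly_nonroot[x].
by rewrite hornerD hornerN h subrr eqxx.
Qed.

Lemma mup_linear (a b : C) : ~~ ((a == 0) && (b == 0)) ->
  mup 0 (a%:P + b *: 'X) = (a == 0).
Proof.
have [->|a0] := eqVneq a 0 => /= h; last first.
  by rewrite mupNroot // /root !hornerE.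
rewrite add0r -mul_polyC mupMr ?rootC //.
by rewrite -['X]subr0 -(expr1 ('X - 0)) mup_XsubCX eqxx.
Qed.

Lemma mup_prod (T : eqType) (s : seq T) (g : T -> {poly C}) :
  (forall t, t \in s -> g t != 0) ->
  mup 0 (\prod_(t <- s) g t) = (\sum_(t <- s) mup 0 (g t))%N.
Proof.
elim: s => [|t s IHs] h; first by rewrite !big_nil mupNroot // root1.
rewrite !big_cons mupM ?IHs //.
- by move=> x xs; rewrite h // inE xs orbT.
- by rewrite h // mem_head.
- rewrite prodf_seq_neq0; apply/allP => x xs.
  by rewrite h // inE xs orbT.
Qed.

Lemma on_lineP l P : on_line l P -> lin l (coords P) = 0.
Proof. by move/eqP. Qed.

Lemma other_point l P : l != 0 -> on_line l P -> exists2 W, on_line l W & W != P.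
Proof.
move=> l0 /eqP lP; have [w [e [e0 lw cw]]] := line_second l0 (coords_neq0 P) lP.
have w0 : w != 0.
  apply: contraNneq l0 => h; have := scaler_eq0 e l; rewrite (negPf e0) -cw /= => <-.
  by rewrite h /cross !mxE !mulr0 subr0 -row3_0.
have [a a0 ew] := coords_proj w0; exists (proj w).
  by rewrite /on_line /lin_eval -/(lin _ _) ew linZr lw mulr0.
apply: contraNneq l0 => h; have := scaler_eq0 (a * e) l; rewrite mulf_eq0 (negPf a0) (negPf e0) /= => <-.
rewrite -scalerA -cw -h.
move: ew; move: (coords _) => q ->; elim/row3P: w {cw lw w0 h} => x y z.
by rewrite row3Z cross3 row3Z [X in _ == X]row3_0; apply/eqP; congr row3; ring.
Qed.

(** Along [T + X W] each factor [det3 P _ n] becomes a polynomial of degree at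
    most 1 in [X], with constant term zero exactly when [P = T]. *)
Lemma cuts_line_section F l P Q R : F \is 3.-homog ->
  cuts (fval F) l [seq coords D | D <- [:: P; Q; R]] -> line_section F l P Q R.
Proof.
move=> hF [l0 hs [k k0 h]]; have {}hs : all (on_line l) [:: P; Q; R].
  by move: hs; rewrite all_map; apply: sub_all => D /= /andP[].
move: (hs) => /= /and4P[lP lQ lR _]; split=> // T lT W lW WT.
have [n ln] := lin_neq0 l0; set s := [:: P; Q; R] in hs h *.
pose g D := (det3 (coords D) (coords T) n)%:P + det3 (coords D) (coords W) n *: 'X.
have detE D U : D \in s -> on_line l U -> (det3 (coords D) (coords U) n == 0) = (D == U).
  move=> Ds lU; apply/eqP/eqP => [d0|->]; last exact: det3_uu.
  apply: coords_sim; apply: on_line_sim ln _ _ _ _ d0; rewrite ?coords_neq0 //.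
    by apply/eqP; exact: (allP hs).
  exact/eqP.
have nz D : D \in s -> ~~ ((det3 (coords D) (coords T) n == 0)
                        && (det3 (coords D) (coords W) n == 0)).
  move=> Ds; rewrite !detE //; apply/negP => /andP[/eqP-> /eqP TW].
  by rewrite TW eqxx in WT.
have fE : (lin l n ^+ 3)%:P * restrict_line F T W = k%:P * \prod_(D <- s) g D.
  apply: poly_ext => x; rewrite !hornerM !hornerC horner_restrict_line //.
  rewrite h; last by rewrite linDr linZr (on_lineP lT) (on_lineP lW) mulr0 addr0.
  rewrite big_map horner_prod; congr (_ * _); apply: eq_bigr => D _.
  by rewrite /g !hornerE -[coords T]scale1r det3_sum scale1r mul1r mulrC.
have rC (c : C) : c != 0 -> ~~ root c%:P 0 by rewrite rootC.
rewrite -(@mupMr _ _ (lin l n ^+ 3)%:P) ?rC ?expf_neq0 // fE mupMr ?rC //.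
rewrite mup_prod => [|D Ds]; last first.
  apply: contraNneq (nz D Ds) => g0; have := congr1 (fun g0 : {poly C} => (g0`_0, g0`_1)) g0.
  by rewrite /g !coefD !coefC !coefZ !coefX /= mulr0 addr0 add0r mulr1 => -[-> ->]; rewrite eqxx.
rewrite -sum1_count [RHS]big_mkcond big_seq [RHS]big_seq /=; apply: eq_bigr => D Ds.
by rewrite /g mup_linear ?nz // detE //; case: (D == T).
Qed.

(** Conversely, the line is not contained in the cubic, as the multiplicity of
    the zero polynomial is zero; so it is cut in some divisor, and the
    multiplicities show that this is the given one. *)
Lemma line_sectionP F l P Q R : F \is 3.-homog ->
  line_section F l P Q R <-> cuts (fval F) l [:: coords P; coords Q; coords R].
Proof.
move=> hF; split; last exact: cuts_line_section.
have cF := fval_cubic hF; move=> hl; have [l0 lP lQ lR hT] := hl.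
have [W lW WP] := other_point l0 lP.
have g0 : restrict_line F P W != 0.
  apply: contraPneq (hT P lP W lW WP) => ->; rewrite /= eqxx.
  have : (mup (0%R : C) 0%R < (size (0%R : {poly C})).+1)%N by exact: ltn_ord.
  by rewrite size_poly0; case: (mup _ _).
have [x] := poly_nonroot g0; rewrite horner_restrict_line //.
set u := _ + _ => fu.
have lu : lin l u = 0 by rewrite linDr linZr (on_lineP lP) (on_lineP lW) mulr0 addr0.
have [p [q [r cpqr]]] := cuts_exists cF l0 lu fu.
have on D : D \in [:: p; q; r] -> D != 0 by case/(cuts_on cpqr).
have pE D : D \in [:: p; q; r] -> D =~ coords (proj D).
  by move=> /on S0; apply/sim_sym/coords_proj.
have cP := cuts_sim3 (sim_refl l) (pE p _) (pE q _) (pE r _) cpqr.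
have {}cP : cuts (fval F) l [seq coords D | D <- [:: proj p; proj q; proj r]].
  by apply: cP; rewrite !inE eqxx ?orbT.
apply: cuts_perm (cP); rewrite -[[:: coords P; _; _]]/[seq coords D | D <- [:: P; Q; R]].
apply: perm_map; apply/allP => T; rewrite mem_cat => hmem.
have hl' := cuts_line_section hF cP.
have lT : on_line l T.
  case: hl' => _ h1 h2 h3 _; move: hmem; rewrite !inE -!orbA.
  by case/or4P => [/eqP->|/eqP->|/eqP->|] //; case/or3P => /eqP->.
have [V lV VT] := other_point l0 lT.
case: hl' => _ _ _ _ hT'; apply/eqP.
by rewrite -(hT T lT V lV VT) -(hT' T lT V lV VT).
Qed.

End Cuts.

(** * The Hesse pencil and the Heisenberg group *)

Section Hesse.
Variable C : numClosedFieldType.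
Implicit Types (l n p q r s u v : 'rV[C]_3) (c : C).

(** A primitive cube root of unity. *)
Definition omega : C := (-1 + sqrtC (- 3)) / 2.
Local Notation w := omega.

Lemma omega_sqr : w ^+ 2 = - 1 - w.
Proof.
have h := sqrtCK (- 3 : C); rewrite /omega.
transitivity ((1 - 2 * sqrtC (- 3) + sqrtC (- 3) ^+ 2) / 4 : C); first by field.
by rewrite h; field.
Qed.

Lemma omega_cube : w ^+ 3 = 1.
Proof. by rewrite exprS omega_sqr mulrBr -expr2 omega_sqr; ring. Qed.

Lemma omega_neq0 : w != 0.
Proof. by apply: contra_eq_neq omega_cube => ->; rewrite expr0n /= eq_sym oner_eq0. Qed.

Lemma omega_neq1 : w != 1.
Proof.
apply: contra_eq_neq omega_sqr => ->; rewrite -subr_eq0.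
by rewrite (_ : _ - _ = 3) ?pnatr_eq0 //; ring.
Qed.

(** The members of the Hesse pencil. *)
Definition cubes a b v : C :=
  a * (v 0 i0 ^+ 3 + v 0 i1 ^+ 3 + v 0 i2 ^+ 3) + b * (v 0 i0 * v 0 i1 * v 0 i2).

Definition hesse c v : C := cubes 1 (- 3 * c) v.

Lemma hesse3 c x y z :
  hesse c (row3 x y z) = x ^+ 3 + y ^+ 3 + z ^+ 3 - 3 * c * (x * y * z).
Proof. by rewrite /hesse /cubes !row3E; ring. Qed.

Lemma cubes_hesse a b v : a != 0 -> cubes a b v = a * hesse (- b / (3 * a)) v.
Proof. by move=> a0; rewrite /hesse /cubes; field. Qed.

Lemma cubesZ a b t v : cubes a b (t *: v) = t ^+ 3 * cubes a b v.
Proof. by rewrite /cubes !mxE; ring. Qed.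

(** The flex taken as the origin, and its tangent. *)
Definition flex0 : 'rV[C]_3 := row3 0 1 (-1).
Local Notation o := flex0.

Definition tangent0 c : 'rV[C]_3 := row3 c 1 1.

(** Translation by a 3-torsion point [P] of a cubic of the Hesse pencil is
    induced by a matrix; these matrices are the same for the whole pencil, and
    are products of the cyclic shift and of the diagonal matrix below.  The
    inversion exchanges two coordinates. *)
Definition shift : 'M[C]_3 := mat3 (row3 0 0 1) (row3 1 0 0) (row3 0 1 0).
Definition clock : 'M[C]_3 := mat3 (row3 1 0 0) (row3 0 w 0) (row3 0 0 (w ^+ 2)).
Definition inversion : 'M[C]_3 := mat3 (row3 1 0 0) (row3 0 0 1) (row3 0 1 0).
Local Notation A := shift.
Local Notation B := clock.
Local Notation N := inversion.

Lemma shiftE x y z : row3 x y z *m A = row3 y z x.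
Proof. by rewrite row3_mat3 !row3Z !row3D; congr row3; ring. Qed.

Lemma clockE x y z : row3 x y z *m B = row3 x (w * y) (w ^+ 2 * z).
Proof. by rewrite row3_mat3 !row3Z !row3D; congr row3; ring. Qed.

Lemma inversionE x y z : row3 x y z *m N = row3 x z y.
Proof. by rewrite row3_mat3 !row3Z !row3D; congr row3; ring. Qed.

Lemma eq_mx3 (M M' : 'M[C]_3) :
  (forall x y z, row3 x y z *m M = row3 x y z *m M') -> M = M'.
Proof.
by move=> h; apply/row_matrixP => i; rewrite !rowE; elim/row3P: (delta_mx 0 i).
Qed.

Lemma shift3 : A ^+ 3 = 1.
Proof.
apply: eq_mx3 => x y z; rewrite !exprS expr0 mulr1 -!mulmxE !mulmxA mulmx1.
by rewrite !shiftE.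
Qed.

Lemma clock3 : B ^+ 3 = 1.
Proof.
apply: eq_mx3 => x y z; rewrite !exprS expr0 mulr1 -!mulmxE !mulmxA mulmx1.
rewrite !clockE; congr row3.
  by transitivity (w ^+ 3 * y); [ring | rewrite omega_cube mul1r].
by transitivity (w ^+ 3 ^+ 2 * z); [ring | rewrite omega_cube expr1n mul1r].
Qed.

Lemma inversion2 : N * N = 1.
Proof. by apply: eq_mx3 => x y z; rewrite -mulmxE mulmxA mulmx1 !inversionE. Qed.

Lemma clock_shift : B * A = w *: (A * B).
Proof.
apply: eq_mx3 => x y z; rewrite -scalemxAr -!mulmxE !mulmxA shiftE !clockE shiftE.
rewrite row3Z; congr row3; first by ring.
by transitivity (w ^+ 3 * x); [rewrite omega_cube mul1r | ring].
Qed.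

Lemma inversion_shift : N * A * N = A ^+ 2.
Proof.
apply: eq_mx3 => x y z; rewrite expr2 -!mulmxE !mulmxA !shiftE !inversionE.
by rewrite shiftE inversionE.
Qed.

Lemma inversion_clock : N * B * N = B ^+ 2.
Proof.
apply: eq_mx3 => x y z; rewrite expr2 -!mulmxE !mulmxA !clockE !inversionE.
rewrite clockE inversionE; congr row3; first by ring.
by transitivity (w ^+ 3 * (w * z)); [rewrite omega_cube mul1r | ring].
Qed.

End Hesse.

(** Up to scalars, the translation by the flex of index [(i, j)] modulo 3.  It
    is locked so that reassociating products does not open it. *)
HB.lock Definition heis (C : numClosedFieldType) (i j : nat) : 'M[C]_3 :=
  shift C ^+ i * clock C ^+ j.

Section Heisenberg.
Variable C : numClosedFieldType.
Implicit Types (l n p q r s u v : 'rV[C]_3) (c : C).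
Local Notation w := (omega C).
Local Notation o := (flex0 C).
Local Notation A := (shift C).
Local Notation B := (clock C).
Local Notation N := (inversion C).
Local Notation heis := (heis C).

Lemma clock_shiftX j k : B ^+ j * A ^+ k = w ^+ (j * k) *: (A ^+ k * B ^+ j).
Proof.
have h1 : B ^+ j * A = w ^+ j *: (A * B ^+ j).
  elim: j => [|j IHj]; first by rewrite !expr0 mul1r mulr1 scale1r.
  rewrite [B ^+ _]exprSr -[LHS]mulrA clock_shift -scalerAr [_ * (A * B)]mulrA IHj.
  by rewrite -scalerAl scalerA -exprS mulrA.
elim: k => [|k IHk]; first by rewrite muln0 !expr0 mul1r mulr1 scale1r.
rewrite [A ^+ _]exprSr mulrA IHk -scalerAl -[_ * B ^+ j * A]mulrA h1 -scalerAr scalerA.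
by rewrite mulrA mulnS [in RHS]addnC exprD.
Qed.

Lemma heisM i j k m : heis i j * heis k m = w ^+ (j * k) *: heis (i + k) (j + m).
Proof.
rewrite !heis.unlock mulrA -(mulrA (A ^+ i)) clock_shiftX -scalerAr -scalerAl !exprD.
by rewrite !mulrA.
Qed.

(** The commutator of two translations; it is the Weil pairing of the two
    points. *)
Lemma heis_comm i j k m :
  w ^+ (i * m) *: (heis i j * heis k m) = w ^+ (j * k) *: (heis k m * heis i j).
Proof.
by rewrite !heisM !scalerA mulrC [(i * m)%N]mulnC [(k + i)%N]addnC [(m + j)%N]addnC.
Qed.

Lemma heis_mod i j : heis (i %% 3) (j %% 3) = heis i j.
Proof. by rewrite !heis.unlock (expr_mod _ (shift3 C)) (expr_mod _ (clock3 C)). Qed.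

Lemma omegaX_neq0 k : w ^+ k != 0.
Proof. by rewrite expf_neq0 // omega_neq0. Qed.

Lemma heis_sim i j k m : heis i j * heis k m =~ heis (i + k) (j + m).
Proof. by rewrite heisM; apply/simZl/omegaX_neq0. Qed.

Lemma heis00 : heis 0 0 = 1.
Proof. by rewrite !heis.unlock !expr0 mulr1. Qed.

Lemma inversion_heis i j : N * heis i j * N =~ heis (2 * i) (2 * j).
Proof.
have conj X Y (k : nat) : N * X * N = Y -> N * X ^+ k * N = Y ^+ k.
  move=> <-; elim: k => [|k IHk]; first by rewrite !expr0 mulr1 inversion2.
  by rewrite [in RHS]exprS -IHk -!mulrA [N * (N * _)]mulrA inversion2 mul1r exprS !mulrA.
rewrite !heis.unlock (_ : N * _ * N = N * A ^+ i * N * (N * B ^+ j * N)); last first.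
  by rewrite -!mulrA [N * (N * _)]mulrA inversion2 mul1r.
by rewrite (conj _ _ _ (inversion_shift C)) (conj _ _ _ (inversion_clock C)) -!exprM; exact: sim_refl.
Qed.

Lemma heis_inv i j : heis i j * heis (2 * i) (2 * j) =~ 1.
Proof.
rewrite -heis00; apply: sim_trans (heis_sim _ _ _ _) _.
rewrite -heis_mod -!mulSn ![(3 * _)%N]mulnC !modnMl; exact: sim_refl.
Qed.

Lemma sim1_unit (M : 'M[C]_3) : M =~ 1 -> M \in unitmx.
Proof. by case=> a a0 ->; rewrite unitmxZ ?unitfE // unitmx1. Qed.

Lemma heis_unit i j : heis i j \in unitmx.
Proof. by have := sim1_unit (heis_inv i j); rewrite -mulmxE unitmx_mul => /andP[]. Qed.

Lemma inversion_unit : N \in unitmx.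
Proof.
by have := unitmx1 C 3; rewrite -[1%:M]/1 -inversion2 -mulmxE unitmx_mul => /andP[].
Qed.

Lemma cubes3 a b x y z :
  cubes a b (row3 x y z) = a * (x ^+ 3 + y ^+ 3 + z ^+ 3) + b * (x * y * z) :> C.
Proof. by rewrite /cubes !row3E. Qed.

Lemma cubes_shift a b v : cubes a b (v *m A) = cubes a b v :> C.
Proof. by elim/row3P: v => x y z; rewrite shiftE !cubes3; ring. Qed.

Lemma cubes_clock a b v : cubes a b (v *m B) = cubes a b v :> C.
Proof.
elim/row3P: v => x y z; rewrite clockE !cubes3.
transitivity (a * (x ^+ 3 + w ^+ 3 * y ^+ 3 + (w ^+ 3) ^+ 2 * z ^+ 3)
  + b * (w ^+ 3 * (x * y * z))); first by ring.
by rewrite omega_cube expr1n !mul1r.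
Qed.

Lemma cubes_heis a b i j v : cubes a b (v *m heis i j) = cubes a b v :> C.
Proof.
have hA (k : nat) u : cubes a b (u *m A ^+ k) = cubes a b u.
  elim: k u => [|k IHk] u; first by rewrite expr0 mulmx1.
  by rewrite exprSr -mulmxE mulmxA cubes_shift IHk.
have hB (k : nat) u : cubes a b (u *m B ^+ k) = cubes a b u.
  elim: k u => [|k IHk] u; first by rewrite expr0 mulmx1.
  by rewrite exprSr -mulmxE mulmxA cubes_clock IHk.
by rewrite !heis.unlock -mulmxE mulmxA hB hA.
Qed.

Lemma hesse_heis c i j v : hesse c (v *m heis i j) = hesse c v.
Proof. exact: cubes_heis. Qed.

Lemma hesse_inversion c v : hesse c (v *m N) = hesse c v.
Proof. by elim/row3P: v => x y z; rewrite inversionE !hesse3; ring. Qed.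

Lemma flex0_neq0 : o != 0.
Proof. by rewrite row3_neq0 oner_neq0 orbT. Qed.

Lemma flex0_inversion : o *m N = - o.
Proof. by rewrite inversionE -scaleN1r row3Z; congr row3; ring. Qed.

(** ** The third point of a chord through the origin *)

(** On the tangent the equation of the cubic reduces to
    [(1 - c ^+ 3) * x ^+ 3]. *)
Lemma hesse_tangent c s : c ^+ 3 != 1 -> s != 0 -> hesse c s = 0 ->
  lin (tangent0 c) s = 0 -> s =~ o.
Proof.
elim/row3P: s => x y z c1 s0; rewrite lin3 !mul1r => hs lt.
have x0 : x = 0.
  have /eqP : (1 - c ^+ 3) * x ^+ 3 = 0.
    rewrite -[RHS]hs hesse3 -[LHS]addr0.
    rewrite -(mul0r (c ^+ 2 * x ^+ 2 + y ^+ 2 + z ^+ 2 - c * x * y - c * x * z - y * z)).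
    by rewrite -lt; ring.
  by rewrite mulf_eq0 subr_eq0 eq_sym (negPf c1) expf_eq0 /= => /eqP.
move: lt s0; rewrite {hs}x0 mulr0 add0r => /eqP; rewrite addr_eq0 => /eqP->.
rewrite row3_neq0 eqxx oppr_eq0 orbb => z0; exists (- z); first by rewrite oppr_eq0.
by rewrite row3Z; congr row3; ring.
Qed.

(** On the line joining the origin to [s], the harmonic homology
    [inversion], which fixes the line, exchanges the other two zeros. *)
Lemma hesse_chord c s a b : hesse c (a *: o + b *: s) =
  3 * lin (tangent0 c) s * (a * b * (a + (s 0 i1 - s 0 i2) * b)) + b ^+ 3 * hesse c s.
Proof.
elim/row3P: s => x y z; rewrite !row3Z row3D !hesse3 lin3 !row3E; ring.
Qed.

Lemma inversion_flex0 s : s *m N = - (s 0 i1 - s 0 i2) *: o + 1 *: s.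
Proof.
by elim/row3P: s => x y z; rewrite inversionE !row3Z row3D !row3E; congr row3; ring.
Qed.

Lemma flex0_tangent c : lin (tangent0 c) o = 0.
Proof. by rewrite lin3; ring. Qed.

Lemma tangent0_neq0 c : tangent0 c != 0.
Proof. by rewrite row3_neq0 oner_neq0 !orbT. Qed.

(** The factorization [hesse_chord] is a line section unless [s] is the
    origin; no tangent line at [s] needs to be discussed separately. *)
Lemma cuts_flex0_exists c s : c ^+ 3 != 1 -> s != 0 -> hesse c s = 0 ->
  exists l, cuts (hesse c) l [:: o; s; s *m N].
Proof.
move=> c1 s0 hs; have [lt|lt] := eqVneq (lin (tangent0 c) s) 0.
  have so := hesse_tangent c1 s0 hs lt; exists (tangent0 c).
  have sNo : o =~ s *m N.
    apply: sim_sym; apply: sim_trans (sim_mulr N so) _.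
    by rewrite flex0_inversion -scaleN1r; apply: simZl; rewrite oppr_eq0 oner_eq0.
  apply: (cuts_sim3 (sim_refl _) (sim_refl _) (sim_sym so) sNo).
  split; rewrite ?tangent0_neq0 //=; first by rewrite flex0_neq0 flex0_tangent eqxx.
  exists (- (1 - c ^+ 3)); first by rewrite oppr_eq0 subr_eq0 eq_sym.
  elim/row3P=> x y z; elim/row3P=> n0 n1 n2; rewrite !lin3 !mul1r => lv.
  rewrite !big_cons big_nil !det33 hesse3.
  have -> : z = - (c * x + y) by apply/eqP; rewrite -addr_eq0 addrC lv.
  ring.
have cos0 : cross o s != 0.
  apply: contraNneq lt => /(cross_eq0 flex0_neq0 s0)/sim_sym h.
  by apply/eqP; exact: sim_lin0 h (flex0_tangent c).
exists (cross o s); split=> //=.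
  rewrite flex0_neq0 lin_crossl lin_crossr eqxx s0 (mulmx_neq0 inversion_unit) //=.
  by rewrite inversion_flex0 linDr !linZr lin_crossl lin_crossr !mulr0 addr0 eqxx.
exists (3 * lin (tangent0 c) s); first by rewrite mulf_neq0 // pnatr_eq0.
move=> v n lv; have [ln|ln] := eqVneq (lin (cross o s) n) 0.
  by rewrite ln expr0n mul0r big_cons (det3_line cos0 (lin_crossl _ _) lv ln) mul0r mulr0.
have := @line_coord _ (cross o s) o s 1 n v (oner_neq0 _) (esym (scale1r _)) ln lv.
move: (_ / _) (_ / _) => b a ->; rewrite hesse_chord hs !big_cons big_nil inversion_flex0.
rewrite !det3_sum [det3 (_ + _) _ n]det3_sym [det3 (_ + _) s n]det3_sym !det3_sum.
rewrite !det3_uu [det3 s o n]det3_sym /(det3 o s n); ring.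
Qed.

End Heisenberg.

(** * The third point of a line through a flex *)

Section ThirdPoint.
Variable C : numClosedFieldType.
Implicit Types (l n p q r s u v : 'rV[C]_3) (c : C).
Local Notation o := (flex0 C).
Local Notation w := (omega C).
Local Notation A := (shift C).
Local Notation B := (clock C).
Local Notation N := (inversion C).

Lemma two_neq0 : (2 : C) != 0. Proof. by rewrite pnatr_eq0. Qed.
Lemma three_neq0 : (3 : C) != 0. Proof. by rewrite pnatr_eq0. Qed.

(** The restriction of the cubic to [l], known from [hesse_chord], is compared
    with the given factorization at a few points of the line. *)
Lemma cuts_flex0 c l s u : c ^+ 3 != 1 -> cuts (hesse c) l [:: o; s; u] ->
  u =~ s *m N /\ (s =~ o -> l =~ tangent0 c).
Proof.
move=> c1 h; have [o0 lo _] := cuts_on h (mem_head _ _).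
have [s0 ls hs] : [/\ s != 0, lin l s = 0 & hesse c s = 0].
  by apply: cuts_on h _; rewrite !inE eqxx orbT.
have [u0 lu hu] : [/\ u != 0, lin l u = 0 & hesse c u = 0].
  by apply: cuts_on h _; rewrite !inE eqxx !orbT.
have [l0 _ [k k0 hk]] := h; have [n ln] := lin_neq0 l0.
have oN : o *m N =~ o.
  by rewrite flex0_inversion -scaleN1r; apply: simZl; rewrite oppr_eq0 oner_eq0.
have [lt|lt] := eqVneq (lin (tangent0 c) s) 0.
  (* The zero at the origin is double, so that [l] is the tangent. *)
  have so := hesse_tangent c1 s0 hs lt.
  have [a a0 sE] := so.
  have [x [e [e0 lx cx]]] := line_second l0 o0 lo.
  have dE : det3 o x n = e * lin l n by rewrite /det3 cx linZl.
  have ltx : lin (tangent0 c) x = 0.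
    have hb b : lin l n ^+ 3 * hesse c (b *: o + 1 *: x) =
        k * a * (e * lin l n) ^+ 2 * (b * det3 u o n + det3 u x n).
      rewrite hk ?linDr ?linZr ?lo ?lx ?mulr0 ?addr0 // !big_cons big_nil sE det3Zl.
      by rewrite !det3_sum !det3_uu dE; ring.
    have := hb 1; have := hb (-1); have := hb 0; rewrite !hesse_chord.
    move: (lin (tangent0 c) x) (hesse c x) (x 0 i1 - _) (det3 u _ _) (det3 u _ _) => t f y d d'.
    move=> h0 hm hp; apply: (mulfI two_neq0); apply: (mulfI three_neq0).
    apply: (mulfI (expf_neq0 3 ln)); rewrite !mulr0.
    transitivity ((lin l n ^+ 3 * (3 * t * (1 * 1 * (1 + y * 1)) + 1 ^+ 3 * f))
      + (lin l n ^+ 3 * (3 * t * (-1 * 1 * (-1 + y * 1)) + 1 ^+ 3 * f))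
      - 2 * (lin l n ^+ 3 * (3 * t * (0 * 1 * (0 + y * 1)) + 1 ^+ 3 * f))); first by ring.
    by rewrite h0 hm hp; ring.
  have lT : tangent0 c =~ l.
    apply: lines_sim (tangent0_neq0 c) _ => // v lv.
    rewrite (line_coord e0 cx ln lv) linDr !linZr flex0_tangent ltx.
    by rewrite !mulr0 addr0.
  split; last by move=> _; exact: sim_sym.
  have ltu : lin (tangent0 c) u = 0.
    by have [b b0 ->] := lT; rewrite linZl lu mulr0.
  apply: sim_trans (hesse_tangent c1 u0 hu ltu) _; apply: sim_sym.
  exact: sim_trans (sim_mulr N so) oN.
split; last by move=> so; case/eqP: lt; exact: sim_lin0 so (flex0_tangent c).
have cE := lin_cross n lo ls.
pose e := det3 o s n / lin l n.
have {}cE : cross o s = e *: l.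
  by apply: (scalerI ln); rewrite cE scalerA /e mulrC divfK.
have e0 : e != 0.
  apply: contraNneq lt => e0; apply/eqP; apply: sim_lin0 (flex0_tangent c).
  by apply/sim_sym/cross_eq0; rewrite ?cE ?e0 ?scale0r.
have dE : det3 o s n = e * lin l n by rewrite /det3 cE linZl.
move: hk u0; rewrite (line_coord e0 cE ln lu); move: (_ / _) (_ / _) => y x hk u0.
have hb b : 3 * lin (tangent0 c) s * (b * (b + (s 0 i1 - s 0 i2))) =
    k * e ^+ 3 * (b * (y * b - x)).
  apply: (mulfI (expf_neq0 3 ln)).
  have := hk (b *: o + 1 *: s) n; rewrite linDr !linZr lo ls !mulr0 addr0 => /(_ erefl).
  rewrite hesse_chord hs !big_cons big_nil det3_comb !det3_sum !det3_uu.
  rewrite [det3 s o n]det3_sym dE => hh.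
  transitivity (lin l n ^+ 3 * (3 * lin (tangent0 c) s *
    (b * 1 * (b + (s 0 i1 - s 0 i2) * 1)) + 1 ^+ 3 * 0)); first by ring.
  by rewrite hh; ring.
rewrite inversion_flex0.
have := hb 1; have := hb (-1); move: (s 0 i1 - s 0 i2) (lin (tangent0 c) s) lt => d t t0 hm hp.
have y0 : y != 0.
  apply: contraNneq t0 => y0; apply/eqP; apply: (mulfI three_neq0); apply: (mulfI two_neq0).
  transitivity (3 * t * (1 * (1 + d)) + 3 * t * (-1 * (-1 + d))); first by ring.
  by rewrite hm hp y0; ring.
have xE : x = y * - d.
  apply: (mulfI (expf_neq0 3 e0)); apply: (mulfI k0); apply: (mulfI two_neq0).
  apply/eqP; rewrite -subr_eq0; apply/eqP.
  transitivity ((k * e ^+ 3 * (-1 * (y * -1 - x)) - k * e ^+ 3 * (1 * (y * 1 - x)))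
    + d * (k * e ^+ 3 * (-1 * (y * -1 - x)) + k * e ^+ 3 * (1 * (y * 1 - x)))); first by ring.
  by rewrite -hm -hp; ring.
by exists y; rewrite // xE scalerDr !scalerA mulr1.
Qed.

Lemma cuts_heis c l i j (ss : seq 'rV[C]_3) :
  cuts (hesse c) l [seq p *m heis C i j | p <- ss] <->
  cuts (hesse c) (l *m (heis C i j)^T) ss.
Proof.
have uT := heis_unit C i j; split=> h.
  apply: (@cuts_ext _ (fun v => 1 * hesse c (v *m heis C i j))).
    by move=> v; rewrite mul1r hesse_heis.
  by apply: cuts_mul; rewrite ?oner_neq0.
have -> : l = l *m (heis C i j)^T *m (invmx (heis C i j))^T.
  by rewrite -mulmxA -trmx_mul mulVmx // trmx1 mulmx1.
apply: (@cuts_mulV _ (hesse c) (heis C i j) 1); rewrite ?oner_neq0 //.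
by apply: cuts_ext h => v; rewrite mul1r hesse_heis.
Qed.

Lemma inversionK : N *m N = 1%:M.
Proof. exact: inversion2. Qed.

Lemma invmx_heis i j : invmx (heis C i j) =~ heis C (2 * i) (2 * j).
Proof.
have := sim_mull (invmx (heis C i j)) (heis_inv C i j).
by rewrite -mulmxE mulKmx ?heis_unit // mulmx1 => /sim_sym.
Qed.

(** With [T] the translation by a flex [P], the third point of the chord
    through [P] and [S] is [S *m invmx T *m N *m T], so that this says
    [- (- S - P) = S + P]; it holds as [N] conjugates [T] to its inverse. *)
Lemma heis_chord i j :
  invmx (heis C i j) *m N *m heis C i j *m N =~ heis C i j.
Proof.
have h1 := sim_mulr (N *m heis C i j *m N) (invmx_heis i j).
have h2 := sim_mull (heis C (2 * i) (2 * j)) (inversion_heis C i j).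
have h3 := heis_sim C (2 * i) (2 * j) (2 * i) (2 * j).
rewrite -!mulmxA (mulmxA N); apply: sim_trans h1 (sim_trans h2 _).
apply: sim_trans h3 _.
have h k : (2 * k + 2 * k = k * 3 + k)%N by ring.
by rewrite -heis_mod !h !modnMDl heis_mod; exact: sim_refl.
Qed.

Lemma heis_invN i j : N *m invmx (heis C i j) *m N =~ heis C i j.
Proof.
apply: sim_trans (sim_mulr _ (sim_mull _ (invmx_heis i j))) _.
apply: sim_trans (inversion_heis C _ _) _; rewrite -heis_mod.
have h k : (2 * (2 * k) = k * 3 + k)%N by ring.
by rewrite !h !modnMDl heis_mod; exact: sim_refl.
Qed.

Lemma heis_Ninv i j : N *m heis C i j *m N =~ invmx (heis C i j).
Proof. exact: sim_trans (inversion_heis C i j) (sim_sym (invmx_heis i j)). Qed.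

(** Translating a flex to the origin reduces this to [cuts_flex0]. *)
Lemma cuts_flex c l i j s u : c ^+ 3 != 1 ->
  cuts (hesse c) l [:: o *m heis C i j; s; u] ->
  u *m N =~ s *m heis C i j
  /\ (s =~ o *m heis C i j -> l =~ tangent0 c *m (invmx (heis C i j))^T).
Proof.
set T := heis C i j; move=> c1 h; have uT : T \in unitmx := heis_unit C i j.
have {h} : cuts (hesse c) (l *m T^T) [:: o; s *m invmx T; u *m invmx T].
  by apply/cuts_heis; rewrite /= !mulmxKV.
case/(cuts_flex0 c1) => h1 h2; split=> [|hs].
  rewrite -[u](mulmxKV uT); apply: sim_trans (sim_mulr _ (sim_mulr _ h1)) _.
  by have := sim_mull s (heis_chord i j); rewrite !mulmxA.
have -> : l = l *m T^T *m (invmx T)^T.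
  by rewrite -mulmxA -trmx_mul mulVmx // trmx1 mulmx1.
by apply/sim_mulr/h2; have := sim_mulr (invmx T) hs; rewrite mulmxK.
Qed.

Lemma cuts_flex_exists c i j s : c ^+ 3 != 1 -> s != 0 -> hesse c s = 0 ->
  exists l, cuts (hesse c) l [:: o *m heis C i j; s; s *m heis C i j *m N].
Proof.
set T := heis C i j; move=> c1 s0 hs; have uT : T \in unitmx := heis_unit C i j.
have [||l hl] := @cuts_flex0_exists _ c (s *m invmx T) c1.
- by rewrite mulmx_neq0 // unitmx_inv.
- by rewrite -(hesse_heis c i j) mulmxKV.
exists (l *m (invmx T)^T).
have {}hl : cuts (hesse c) (l *m (invmx T)^T) [:: o *m T; s; s *m invmx T *m N *m T].
  rewrite -[s in [:: _; s; _]](mulmxKV uT); apply/(cuts_heis c _ i j [:: _; _; _]).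
  by rewrite -mulmxA -trmx_mul mulmxV // trmx1 mulmx1.
apply: (cuts_sim3 (sim_refl _) (sim_refl _) (sim_refl _) _ hl).
have := sim_mulr N (sim_mull s (heis_chord i j)).
by rewrite !mulmxA -(mulmxA _ N N) inversionK mulmx1.
Qed.

(** ** Flexes lie on the Hessian *)

(** The determinant of the quadratic form [v |-> pol f p v v / 6]. *)
Definition hess_val c v : C := cubes (- (c ^+ 2 / 4)) (1 - c ^+ 3 / 4) v.

Lemma fhess_hesse c v : fhess (hesse c) v = 27 * hess_val c v.
Proof.
rewrite /fhess [X in \det X]mat3_eta det_mat3; elim/row3P: v => x y z.
set d := fun i : 'I_3 => delta_mx 0 i : 'rV[C]_3.
have d0 : d i0 = row3 1 0 0 by apply/rowP; apply: ord3P; rewrite !mxE.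
have d1 : d i1 = row3 0 1 0 by apply/rowP; apply: ord3P; rewrite !mxE.
have d2 : d i2 = row3 0 0 1 by apply/rowP; apply: ord3P; rewrite !mxE.
have rE i : row i (\matrix_(i, j) (2^-1 * pol (hesse c) (row3 x y z) (d i) (d j))) =
  row3 (2^-1 * pol (hesse c) (row3 x y z) (d i) (d i0))
       (2^-1 * pol (hesse c) (row3 x y z) (d i) (d i1))
       (2^-1 * pol (hesse c) (row3 x y z) (d i) (d i2)).
  by apply/rowP; apply: ord3P; rewrite !mxE.
rewrite !rE det33 d0 d1 d2 /pol !row3D !hesse3 /hess_val cubes3.
by field.
Qed.

(** At a flex the quadratic form [q] of second derivatives vanishes on the
    whole tangent line.  The gradient [g] at [p] is proportional to [l], so
    the cross product of [g] with a vector [e] of the standard basis lies on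
    the line, and [q (cross g e)] equals, modulo the equation of the cubic,
    minus the Hessian times the square of a coordinate of [p]. *)
Lemma cuts_hess_val c l p : cuts (hesse c) l [:: p; p; p] -> hess_val c p = 0.
Proof.
move=> h; have [p0 lp hp] := cuts_on h (mem_head _ _).
have [l0 _ [k k0 hk]] := h; have [n ln] := lin_neq0 l0.
move: p0 lp hp hk {h}; elim/row3P: p => x y z p0 lp hp hk.
pose g := row3 (x ^+ 2 - c * (y * z)) (y ^+ 2 - c * (x * z)) (z ^+ 2 - c * (x * y)).
pose q u := x * u 0 i0 ^+ 2 + y * u 0 i1 ^+ 2 + z * u 0 i2 ^+ 2
  - c * (x * (u 0 i1 * u 0 i2) + y * (u 0 i0 * u 0 i2) + z * (u 0 i0 * u 0 i1)).
have taylor t u : hesse c (1 *: row3 x y z + t *: u) =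
    hesse c (row3 x y z) + 3 * t * lin g u + 3 * t ^+ 2 * q u + t ^+ 3 * hesse c u.
  by elim/row3P: u => u0 u1 u2; rewrite !row3Z row3D !hesse3 lin3 /q !row3E; ring.
(* On [l] the Taylor expansion reduces to its last term. *)
have hq u : lin l u = 0 -> lin g u = 0 /\ q u = 0.
  move=> lu; pose e := k * det3 (row3 x y z) u n ^+ 3 - lin l n ^+ 3 * hesse c u.
  have ht t : lin l n ^+ 3 * (3 * t * lin g u + 3 * t ^+ 2 * q u) = t ^+ 3 * e.
    have := hk (1 *: row3 x y z + t *: u) n.
    rewrite linDr !linZr lp lu !mulr0 addr0 => /(_ erefl).
    rewrite taylor hp !big_cons big_nil det3_sum det3_uu => hh.
    rewrite /e [RHS](_ : _ = k * ((1 * 0 + t * det3 (row3 x y z) u n) *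
      ((1 * 0 + t * det3 (row3 x y z) u n) * ((1 * 0 + t * det3 (row3 x y z) u n) * 1)))
      - lin l n ^+ 3 * (t ^+ 3 * hesse c u)); first by rewrite -hh; ring.
    by ring.
  have hm := ht (-1); have := ht 1; have := ht 2; move: hm.
  move: (lin g u) (q u) e {ht} => t d e hm h2 h1.
  split; apply: (mulfI (expf_neq0 3 ln)); apply: (mulfI three_neq0);
    apply: (mulfI three_neq0); apply: (mulfI two_neq0); rewrite !mulr0.
    transitivity (4 * (lin l n ^+ 3 * (3 * 1 * t + 3 * 1 ^+ 2 * d))
      - 4 * (lin l n ^+ 3 * (3 * -1 * t + 3 * (-1) ^+ 2 * d))
      - (lin l n ^+ 3 * (3 * 2 * t + 3 * 2 ^+ 2 * d))
      + 2 * (lin l n ^+ 3 * (3 * 1 * t + 3 * 1 ^+ 2 * d)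
        + lin l n ^+ 3 * (3 * -1 * t + 3 * (-1) ^+ 2 * d))); first by ring.
    by rewrite h1 h2 hm; ring.
  transitivity (3 * (lin l n ^+ 3 * (3 * 1 * t + 3 * 1 ^+ 2 * d)
    + lin l n ^+ 3 * (3 * -1 * t + 3 * (-1) ^+ 2 * d))); first by ring.
  by rewrite h1 hm; ring.
have [a gE] : exists a, g = a *: l.
  have [->|g0] := eqVneq g 0; first by exists 0; rewrite scale0r.
  by have [a _ ->] := lines_sim l0 g0 (fun v lv => (hq v lv).1); exists a.
have qg u : q (cross g u) = 0.
  have -> : cross g u = a *: cross l u.
    rewrite gE; elim/row3P: l {l0 lp hk ln hq gE} => l0 l1 l2.
    by elim/row3P: u => u0 u1 u2; rewrite row3Z !cross3 row3Z; congr row3; ring.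
  have -> : q (a *: cross l u) = a ^+ 2 * q (cross l u) by rewrite /q !mxE; ring.
  by have [|_ ->] := hq (cross l u); rewrite ?mulr0 // linC lin_crossl.
rewrite hesse3 in hp.
move: p0; rewrite row3_neq0 => /or3P[] h0; apply: (mulfI (expf_neq0 2 h0)); rewrite mulr0.
- rewrite -[RHS]oppr0 -(qg (row3 1 0 0)).
  transitivity ((y * z - c ^+ 2 * x ^+ 2 / 4) * (x ^+ 3 + y ^+ 3 + z ^+ 3 - 3 * c * (x * y * z))
    - q (cross g (row3 1 0 0))); last by rewrite hp mulr0 add0r.
  by rewrite /hess_val cubes3 /q cross3 !row3E; field.
- rewrite -[RHS]oppr0 -(qg (row3 0 1 0)).
  transitivity ((x * z - c ^+ 2 * y ^+ 2 / 4) * (x ^+ 3 + y ^+ 3 + z ^+ 3 - 3 * c * (x * y * z))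
    - q (cross g (row3 0 1 0))); last by rewrite hp mulr0 add0r.
  by rewrite /hess_val cubes3 /q cross3 !row3E; field.
- rewrite -[RHS]oppr0 -(qg (row3 0 0 1)).
  transitivity ((x * y - c ^+ 2 * z ^+ 2 / 4) * (x ^+ 3 + y ^+ 3 + z ^+ 3 - 3 * c * (x * y * z))
    - q (cross g (row3 0 0 1))); last by rewrite hp mulr0 add0r.
  by rewrite /hess_val cubes3 /q cross3 !row3E; field.
Qed.

End ThirdPoint.

(** * The nine base points *)

Section BasePoints.
Variable C : numClosedFieldType.
Implicit Types (l n p q r s u v : 'rV[C]_3) (c : C).
Local Notation o := (flex0 C).
Local Notation w := (omega C).
Local Notation A := (shift C).
Local Notation N := (inversion C).

Lemma heis10 : heis C 1 0 = A.
Proof. by rewrite heis.unlock expr0 mulr1. Qed.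

Lemma flex0_clock j : o *m heis C 0 j = row3 0 (w ^+ j) (- w ^+ (2 * j)).
Proof.
rewrite heis.unlock expr0 mul1r.
elim: j => [|j IHj]; first by rewrite muln0 !expr0 mulmx1.
rewrite exprSr -mulmxE mulmxA IHj clockE mulnS exprD.
by congr row3; rewrite ?exprS; ring.
Qed.

Lemma cube_root1 (t : C) : t ^+ 3 = 1 -> exists j, t = w ^+ j.
Proof.
have w2 := omega_sqr C; move=> t3.
have /eqP : (t - 1) * (t - w) * (t - w ^+ 2) = 0.
  rewrite w2 -[RHS](subrr 1) -[X in _ = X - _]t3 -[X in _ = _ - X](mulr1 1).
  by transitivity (t ^+ 3 - 1 - (t - 1) * (1 + w + w ^+ 2)); [ring | rewrite w2; ring].
rewrite !mulf_eq0 !subr_eq0 -orbA.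
by case/or3P => /eqP->; [exists 0%N | exists 1%N | exists 2%N].
Qed.

Lemma hesse_base_x0 c y z : row3 0 y z != 0 -> hesse c (row3 0 y z) = 0 ->
  exists j, row3 0 y z =~ o *m heis C 0 j.
Proof.
rewrite row3_neq0 eqxx hesse3 /= => yz0 h.
have {}h : y ^+ 3 = - z ^+ 3.
  by apply/eqP; rewrite -addr_eq0 -[X in _ == X]h; apply/eqP; ring.
have y0 : y != 0.
  move: yz0; case/orP => // z0; apply: contraNneq z0 => y0.
  by move: h; rewrite y0 expr0n => /esym/eqP; rewrite oppr_eq0 expf_eq0.
have [|j tj] := @cube_root1 (- z / y); first by rewrite expr_div_n exprNn -[z ^+ 3]opprK -h; field.
exists j, (y / w ^+ j); first by rewrite mulf_neq0 ?invr_eq0 ?omegaX_neq0.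
have wj := omegaX_neq0 C j; rewrite flex0_clock row3Z mulr0; congr row3.
  by rewrite divfK.
by rewrite mul2n -addnn exprD mulrN mulrA divfK // -tj; field.
Qed.

(** A combination of the two equations is [(1 - c ^+ 3) * (x * y * z)], so a
    coordinate vanishes and the ratio of the other two is the opposite of a
    cube root of unity. *)
Lemma hesse_base c p : c ^+ 3 != 1 -> p != 0 -> hesse c p = 0 -> hess_val c p = 0 ->
  exists i j, p =~ o *m heis C i j.
Proof.
move=> c1 p0 hp hH.
have {}hH : p 0 i0 * p 0 i1 * p 0 i2 = 0.
  apply: (@mulfI _ (1 - c ^+ 3)); first by rewrite subr_eq0 eq_sym.
  rewrite mulr0 -[RHS](addr0 0) -[X in _ = X + _]hH -[X in _ = _ + X](mulr0 (c ^+ 2 / 4)) -hp.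
  by rewrite /hess_val /hesse /cubes; field.
have step i j q : q *m A =~ o *m heis C i j -> q =~ o *m heis C (i + 2) j.
  move=> h; have A2 : q *m A *m heis C 2 0 = q.
    rewrite -heis10 -mulmxA mulmxE heisM mul0n expr0 scale1r addn0.
    by rewrite -heis_mod modnn heis00 mulmx1.
  rewrite -{1}A2; apply: sim_trans (sim_mulr _ h) _; rewrite -mulmxA mulmxE.
  by apply: sim_mull; apply: sim_trans (heis_sim _ _ _ _ _) _; rewrite addn0; apply: sim_refl.
have hA q : q != 0 -> q *m A != 0.
  by apply: mulmx_neq0; rewrite -heis10 heis_unit.
have hesseA q : hesse c (q *m A) = hesse c q by exact: cubes_shift.
move: p0 hp hH; elim/row3P: p => x y z p0 hp; rewrite !row3E => /eqP.
rewrite !mulf_eq0 -orbA => /or3P[] /eqP h; rewrite h in p0 hp *.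
- by have [j hj] := hesse_base_x0 p0 hp; exists 0%N, j.
- have [||j hj] := @hesse_base_x0 c z x.
  + by rewrite -(shiftE x 0 z) hA.
  + by rewrite -(shiftE x 0 z) hesseA.
  by exists (0 + 2)%N, j; apply: step; rewrite shiftE.
- have [||j hj] := @hesse_base_x0 c x y.
  + by rewrite -(shiftE y 0 x) -(shiftE x y 0) !hA.
  + by rewrite -(shiftE y 0 x) -(shiftE x y 0) !hesseA.
  by exists (0 + 2 + 2)%N, j; apply: (step); apply: (step); rewrite !shiftE.
Qed.

Lemma cubes_flex a b i j : cubes a b (o *m heis C i j) = 0.
Proof. by rewrite cubes_heis cubes3; ring. Qed.

Lemma flex_neq0 i j : o *m heis C i j != 0.
Proof. by rewrite mulmx_neq0 ?heis_unit ?flex0_neq0. Qed.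

End BasePoints.

(** * Cubics in Hesse form *)

Section Frame.
Variable C : numClosedFieldType.
Implicit Types (l n p q r s u v : 'rV[C]_3) (c : C).
Implicit Types (F : {mpoly C[3]}) (P Q R T W : P2 C).
Local Notation o := (flex0 C).
Local Notation w := (omega C).
Local Notation N := (inversion C).

(** A choice of coordinates in which the cubic is in Hesse form.  The
    descriptions below of the 3-torsion, its group law and its Weil pairing
    depend on the cubic through [M] only. *)
Definition hesse_frame F (M : 'M[C]_3) a c : Prop :=
  [/\ M \in unitmx, a != 0, c ^+ 3 != 1 & forall v, fval F (v *m M) = a * hesse c v].

Variables (F : {mpoly C[3]}) (M : 'M[C]_3) (a c : C).
Hypotheses (hF : F \is 3.-homog) (hM : hesse_frame F M a c).

Let uM : M \in unitmx. Proof. by case: hM. Qed.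
Let a0 : a != 0. Proof. by case: hM. Qed.
Let c1 : c ^+ 3 != 1. Proof. by case: hM. Qed.
Let FE v : fval F (v *m M) = a * hesse c v. Proof. by case: hM. Qed.

Lemma frame_coords P : coords P =~ (coords P *m invmx M) *m M.
Proof. by rewrite mulmxKV //; apply: sim_refl. Qed.

Lemma frame_section l P Q R p q r :
  coords P =~ p *m M -> coords Q =~ q *m M -> coords R =~ r *m M ->
  line_section F l P Q R -> cuts (hesse c) (l *m M^T) [:: p; q; r].
Proof.
move=> hP hQ hR /(line_sectionP _ _ _ _ hF)/(cuts_sim3 (sim_refl l) hP hQ hR) h.
have ai : a^-1 != 0 by rewrite invr_eq0.
by apply: cuts_ext (cuts_mul uM ai (s := [:: p; q; r]) h) => v; rewrite FE mulKf.
Qed.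

Lemma frame_section_exists l P Q R p q r :
  coords P =~ p *m M -> coords Q =~ q *m M -> coords R =~ r *m M ->
  cuts (hesse c) l [:: p; q; r] -> exists l', line_section F l' P Q R.
Proof.
move=> hP hQ hR h; exists (l *m (invmx M)^T); apply/(line_sectionP _ _ _ _ hF).
apply: (cuts_sim3 (sim_refl _) (sim_sym hP) (sim_sym hQ) (sim_sym hR)).
have ai : a^-1 != 0 by rewrite invr_eq0.
apply: (@cuts_mulV _ (fval F) M a^-1 l [:: p; q; r]) => //.
by apply: cuts_ext h => v; rewrite FE mulKf.
Qed.

Lemma frame_on_curve P p : coords P =~ p *m M -> on_curve F P = (hesse c p == 0).
Proof.
case=> b b0 PE; rewrite /on_curve -/(fval F (coords P)) PE cubicZ; last exact: fval_cubic.
by rewrite mulf_eq0 expf_eq0 (negPf b0) /= FE mulf_eq0 (negPf a0).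
Qed.

Lemma frame_neq0 P p : coords P =~ p *m M -> p != 0.
Proof.
move=> h; apply: contraNneq (coords_neq0 P) => p0; move: h; rewrite p0 mul0mx.
by case=> b _ ->; rewrite scaler0.
Qed.

Lemma frame_proj p : p != 0 -> coords (proj (p *m M)) =~ p *m M.
Proof. by move=> p0; apply/coords_proj/mulmx_neq0. Qed.

Lemma frame_inj p q (P : P2 C) : coords P =~ p *m M -> coords P =~ q *m M -> p =~ q.
Proof.
move=> hp hq; have := sim_mulr (invmx M) (sim_trans (sim_sym hp) hq).
by rewrite !mulmxK.
Qed.

Variable O : P2 C.
Hypothesis hO : coords O =~ o *m M.
Let E := PointedCubic F O.

(** Both lines in the definition of the sum pass through a flex, so that
    [cuts_flex] gives their third points. *)
Lemma frame_add P Q R s i j : coords P =~ o *m heis C i j *m M -> coords Q =~ s *m M ->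
  ec_add E P Q R <-> hesse c s = 0 /\ coords R =~ s *m heis C i j *m M.
Proof.
have o0M X : coords X =~ o *m M -> coords X =~ o *m heis C 0 0 *m M.
  by rewrite heis00 mulmx1.
move=> hP hQ; split=> [[l [l' [D [h h']]]]|[hs hR]].
  have hD := frame_coords D; have hR := frame_coords R.
  have {}h := frame_section hP hQ hD h; split.
    by have [] := cuts_on h (p := s); rewrite // !inE eqxx orbT.
  have /cuts_rot h'' := frame_section hD (o0M _ hO) hR h'.
  have [h1 _] := cuts_flex c1 h; have [h2 _] := cuts_flex c1 h''.
  apply: sim_trans hR _; apply: sim_mulr; rewrite heis00 mulmx1 in h2.
  exact: sim_trans (sim_sym h2) h1.
have s0 := frame_neq0 hQ.
have u0 : s *m heis C i j *m N != 0.
  by rewrite !mulmx_neq0 ?inversion_unit ?heis_unit.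
have hu := frame_proj u0; have [l h] := cuts_flex_exists i j c1 s0 hs.
have [l1 h1] := frame_section_exists hP hQ hu h.
have [|l' h'] := cuts_flex_exists 0 0 c1 u0.
  by rewrite hesse_inversion hesse_heis.
have {}h' : cuts (hesse c) l' [:: s *m heis C i j *m N; o *m heis C 0 0; s *m heis C i j].
  apply/cuts_rot/cuts_rot/cuts_swap; move: h'.
  by rewrite heis00 !mulmx1 -(mulmxA _ N N) inversionK mulmx1.
have [l2 h2] := frame_section_exists hu (o0M _ hO) hR h'.
by exists l1, l2, (proj (s *m heis C i j *m N *m M)).
Qed.

(** The origin is a flex, so that [P], [Q] and the origin are collinear. *)
Lemma frame_opp P Q s : coords P =~ s *m M ->
  ec_add E P Q O -> hesse c s = 0 /\ coords Q =~ s *m N *m M.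
Proof.
move=> hP [l [l' [D [h h']]]].
have hD := frame_coords D; have hQ := frame_coords Q.
have o0M X : coords X =~ o *m M -> coords X =~ o *m heis C 0 0 *m M.
  by rewrite heis00 mulmx1.
have /cuts_rot h1 := frame_section hD (o0M _ hO) (o0M _ hO) h'.
have [] := cuts_flex c1 h1; rewrite heis00 !mulmx1 => h2 _.
have {}hD : coords D =~ o *m heis C 0 0 *m M.
  rewrite heis00 mulmx1; apply: sim_trans hD _; apply: sim_mulr.
  have := sim_mulr N h2; rewrite -mulmxA inversionK mulmx1 => h3.
  apply: sim_trans h3 _; rewrite flex0_inversion -scaleN1r.
  by apply: simZl; rewrite oppr_eq0 oner_eq0.
have /cuts_rot/cuts_rot h3 := frame_section hP hQ hD h.
have [h4 _] := cuts_flex c1 h3; split.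
  by have [] := cuts_on h3 (p := s); rewrite // !inE eqxx orbT.
apply: sim_trans hQ _; apply: sim_mulr; have := sim_mulr N h4.
by rewrite heis00 mulmx1 -mulmxA inversionK mulmx1.
Qed.

Lemma cuts_origin : exists l, cuts (hesse c) l [:: o; o; o].
Proof.
have [||l] := @cuts_flex_exists _ c 0 0 o c1; first exact: flex0_neq0.
  by rewrite hesse3; ring.
rewrite heis00 !mulmx1 flex0_inversion => h; exists l.
apply: (cuts_sim3 (sim_refl _) (sim_refl _) (sim_refl _) _ h).
by rewrite -scaleN1r; apply: simZl; rewrite oppr_eq0 oner_eq0.
Qed.

Lemma heis_sq i j : heis C i j *m heis C i j =~ heis C (2 * i) (2 * j).
Proof. by rewrite !mul2n -!addnn; exact: heis_sim. Qed.

Lemma frame_opp_exists P Q s : coords P =~ s *m M -> hesse c s = 0 ->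
  coords Q =~ s *m N *m M -> ec_add E P Q O.
Proof.
move=> hP hs hQ.
have o0M X : coords X =~ o *m M -> coords X =~ o *m heis C 0 0 *m M.
  by rewrite heis00 mulmx1.
have [l] := cuts_flex_exists 0 0 c1 (frame_neq0 hP) hs.
rewrite heis00 !mulmx1 => /cuts_rot h.
have [l1 h1] := frame_section_exists hP hQ hO h.
have [l2 h2] := cuts_origin; have [l3 h3] := frame_section_exists hO hO hO h2.
by exists l1, l3, O.
Qed.

(** If [3 P = O] then the line through [P], [P] and [- 2 P] is a flex tangent
    since [- 2 P = P]; flexes are base points by [cuts_hess_val]. *)
Lemma frame_torsion P :
  torsion3 E P <-> exists i j, coords P =~ o *m heis C i j *m M.
Proof.
have o0M X : coords X =~ o *m M -> coords X =~ o *m heis C 0 0 *m M.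
  by rewrite heis00 mulmx1.
split=> [[cP [Q [[l [l' [D [h h']]]] hQ]]]|[i [j hP]]].
  have hP := frame_coords P; have hD := frame_coords D.
  have hQ' := frame_coords Q; have [hq hPQ] := frame_opp hQ' hQ.
  have pq := frame_inj hP hPQ.
  have {}h := frame_section hP hP hD h.
  have /cuts_rot h'' := frame_section hD (o0M _ hO) hQ' h'.
  have [h2 _] := cuts_flex c1 h''.
  have {h2} h2 := sim_mulr N h2.
  rewrite heis00 mulmx1 -!(mulmxA _ N N) inversionK !mulmx1 in h2.
  have {}h := cuts_sim3 (sim_refl _) (sim_refl _) (sim_refl _)
    (sim_trans h2 (sim_sym pq)) h.
  have [_ _ hs] := cuts_on h (mem_head _ _).
  have [i [j hij]] := hesse_base c1 (frame_neq0 hP) hs (cuts_hess_val h).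
  by exists i, j; apply: sim_trans hP (sim_mulr _ hij).
have hs := cubes_flex 1 (- 3 * c) i j.
split; first by rewrite (frame_on_curve hP); apply/eqP.
have s0 : o *m heis C i j *m N != 0 by rewrite mulmx_neq0 ?inversion_unit ?flex_neq0.
have hQ := frame_proj s0; exists (proj (o *m heis C i j *m N *m M)).
split; last first.
  apply: frame_opp_exists hQ _ _; first by rewrite hesse_inversion.
  by rewrite -(mulmxA _ N N) inversionK mulmx1.
apply/(frame_add _ hP hP); split=> //; apply: sim_trans hQ _; apply: sim_mulr.
have h1 := sim_mull o (heis_Ninv C i j).
have h2 := sim_mull o (sim_trans (invmx_heis C i j) (sim_sym (heis_sq i j))).
rewrite !mulmxA flex0_inversion in h1; rewrite mulmxA in h2.
apply: sim_trans _ (sim_trans h1 h2).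
by rewrite -scaleN1r -!scalemxAl; apply/sim_sym/simZl; rewrite oppr_eq0 oner_eq0.
Qed.

(** This description, unlike the previous one, involves only equations over
    the field of definition of the cubic, and is stable under Galois. *)
Lemma frame_torsion_hessian P :
  torsion3 E P <-> on_curve F P /\ on_curve (hessian F) P.
Proof.
pose p := coords P *m invmx M; have hP : coords P =~ p *m M := frame_coords P.
have hH : on_curve (hessian F) P = (hess_val c p == 0).
  rewrite /on_curve -/(fval _ _) fval_hessian //.
  have dn : \det M ^+ 2 != 0 by rewrite expf_neq0 // -unitfE -unitmxE.
  have e := fhess_mul M p (fval_cubic hF); rewrite {2}/p mulmxKV // in e.
  transitivity (\det M ^+ 2 * fhess (fval F) (coords P) == 0).
    by rewrite mulf_eq0 (negPf dn).
  rewrite -e (fhess_ext _ FE) fhessZ fhess_hesse.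
  by rewrite mulf_eq0 expf_eq0 (negPf a0) /= mulf_eq0 pnatr_eq0.
rewrite hH (frame_on_curve hP) frame_torsion; split=> [[i [j h]]|[/eqP h1 /eqP h2]].
  have [b b0 pE] := frame_inj hP h.
  by rewrite pE /hesse /hess_val !cubesZ !cubes_flex !mulr0 eqxx.
have [i [j h]] := hesse_base c1 (frame_neq0 hP) h1 h2.
by exists i, j; apply: sim_trans hP (sim_mulr _ h).
Qed.

(** ** The Weil pairing is the commutator of the translations *)

Lemma lin_evalE l P : lin_eval l P = lin l (coords P).
Proof. by []. Qed.

Lemma lin_ratio_frame l m P x l0 m0 al be :
  l *m M^T = al *: l0 -> m *m M^T = be *: m0 -> coords P =~ x *m M ->
  lin_ratio l m P = al / be * (lin l0 x / lin m0 x).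
Proof.
move=> lE mE [g g0 PE]; rewrite /lin_ratio !lin_evalE PE !linZr.
rewrite -!lin_mul lE mE !linZl -mulf_div divff // mul1r.
by rewrite mulf_div.
Qed.

Lemma lin_tangent_inversion x : lin (tangent0 c) (x *m N) = lin (tangent0 c) x.
Proof. by elim/row3P: x => x y z; rewrite inversionE !lin3; ring. Qed.

Lemma heis_quotient i j k m :
  heis C k m *m invmx (heis C i j) =
    w ^+ (j * k) / w ^+ (i * m) *: (invmx (heis C i j) *m heis C k m).
Proof.
have := heis_comm C i j k m; have uT := heis_unit C i j.
have wi := omegaX_neq0 C (i * m); have wj := omegaX_neq0 C (j * k).
move: (heis C i j) (heis C k m) uT => T U uT; rewrite -!mulmxE => h.
have /(congr1 (fun X => (w ^+ (i * m))^-1 *: (invmx T *m X *m invmx T))) := h.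
rewrite -!scalemxAr -!scalemxAl !scalerA !mulmxA mulVmx // mul1mx mulVf // scale1r.
by rewrite -!mulmxA mulmxV // mulmx1 mulrC.
Qed.

(** Write [T] and [U] for the translations by [P] and [Q], and [t] for the
    tangent at the origin, so that the tangents at [P] and [Q] are [t]
    composed with the inverses of [T] and [U].  As [inversion] preserves [t]
    and conjugates translations to their inverses, all factors of the
    definition cancel but [t (S U T^-1) / t (S T^-1 U)], whatever the
    auxiliary point [S]; this is the commutator of [U] and [T^-1]. *)
Lemma frame_weil_val P Q i j k m z : 
  coords P =~ o *m heis C i j *m M -> coords Q =~ o *m heis C k m *m M ->
  weil3 E P Q z -> z = w ^+ (j * k) / w ^+ (i * m).
Proof.
move=> hP hQ [lO [lP [lQ [D [QD [ND [PD []]]]]]]].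
case=> hO3 hP3 hQ3 [hQD hND hPD] [n1 n2 n3 n4] [n5 n6 n7 n8] ->.
have := frame_coords D; move: (coords D *m invmx M) => s hD.
have [hs hQD'] := (frame_add _ hQ hD).1 hQD.
have [_ hND'] := frame_opp hD hND.
have [_ hPD'] := (frame_add _ hP hND').1 hPD.
set T := heis C i j in hP hPD' *; set U := heis C k m in hQ hQD' *.
have uT : T \in unitmx := heis_unit C i j; have uU : U \in unitmx := heis_unit C k m.
have oM X : coords X =~ o *m M -> coords X =~ o *m heis C 0 0 *m M by rewrite heis00 mulmx1.
have [_ /(_ (sim_refl _)) tO] := cuts_flex c1 (frame_section (oM _ hO) (oM _ hO) (oM _ hO) hO3).
have [_ /(_ (sim_refl _)) tP] := cuts_flex c1 (frame_section hP hP hP hP3).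
have [_ /(_ (sim_refl _)) tQ] := cuts_flex c1 (frame_section hQ hQ hQ hQ3).
rewrite heis00 invmx1 trmx1 mulmx1 in tO.
have [aO aO0 lOE] := tO; have [aP aP0 lPE] := tP; have [aQ aQ0 lQE] := tQ.
have on_l l b l0 X x : l *m M^T = b *: l0 -> coords X =~ x *m M ->
  ~~ on_line l X -> lin l0 x != 0.
  move=> lE [g g0 XE]; apply: contraNneq => h.
  by rewrite /on_line lin_evalE XE linZr -lin_mul lE linZl h !mulr0.
rewrite (lin_ratio_frame lPE lOE hQD') (lin_ratio_frame lPE lOE hD).
rewrite (lin_ratio_frame lQE lOE hPD') (lin_ratio_frame lQE lOE hND').
have {}n1 := on_l _ _ _ _ _ lPE hQD' n1; have {}n2 := on_l _ _ _ _ _ lOE hQD' n2.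
have {}n3 := on_l _ _ _ _ _ lPE hD n3; have {}n4 := on_l _ _ _ _ _ lOE hD n4.
have {}n5 := on_l _ _ _ _ _ lQE hPD' n5; have {}n6 := on_l _ _ _ _ _ lOE hPD' n6.
have {}n7 := on_l _ _ _ _ _ lQE hND' n7; have {}n8 := on_l _ _ _ _ _ lOE hND' n8.
rewrite !lin_mul in n1 n3 n5 n7 *.
have NN := inversionK C.
have [x x0 hx] := heis_Ninv C i j; have [y y0 hy] := heis_invN C k m.
rewrite -/T in hx; rewrite -/U in hy.
have e1 : lin (tangent0 c) (s *m N *m T) = x * lin (tangent0 c) (s *m invmx T).
  by rewrite -lin_tangent_inversion -!mulmxA (mulmxA N) hx -scalemxAr linZr.
have e2 : lin (tangent0 c) (s *m N *m invmx U) = y * lin (tangent0 c) (s *m U).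
  by rewrite -lin_tangent_inversion -!mulmxA (mulmxA N) hy -scalemxAr linZr.
have e3 : lin (tangent0 c) (s *m N *m T *m invmx U) =
    x * y * lin (tangent0 c) (s *m invmx T *m U).
  rewrite -lin_tangent_inversion -linZr; congr lin.
  transitivity (s *m (N *m T *m N) *m (N *m invmx U *m N)).
    by rewrite !mulmxA -(mulmxA _ N N) NN mulmx1.
  by rewrite hx hy -!scalemxAr -!scalemxAl scalerA mulrC.
have e4 : lin (tangent0 c) (s *m U *m invmx T) =
    w ^+ (j * k) / w ^+ (i * m) * lin (tangent0 c) (s *m invmx T *m U).
  by rewrite -!mulmxA heis_quotient -scalemxAr linZr.
rewrite e1 in n6 *; rewrite e2 in n7 *; rewrite e3 in n5 *; rewrite e4 lin_tangent_inversion.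
move: n5; rewrite mulf_eq0 negb_or => /andP[_ n5].
have wi := omegaX_neq0 C (i * m).
field.
by rewrite ?n2 ?n3 ?n4 ?n5 ?aO0 ?aP0 ?aQ0 ?x0 ?y0 ?wi.
Qed.

Lemma cuts_flex3 i j :
  exists l, cuts (hesse c) l [:: o *m heis C i j; o *m heis C i j; o *m heis C i j].
Proof.
have [l h] := cuts_origin; exists (l *m (invmx (heis C i j))^T).
apply/(cuts_heis c _ i j [:: o; o; o]).
by rewrite -mulmxA -trmx_mul mulmxV ?heis_unit // trmx1 mulmx1.
Qed.

Lemma tangent_off_base x : hesse c x = 0 -> cubes 0 1 x != 0 -> lin (tangent0 c) x != 0.
Proof.
move=> hx; apply: contraNneq => tx; have [->|x0] := eqVneq x 0.
  by rewrite /cubes !mxE !mulr0 expr0n /= !addr0 mulr0.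
have [b b0 ->] := hesse_tangent c1 x0 hx tx.
by rewrite cubesZ cubes3; apply/eqP; ring.
Qed.

Lemma frame_weil P Q i j k m :
  coords P =~ o *m heis C i j *m M -> coords Q =~ o *m heis C k m *m M ->
  weil3 E P Q (w ^+ (j * k) / w ^+ (i * m)).
Proof.
move=> hP hQ; suff [z h] : exists z, weil3 E P Q z by rewrite -(frame_weil_val hP hQ h).
(* The auxiliary point is off the nine flexes since its coordinates do not
   vanish. *)
have [t] := @solve_monicpoly C 3 (nth 0 [:: - 2; 3 * c; 0]) isT.
rewrite !big_ord_recl big_ord0 /= /bump /= => ht.
pose good x := hesse c x = 0 /\ cubes 0 1 x != 0.
have [s gs] : exists s, good s.
  exists (row3 1 1 t); rewrite /good hesse3 cubes3 ht; split; first by ring.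
  rewrite mul0r add0r !mul1r; apply: contra_eq_neq ht => ->.
  rewrite !expr0n /= !mul0r !mulr0 !addr0 mulr1 eq_sym.
  by rewrite oppr_eq0 pnatr_eq0.
have gT x i' j' : good x -> good (x *m heis C i' j').
  by rewrite /good /hesse !cubes_heis.
have gV x i' j' : good x -> good (x *m invmx (heis C i' j')).
  have e a' b' : cubes a' b' (x *m invmx (heis C i' j')) = cubes a' b' x.
    by rewrite -(cubes_heis _ _ i' j') mulmxKV ?heis_unit.
  by rewrite /good /hesse !e.
have gN x : good x -> good (x *m N).
  case=> h1 h2; split; first by rewrite hesse_inversion.
  move: h2 {h1}; elim/row3P: x => x y z; rewrite inversionE !cubes3.
  by rewrite !mul0r !add0r !mul1r mulrAC.
have g0 x : good x -> x != 0.
  case=> _; apply: contraNneq => ->.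
  by rewrite /cubes !mxE !mulr0 expr0n /= !addr0 mulr0.
have pt x : good x -> coords (proj (x *m M)) =~ x *m M by move=> /g0/frame_proj.
have tang R i' j' : coords R =~ o *m heis C i' j' *m M ->
    exists2 l, line_section F l R R R & forall x, good x -> ~~ on_line l (proj (x *m M)).
  move=> hR; have [l0 h0] := cuts_flex3 i' j'.
  have [l h] := frame_section_exists hR hR hR h0; exists l => // x gx.
  have [_ /(_ (sim_refl _)) [b b0 lE]] := cuts_flex c1 (frame_section hR hR hR h).
  have [g gn0 xE] := pt x gx.
  rewrite /on_line lin_evalE xE linZr -lin_mul lE linZl lin_mul !mulf_eq0 (negPf b0) (negPf gn0) /=.
  by have [h1 h2] := gV x i' j' gx; apply: tangent_off_base.
have hO' : coords O =~ o *m heis C 0 0 *m M by rewrite heis00 mulmx1.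
have [lO hlO nO] := tang _ _ _ hO'; have [lP hlP nP] := tang _ _ _ hP.
have [lQ hlQ nQ] := tang _ _ _ hQ.
have gQS := gT s k m gs; have gNS := gN s gs; have gPS := gT _ i j gNS.
eexists; exists lO, lP, lQ, (proj (s *m M)), (proj (s *m heis C k m *m M)),
  (proj (s *m N *m M)), (proj (s *m N *m heis C i j *m M)).
split; last by [].
- by split.
- split.
  + by apply/(frame_add _ hQ (pt _ gs)); split; [case: gs | apply: pt].
  + by apply: (frame_opp_exists (pt _ gs)); [case: gs | apply: pt].
  + by apply/(frame_add _ hP (pt _ gNS)); split; [case: gNS | apply: pt].
- by split; [apply: nP | apply: nO | apply: nP | apply: nO].
- by split; [apply: nQ | apply: nO | apply: nQ | apply: nO].
Qed.

End Frame.

(** * Reduction of a nonsingular cubic to Hesse form *)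

Section NormalForm.
Variable C : numClosedFieldType.
Implicit Types (f : 'rV[C]_3 -> C) (l p v : 'rV[C]_3).
Local Notation o := (flex0 C).
Local Notation w := (omega C).

Lemma nonsing_ext f f' : f =1 f' -> nonsing f -> nonsing f'.
Proof.
move=> e ns v v0 fv; have [|x hx] := ns v v0; first by rewrite e.
by exists x; rewrite -(pol_ext _ _ _ e).
Qed.

Lemma pol_diag f v : cubic f -> pol f v v v = 6 * f v.
Proof.
by move=> cf; rewrite /pol -[v]scale1r -!scalerDl !cubicZ //; ring.
Qed.

Definition weierstrass (g d : C) v : C :=
  v 0 i0 ^+ 3 + v 0 i2 * (v 0 i1 ^+ 2 + g * (v 0 i0 * v 0 i2) + d * v 0 i2 ^+ 2).

Lemma weierstrass3 g d x y z :
  weierstrass g d (row3 x y z) = x ^+ 3 + z * (y ^+ 2 + g * (x * z) + d * z ^+ 2).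
Proof. by rewrite /weierstrass !row3E. Qed.

(** With a flex at [(0 : 1 : 0)] and tangent [z = 0], a cubic is reduced to
    Weierstrass form by completing a square and a cube. *)
Lemma weierstrass_form f l p : cubic f -> nonsing f -> cuts f l [:: p; p; p] ->
  exists (M : 'M[C]_3) a g d, [/\ M \in unitmx, a != 0, row3 0 1 0 *m M = p
    & forall v, f (v *m M) = a * weierstrass g d v].
Proof.
move=> cf ns h; have [p0 lp fp] := cuts_on h (mem_head _ _).
have [l0 _ [k k0 hk]] := h; have [n ln] := lin_neq0 l0.
have [t [e [e0 lt ct]]] := line_second l0 p0 lp.
have dE : det3 p t n = e * lin l n by rewrite /det3 ct linZl.
have dn : e * lin l n != 0 by rewrite mulf_neq0.
have uM0 : mat3 t p n \in unitmx.
  by rewrite unitmxE unitfE det_mat3 det3_sym dE oppr_eq0.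
have hb b : lin l n ^+ 3 * f (1 *: t + b *: p) = k * (e * lin l n) ^+ 3.
  rewrite hk ?linDr ?linZr ?lt ?lp ?mulr0 ?addr0 // !big_cons big_nil.
  by rewrite !det3_sum det3_uu dE; ring.
have ft : f t != 0.
  apply: contraNneq (mulf_neq0 k0 (expf_neq0 3 dn)) => ft.
  by rewrite -(hb 0) scale1r scale0r addr0 ft mulr0.
have [A0 B0] : pol f t t p / 2 = 0 /\ pol f t p p / 2 = 0.
  have eb b : f (1 *: t + b *: p) = f t.
    rewrite -[t in RHS](addr0 t) -(scale0r p) -{2}[t]scale1r.
    by apply: (mulfI (expf_neq0 3 ln)); rewrite !hb.
  have := eb 1; have := eb (-1); rewrite !cubic_line // fp.
  move: (pol f t t p / 2) (pol f t p p / 2) => A B hm hp.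
  split; apply: (mulfI (two_neq0 C)); rewrite mulr0.
    transitivity ((f t * 1 ^+ 3 + A * (1 ^+ 2 * 1) + B * (1 * 1 ^+ 2) + 0 * 1 ^+ 3)
      - (f t * 1 ^+ 3 + A * (1 ^+ 2 * -1) + B * (1 * (-1) ^+ 2) + 0 * (-1) ^+ 3)); first by ring.
    by rewrite hp hm subrr.
  transitivity ((f t * 1 ^+ 3 + A * (1 ^+ 2 * 1) + B * (1 * 1 ^+ 2) + 0 * 1 ^+ 3)
      + (f t * 1 ^+ 3 + A * (1 ^+ 2 * -1) + B * (1 * (-1) ^+ 2) + 0 * (-1) ^+ 3)
      - 2 * f t); first by ring.
  by rewrite hp hm; ring.
have q0 : pol f p p n != 0.
  have [u hu] := ns p p0 fp; apply: contraNneq hu => q0.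
  rewrite -(mulmxKV uM0 u); elim/row3P: (u *m _) => x y z.
  rewrite row3_mat3 pol_sum3 // q0 (pol_rot f p p t) (pol_rot f p t p).
  have -> : pol f t p p = 0 by rewrite -[LHS](divfK (two_neq0 C)) B0 mul0r.
  by rewrite pol_diag // fp !mulr0 !addr0.
pose q := pol f p p n / 2 / f t.
have qn0 : q != 0 by rewrite /q !mulf_neq0 ?invr_eq0 ?two_neq0.
pose b := pol f t p n / f t / q; pose d := pol f p n n / 2 / f t / q ^+ 2.
pose g := pol f t t n / 2 / f t / q - b ^+ 2 / 4.
pose h1 := pol f t n n / 2 / f t / q ^+ 2 - b * d / 2.
pose m := f n / f t / q ^+ 3 - d ^+ 2 / 4.
(* Complete the square in [y], then the cube in [x]. *)
pose D := mat3 (row3 1 (- b / 2) 0) (row3 0 1 0) (row3 (- g / 3) (b * g / 6 - d / 2) q^-1).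
have uD : D \in unitmx.
  rewrite unitmxE unitfE det_mat3 det33 (_ : _ + _ = q^-1) ?invr_eq0 //; ring.
exists (D *m mat3 t p n), (f t), (h1 - g ^+ 2 / 3), (m - h1 * g / 3 + 2 * g ^+ 3 / 27).
split=> //; first by rewrite unitmx_mul uD.
  by rewrite mulmxA !row3_mat3 !row3Z !row3D row3_mat3 !(mulr0, mul0r, addr0, add0r) !scale0r mulr1 scale1r add0r addr0.
elim/row3P=> x y z; rewrite mulmxA row3_mat3 !row3Z !row3D row3_mat3 cubic_expand // A0 B0 fp.
rewrite weierstrass3 /h1 /m /g /d /b /q; field.
by rewrite q0 ft.
Qed.

(** The parameters describe a flex tangent [y = u x + v z] other than [z = 0];
    [r = u ^+ 2 / 3] is a root of the 3-division polynomial. *)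
Lemma weierstrass_flex (g d : C) : exists u v : C,
  g = u ^+ 4 / 3 - 2 * u * v /\ d = u ^+ 6 / 27 - v ^+ 2.
Proof.
have [r] := @solve_monicpoly C 4 (nth 0 [:: g ^+ 2 / 3; 4 * d; - 2 * g; 0]) isT.
rewrite !big_ord_recl big_ord0 /= /bump /= => hr.
pose u := sqrtC (3 * r); have u2 : u ^+ 2 = 3 * r by rewrite sqrtCK.
have u4 : u ^+ 4 = (u ^+ 2) ^+ 2 by rewrite -exprM.
have u6 : u ^+ 6 = (u ^+ 2) ^+ 3 by rewrite -exprM.
have [u0|u0] := eqVneq u 0.
  have r0 : r = 0.
    by apply: (mulfI (three_neq0 C)); rewrite -u2 u0 expr0n mulr0.
  have g0 : g = 0.
    move: hr; rewrite r0 !expr0n /= !mulr0 !addr0 mulr1 => /esym/eqP.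
    by rewrite mulf_eq0 invr_eq0 pnatr_eq0 orbF expf_eq0 => /eqP.
  exists u, (sqrtC (- d)); rewrite u0 g0 sqrtCK !expr0n /=.
  by split; ring.
exists u, ((u ^+ 4 / 3 - g) / (2 * u)); split; first by field.
rewrite expr_div_n exprMn u6 u4 u2.
have r0 : r != 0.
  by apply: contraNneq (expf_neq0 2 u0) => r0; rewrite u2 r0 mulr0.
have g2 : g ^+ 2 = 3 * r ^+ 4 + 6 * g * r ^+ 2 - 12 * d * r by rewrite hr; field.
transitivity ((3 * r) ^+ 3 / 27 - (((3 * r) ^+ 2 / 3) ^+ 2
  - 2 * ((3 * r) ^+ 2 / 3) * g + g ^+ 2) / (2 ^+ 2 * (3 * r))); last by field.
by rewrite g2; field.
Qed.

(** In terms of [l = x + u ^+ 2 / 3 * z], the Weierstrass cubic is [l ^+ 3]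
    plus the product of the flex tangents [z], [y - u * x - v * z] and
    [y + u * x + v * z], whose flexes lie on the line [l].  A Hesse cubic
    decomposes likewise, as the product of the three tangents
    [c * x + w ^+ i * y + w ^- i * z] plus [(1 - c ^+ 3) * x ^+ 3].  The matrix
    [L] matches the two decompositions: multiples of the tangents are to have
    the sum [3 * c * x], which fixes [D] and [c], and the coefficient of the
    cube then fixes [theta].  If [D] or [theta] were zero the cubic would be
    singular, at [(- u ^+ 2 / 3 : 0 : 1)] or [(u ^+ 2 / 9 : 0 : 1)]. *)
Lemma weierstrass_hesse (g d : C) : nonsing (weierstrass g d) ->
  exists (L : 'M[C]_3) b c, [/\ L \in unitmx, b != 0, c ^+ 3 != 1,
    row3 0 1 0 *m L =~ o & forall v, hesse c (v *m L) = b * weierstrass g d v].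
Proof.
have [u [v [-> ->]]] := weierstrass_flex g d; move=> ns.
pose D := v - u ^+ 3 / 3; pose r := u ^+ 2 / 3.
have nz x : (forall e0 e1 e2, pol (weierstrass (u ^+ 4 / 3 - 2 * u * v) (u ^+ 6 / 27 - v ^+ 2))
     (row3 x 0 1) (row3 x 0 1) (row3 e0 e1 e2) = 0) ->
   weierstrass (u ^+ 4 / 3 - 2 * u * v) (u ^+ 6 / 27 - v ^+ 2) (row3 x 0 1) = 0 -> False.
  move=> h h0; have [||e] := ns (row3 x 0 1); rewrite ?row3_neq0 ?oner_neq0 ?orbT //.
  by elim/row3P: e => e0 e1 e2; rewrite h eqxx.
have D0 : D != 0.
  apply/eqP => D0; have vE : v = u ^+ 3 / 3 by apply/eqP; rewrite -subr_eq0; apply/eqP.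
  apply: (nz (- r)) => [e0 e1 e2|]; rewrite vE ?weierstrass3 /r; last by field.
  by rewrite /pol !row3D !weierstrass3; field.
pose theta := 3.-root (2 * v - 10 * u ^+ 3 / 27).
have theta3 : theta ^+ 3 = 2 * v - 10 * u ^+ 3 / 27 by rewrite rootCK.
have theta0 : theta != 0.
  apply/eqP => t0; have vE : v = 5 * u ^+ 3 / 27.
    have : 2 * v - 10 * u ^+ 3 / 27 = 0 by rewrite -theta3 t0 expr0n.
    by move/eqP; rewrite subr_eq0 => /eqP h; apply: (mulfI (two_neq0 C)); rewrite h; field.
  apply: (nz (u ^+ 2 / 9)) => [e0 e1 e2|]; rewrite vE ?weierstrass3; last by field.
  by rewrite /pol !row3D !weierstrass3; field.
pose c := 2 * u / (3 * theta); pose s := (w ^+ 2 - w) / 3.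
have w2 := omega_sqr C.
have s2 : s ^+ 2 = - 1 / 3.
  rewrite /s w2; transitivity ((1 + 4 * w + 4 * w ^+ 2) / 9); first by field.
  by rewrite w2; field.
have s0 : s != 0.
  apply: contra_eq_neq s2 => ->; rewrite expr0n /= eq_sym.
  by rewrite mulf_neq0 ?oppr_eq0 ?oner_neq0 ?invr_eq0 ?three_neq0.
pose L := mat3 (row3 theta (- u / 3) (- u / 3)) (row3 0 s (- s))
  (row3 (theta * r) (- (2 * D + v) / 3) (- (2 * D + v) / 3)).
have cE : (1 - c ^+ 3) * theta ^+ 3 = 2 * D.
  transitivity (theta ^+ 3 - 8 * u ^+ 3 / 27); first by rewrite /c; field.
  by rewrite theta3 /D; field.
have td0 := mulf_neq0 (mulf_neq0 (mulf_neq0 (two_neq0 C) theta0) s0) D0.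
exists L, (2 * D), c; split.
- rewrite unitmxE unitfE det_mat3 det33 (_ : _ + _ = - (2 * theta * s * D)).
    by rewrite oppr_eq0 (negPf td0).
  by rewrite /D /r; field.
- exact: mulf_neq0 (two_neq0 C) D0.
- apply: contraNneq D0 => c1; move: cE; rewrite c1 subrr mul0r => /esym/eqP.
  by rewrite mulf_eq0 (negPf (two_neq0 C)).
- by exists s => //; rewrite row3_mat3 !row3Z !row3D; congr row3; ring.
elim/row3P=> x y z; rewrite row3_mat3 !row3Z !row3D hesse3 weierstrass3.
pose m := - (u * x + (2 * D + v) * z) / 3.
have cx : 3 * c * (theta * (x + r * z)) = 2 * u * (x + r * z) by rewrite /c; field.
transitivity (theta ^+ 3 * (x + r * z) ^+ 3 + 2 * m ^+ 3 + 6 * m * s ^+ 2 * y ^+ 2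
  - 3 * c * (theta * (x + r * z)) * (m ^+ 2 - s ^+ 2 * y ^+ 2)).
  by rewrite /m; field.
by rewrite cx s2 theta3 /m /r /D; field.
Qed.

Implicit Types (F G : {mpoly C[3]}) (M : 'M[C]_3) (O : P2 C).

Theorem hesse_frame_exists F O : F \is 3.-homog -> nonsingular F -> is_flex F O ->
  exists M a c, hesse_frame F M a c /\ coords O =~ o *m M.
Proof.
move=> hF /(nonsingularP hF) ns [l /(line_sectionP _ _ _ _ hF) h].
have [M [a [g [d [uM a0 Mp fE]]]]] := weierstrass_form (fval_cubic hF) ns h.
have nsW : nonsing (weierstrass g d).
  apply: nonsing_ext (@nonsing_mul _ _ M a^-1 uM _ ns); last by rewrite invr_eq0.
  by move=> v /=; rewrite fE mulKf.
have [L [b [c [uL b0 c1 oL hL]]]] := weierstrass_hesse nsW.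
exists (invmx L *m M), (a / b), c; split; last first.
  rewrite -Mp mulmxA; apply: sim_mulr.
  by have := sim_mulr (invmx L) oL; rewrite mulmxK.
split=> //; first by rewrite unitmx_mul unitmx_inv uL.
  by rewrite mulf_neq0 ?invr_eq0.
by move=> v; rewrite mulmxA fE -{2}(mulmxKV uL v) hL mulrA divfK.
Qed.

(** ** The pencil spanned by a cubic and its Hessian *)

Lemma frame_hessian F M a c v : F \is 3.-homog -> hesse_frame F M a c ->
  fval (hessian F) (v *m M) = 27 * a ^+ 3 / \det M ^+ 2 * hess_val c v.
Proof.
move=> hF [uM a0 c1 FE]; rewrite fval_hessian //.
have := fhess_mul M v (fval_cubic hF); rewrite (fhess_ext _ FE) fhessZ fhess_hesse => h.
have d0 : \det M != 0 by rewrite -unitfE -unitmxE.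
apply: (mulfI (expf_neq0 2 d0)); rewrite -h; field.
exact: d0.
Qed.

(** Otherwise the curve is singular at [(1 : 0 : 0)], or at
    [(c ^+ 2 : 1 : 1)] when [c ^+ 3 = 1]. *)
Lemma nonsing_cubes a b : nonsing (cubes a b : _ -> C) ->
  a != 0 /\ (- b / (3 * a)) ^+ 3 != 1.
Proof.
move=> ns; have a0 : a != 0.
  apply/eqP => a0; have [||u] := ns (row3 1 0 0); rewrite ?row3_neq0 ?oner_neq0 //.
    by rewrite a0 cubes3; ring.
  by elim/row3P: u => u0 u1 u2; rewrite a0 /pol !row3D !cubes3; case/eqP; ring.
split=> //; set c := _ / _; apply/eqP => c1.
have [||u] := ns (row3 (c ^+ 2) 1 1); rewrite ?row3_neq0 ?oner_neq0 ?orbT //.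
  rewrite cubes_hesse // -/c hesse3.
  transitivity (a * (c ^+ 3 ^+ 2 + 2 - 3 * c ^+ 3)); first by ring.
  by rewrite c1; ring.
elim/row3P: u => u0 u1 u2; rewrite (pol_ext _ _ _ (fun v => cubes_hesse b v a0)) -/c.
case/eqP; rewrite polZ /pol !row3D !hesse3.
transitivity (a * 6 * (c * u0 * (c ^+ 3 - 1) - (c ^+ 3 - 1) * (u1 + u2))).
  by ring.
by rewrite c1; ring.
Qed.

Lemma cubes_frame G M a b : M \in unitmx -> nonsing (fval G) ->
  (forall v, fval G (v *m M) = cubes a b v) ->
  exists a' c', hesse_frame G M a' c'.
Proof.
move=> uM ns GE; have nsC : nonsing (cubes a b).
  apply: nonsing_ext (@nonsing_mul _ _ M 1 uM (oner_neq0 _) ns) => v /=.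
  by rewrite mul1r GE.
have [a0 c1] := nonsing_cubes nsC; exists a, (- b / (3 * a)); split=> // v.
by rewrite GE cubes_hesse.
Qed.

Lemma pencil_cubes F M a c la mu : F \is 3.-homog -> hesse_frame F M a c ->
  exists a' b', forall v,
    la * fval F (v *m M) + mu * fval (hessian F) (v *m M) = cubes a' b' v.
Proof.
move=> hF hM; have [uM a0 c1 FE] := hM; set K := 27 * a ^+ 3 / \det M ^+ 2.
exists (la * a - mu * K * (c ^+ 2 / 4)),
  (la * a * (- 3 * c) + mu * K * (1 - c ^+ 3 / 4)) => v.
by rewrite FE (frame_hessian _ hF hM) -/K /hess_val /hesse /cubes; field.
Qed.

(** The coefficients solve a linear system of determinant proportional to
    [1 - c ^+ 3]. *)
Lemma cubes_pencil F M a c a' b' : F \is 3.-homog -> hesse_frame F M a c ->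
  exists la mu, forall v,
    la * fval F (v *m M) + mu * fval (hessian F) (v *m M) = cubes a' b' v.
Proof.
move=> hF hM; have [uM a0 c1 FE] := hM.
have d0 : \det M != 0 by rewrite -unitfE -unitmxE.
have k0 : 1 - c ^+ 3 != 0 by rewrite subr_eq0 eq_sym.
pose mu := (b' + 3 * c * a') / (27 * a ^+ 3 / \det M ^+ 2 * (1 - c ^+ 3)).
exists ((a' + mu * (27 * a ^+ 3 / \det M ^+ 2) * (c ^+ 2 / 4)) / a), mu => v.
rewrite FE (frame_hessian _ hF hM) /mu /hess_val /hesse /cubes; field.
by rewrite a0 d0 k0.
Qed.

Lemma pencil_inj F M a c la mu la' mu' : F \is 3.-homog -> hesse_frame F M a c ->
  (forall v, la * fval F v + mu * fval (hessian F) v =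
             la' * fval F v + mu' * fval (hessian F) v) ->
  la = la' /\ mu = mu'.
Proof.
move=> hF hM h; have [uM a0 c1 FE] := hM.
have d0 : \det M != 0 by rewrite -unitfE -unitmxE.
have k0 : 1 - c ^+ 3 != 0 by rewrite subr_eq0 eq_sym.
have h1 := h (row3 1 0 0 *m M); have h2 := h (row3 1 1 1 *m M).
rewrite !FE !(frame_hessian _ hF hM) /hess_val /hesse !cubes3 in h1 h2.
set K := 27 * a ^+ 3 / \det M ^+ 2 in h1 h2.
have K0 : K != 0 by rewrite /K !mulf_neq0 ?invr_eq0 ?expf_neq0 // pnatr_eq0.
move/eqP: h1; rewrite -subr_eq0 => /eqP h1; move/eqP: h2; rewrite -subr_eq0 => /eqP h2.
have mm : mu = mu'.
  apply: (mulfI k0); apply: (mulfI K0); apply/eqP; rewrite -subr_eq0; apply/eqP.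
  transitivity ((3 * c - 3) * 0 + 0 : C); last by ring.
  by rewrite -[X in _ = _ + X]h2 -[X in _ = _ * X + _]h1; field.
split=> //; apply: (mulfI a0); apply/eqP; rewrite -subr_eq0; apply/eqP.
by rewrite -[RHS]h1 mm; ring.
Qed.

End NormalForm.

(** * Galois descent *)

Section Descent.
Variables (k : fieldExtType rat) (iota : {rmorphism k -> algC}).

(** [L] is the splitting field of the minimal polynomial of a primitive
    element of the field generated by [k] and [x]. *)
Lemma normal_closure_exists (x : algC) :
  exists (L : splittingFieldType rat) (LC : {rmorphism L -> algC}),
    (exists y, LC y = x) /\ (forall a, exists b, iota a = LC b).
Proof.
pose b0 := vbasis {:k}.
have [z _ /sig_eqW[[|px ps] // [Dx Ds]]] := algC_PET (x :: map iota b0).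
have [p [_ mon_p] /(_ p) pz0] := minCpolyP z; rewrite dvdpp in pz0.
have [r Dr] := closed_field_poly_normal (map_poly ratr p : {poly algC}).
rewrite lead_coef_map (monicP mon_p) rmorph1 scale1r in Dr.
have {pz0} rz : z \in r by rewrite -root_prod_XsubC -Dr.
have [Qr [QrC [rr Drr genQr]]] := num_field_exists r.
have Sinj_poly q : map_poly QrC (map_poly (in_alg Qr) q) = map_poly ratr q.
  rewrite -map_poly_comp; apply: eq_map_poly => a.
  by rewrite /= rmorphZ_num rmorph1 mulr1.
have [zz Dz] : exists zz, QrC zz = z.
  by move: rz; rewrite -Drr => /mapP[zz _ ->]; exists zz.
have in_Qr (q : {poly rat}) : QrC (map_poly (in_alg Qr) q).[zz] = (map_poly ratr q).[z].
  by rewrite -horner_map Dz Sinj_poly.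
have splitQr : splitting_field_axiom Qr.
  exists (map_poly (in_alg Qr) p).
    by apply/polyOverP=> i; rewrite coef_map memvZ ?memv_line.
  exists rr => //; congr (_ %= _): (eqpxx (map_poly (in_alg Qr) p)).
  apply/(map_poly_inj QrC); rewrite Sinj_poly Dr -Drr big_map rmorph_prod /=.
  by apply: eq_bigr => t _; rewrite map_polyXsubC.
pose mix := FieldExt_isSplittingField.Build rat Qr splitQr.
pose L : splittingFieldType rat := HB.pack (FieldExt.sort Qr) mix.
exists L, QrC; split; first by exists (map_poly (in_alg Qr) px).[zz]; rewrite in_Qr.
move=> a; exists (\sum_i coord b0 i a *: (map_poly (in_alg Qr) ps`_i).[zz]).
rewrite {1}(coord_vbasis (memvf a)) !rmorph_sum /=; apply: eq_bigr => i _.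
rewrite 2!rmorphZ_num -(nth_map _ 0) ?size_tuple // Ds in_Qr (nth_map 0) //.
by have:= congr1 size Ds; rewrite !size_map size_tuple => <-.
Qed.

(** Automorphisms over [k] of a normal closure extend to [algC], so that Galois
    theory applies in the closure. *)
Lemma galois_fixed (x : algC) :
  (forall sigma : {rmorphism algC -> algC}, sigma \o iota =1 iota -> sigma x = x) ->
  exists y, iota y = x.
Proof.
move=> fix_x; have [L [LC [[x0 x0E] inL]]] := normal_closure_exists x.
pose j a := sval (sig_eqW (inL a)).
have jE a : iota a = LC (j a) by rewrite /j; case: (sig_eqW _).
pose rwM := (=^~ jE, rmorphZ_num, rmorph1, rmorphB, rmorphM).
have ja : zmod_morphism j by move=> ? ?; apply: (fmorph_inj LC); rewrite !rwM.
have jm : monoid_morphism j.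
  by split; try move=> ? ?; apply: (fmorph_inj LC); rewrite !rwM /= ?rwM.
have jl : scalable j by move=> ? ?; apply: (fmorph_inj LC); rewrite !rwM.
pose jaM := GRing.isZmodMorphism.Build _ _ j ja.
pose jmM := GRing.isMonoidMorphism.Build _ _ j jm.
pose jlM := GRing.isScalable.Build _ _  _ _ j jl.
pose jLRM : {lrmorphism _ -> _} := HB.pack j jaM jmM jlM.
pose K := (linfun jLRM @: fullv)%VS.
have memK y : reflect (exists a, y = j a) (y \in K).
  apply: (iffP memv_imgP) => [[a _ ->] | [a ->]];
    by exists a; rewrite ?lfunE ?memvf.
have algK : is_aspace K.
  rewrite /is_aspace has_algid1; last by apply/memK; exists 1; rewrite jm.
  apply/prodvP=> _ _ /memK[y1 ->] /memK[y2 ->].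
  by apply/memK; exists (y1 * y2); rewrite jm.
have galL : galois (ASpace algK) {:L}.
  have [p Kp splitp] := splittingFieldP L.
  apply/and3P; split; first exact: subvf.
    apply/separableP => y _; apply: contraT => /separablePn_pchar[q].
    by rewrite (pchar_lalg L) (pchar_num rat).
  exact: normalFieldf.
have : x0 \in fixedField 'Gal({:L} / ASpace algK)%g.
  apply/fixedFieldP; rewrite ?memvf // => s galS.
  have [nu Dnu] := extend_algC_subfield_aut LC s.
  apply: (fmorph_inj LC); rewrite Dnu x0E; apply: fix_x => a /=.
  rewrite jE -Dnu; congr (LC _).
  by apply: (fixed_gal (subvf (ASpace algK)) galS); apply/memK; exists a.
move/galois_fixedField: galL => -> /memK[a aE].
by exists a; rewrite jE -aE.
Qed.

End Descent.

(** * Symplectic automorphisms are induced by the Hessian group *)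

Section HessianGroup.
Variable C : numClosedFieldType.
Implicit Types (v : 'rV[C]_3) (R M : 'M[C]_3).
Local Notation o := (flex0 C).
Local Notation w := (omega C).
Local Notation A := (shift C).
Local Notation B := (clock C).

(** The matrix with rows [(i, j)] and [(k, m)] over the integers modulo 3 is
    the action on the 3-torsion of an element, fixing the origin, of the
    Hessian group: the projective transformations preserving the pencil. *)
Definition hessian_rep i j k m : Prop := exists R,
  [/\ R \in unitmx, forall a b, exists a' b', forall v, cubes a b (v *m R) = cubes a' b' v,
      o *m R =~ o, heis C 1 0 *m R =~ R *m heis C i j & heis C 0 1 *m R =~ R *m heis C k m].

Lemma hessian_rep1 : hessian_rep 1 0 0 1.
Proof.
exists 1%:M; split; rewrite ?mulmx1 ?mul1mx; try exact: sim_refl.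
  exact: unitmx1.
by move=> a b; exists a, b => v; rewrite mulmx1.
Qed.

Lemma hessian_rep_mod i j k m :
  hessian_rep i j k m <-> hessian_rep (i %% 3) (j %% 3) (k %% 3) (m %% 3).
Proof. by rewrite /hessian_rep !heis_mod. Qed.

Definition fourier : 'M[C]_3 := mat3 (row3 1 1 1) (row3 1 w (w ^+ 2)) (row3 1 (w ^+ 2) w).

Definition shear : 'M[C]_3 := mat3 (row3 w 0 0) (row3 0 1 0) (row3 0 0 1).

Lemma fourierE x y z : row3 x y z *m fourier =
  row3 (x + y + z) (x + w * y + w ^+ 2 * z) (x + w ^+ 2 * y + w * z).
Proof. by rewrite row3_mat3 !row3Z !row3D; congr row3; ring. Qed.

Lemma shearE x y z : row3 x y z *m shear = row3 (w * x) y z.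
Proof. by rewrite row3_mat3 !row3Z !row3D; congr row3; ring. Qed.

Lemma mulmx_heis v i j : v *m heis C i j = v *m A ^+ i *m B ^+ j.
Proof. by rewrite heis.unlock mulmxA. Qed.

Lemma intertwine_mul R i j k m i' j' k' m' :
  heis C i j *m R =~ R *m heis C k m -> heis C i' j' *m R =~ R *m heis C k' m' ->
  heis C (i + i') (j + j') *m R =~ R *m heis C (k + k') (m + m').
Proof.
move=> h h'; apply: sim_trans (sim_mulr R (sim_sym (heis_sim C i j i' j'))) _.
rewrite -mulmxE -mulmxA; apply: sim_trans (sim_mull _ h') _.
rewrite mulmxA; apply: sim_trans (sim_mulr _ h) _.
by rewrite -mulmxA; apply: sim_mull; exact: heis_sim.
Qed.

Lemma fourier_shift : heis C 1 0 *m fourier =~ fourier *m heis C 0 2.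
Proof.
have w2 := omega_sqr C; exists 1; rewrite ?oner_neq0 // scale1r.
apply: eq_mx3 => x y z; rewrite !mulmxA !mulmx_heis !expr0 !mulmx1 expr1 shiftE !fourierE.
rewrite [B ^+ 2]expr2 -mulmxE !mulmxA !clockE.
by congr row3; ring: w2.
Qed.

Lemma fourier_clock : heis C 0 1 *m fourier =~ fourier *m heis C 1 0.
Proof.
have w2 := omega_sqr C; exists 1; rewrite ?oner_neq0 // scale1r.
apply: eq_mx3 => x y z; rewrite !mulmxA !mulmx_heis !expr0 !mulmx1 !expr1 clockE !fourierE.
rewrite shiftE.
by congr row3; ring: w2.
Qed.

Lemma shear_shift : heis C 1 0 *m shear =~ shear *m heis C 1 2.
Proof.
have w2 := omega_sqr C; exists w; first exact: omega_neq0.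
apply: eq_mx3 => x y z; rewrite -scalemxAr !mulmxA !mulmx_heis !expr0 !mulmx1 !expr1.
rewrite shearE !shiftE shearE [B ^+ 2]expr2 -mulmxE mulmxA !clockE row3Z.
by congr row3; ring: w2.
Qed.

Lemma shear_clock : heis C 0 1 *m shear =~ shear *m heis C 0 1.
Proof.
exists 1; rewrite ?oner_neq0 // scale1r.
apply: eq_mx3 => x y z; rewrite !mulmxA !mulmx_heis !expr0 !mulmx1 !expr1.
by rewrite clockE !shearE clockE.
Qed.

Lemma fourier_unit : fourier \in unitmx.
Proof.
have w2 := omega_sqr C.
have e : fourier *m fourier = 3 *: inversion C.
  apply: eq_mx3 => x y z; rewrite mulmxA !fourierE -scalemxAr inversionE row3Z.
  by congr row3; ring: w2.
have : 3 *: inversion C \in unitmx.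
  by rewrite unitmxZ ?inversion_unit // unitfE three_neq0.
by rewrite -e unitmx_mul => /andP[].
Qed.

Lemma shear_unit : shear \in unitmx.
Proof.
rewrite unitmxE unitfE det_mat3 det33 (_ : _ + _ = w) ?omega_neq0 //; ring.
Qed.

Lemma fourier_cubes (a b : C) : exists a' b', forall v,
  cubes a b (v *m fourier) = cubes a' b' v.
Proof.
have w2 := omega_sqr C; exists (3 * a + b), (18 * a - 3 * b).
by elim/row3P=> x y z; rewrite fourierE !cubes3; ring: w2.
Qed.

Lemma shear_cubes (a b : C) : exists a' b', forall v,
  cubes a b (v *m shear) = cubes a' b' v.
Proof.
have w2 := omega_sqr C; exists a, (w * b).
by elim/row3P=> x y z; rewrite shearE !cubes3; ring: w2.
Qed.

Lemma fourier_flex0 : o *m fourier =~ o.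
Proof.
have w2 := omega_sqr C; exists (1 + 2 * w); last first.
  by rewrite fourierE row3Z; congr row3; ring: w2.
apply: contraTneq (three_neq0 C) => h; rewrite negbK.
have e : - (1 + 2 * w) ^+ 2 = 3 by ring: w2.
by rewrite -e h expr0n oppr0.
Qed.

Lemma shear_flex0 : o *m shear =~ o.
Proof. by rewrite shearE mulr0; exact: sim_refl. Qed.

Lemma hessian_rep_step G i j k m i' j' k' m' :
  G \in unitmx -> (forall a b, exists a' b', forall v, cubes a b (v *m G) = cubes a' b' v) ->
  o *m G =~ o ->
  heis C 1 0 *m G =~ G *m heis C i j -> heis C 0 1 *m G =~ G *m heis C k m ->
  (exists2 R, [/\ R \in unitmx,
     forall a b, exists a' b', forall v, cubes a b (v *m R) = cubes a' b' v & o *m R =~ o]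
   & heis C i j *m R =~ R *m heis C i' j' /\ heis C k m *m R =~ R *m heis C k' m') ->
  hessian_rep i' j' k' m'.
Proof.
move=> uG cG oG AG BG [R [uR cR oR] [AR BR]]; exists (G *m R); split.
- by rewrite unitmx_mul uG.
- move=> a b; have [a1 [b1 h1]] := cR a b; have [a2 [b2 h2]] := cG a1 b1.
  by exists a2, b2 => v; rewrite mulmxA h1 h2.
- by rewrite mulmxA; apply: sim_trans (sim_mulr _ oG) oR.
- rewrite mulmxA; apply: sim_trans (sim_mulr _ AG) _.
  by rewrite -!mulmxA; apply: sim_mull.
rewrite mulmxA; apply: sim_trans (sim_mulr _ BG) _.
by rewrite -!mulmxA; apply: sim_mull.
Qed.

(** This move composes with the rotation of order 4 that exchanges the shift
    and the clock. *)
Lemma hessian_rep_fourier i j k m :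
  hessian_rep i j k m -> hessian_rep (2 * k) (2 * m) i j.
Proof.
case=> R [uR cR oR AR BR].
apply: (hessian_rep_step fourier_unit fourier_cubes fourier_flex0 fourier_shift fourier_clock).
exists R => //; split=> //.
by have := intertwine_mul BR BR; rewrite !addnn -!mul2n.
Qed.

Lemma hessian_rep_shear i j k m :
  hessian_rep i j k m -> hessian_rep (i + 2 * k) (j + 2 * m) k m.
Proof.
case=> R [uR cR oR AR BR].
apply: (hessian_rep_step shear_unit shear_cubes shear_flex0 shear_shift shear_clock).
exists R => //; split=> //.
by have := intertwine_mul AR (intertwine_mul BR BR); rewrite !addnn -!mul2n.
Qed.

(** The two moves above generate all matrices of determinant 1 modulo 3,
    which is checked by enumeration. *)
Definition sl2_moves (q : nat * nat * nat * nat) : seq (nat * nat * nat * nat) :=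
  let: (i, j, k, m) := q in
  [:: q; ((2 * k) %% 3, (2 * m) %% 3, i, j); ((i + 2 * k) %% 3, (j + 2 * m) %% 3, k, m)]%N.

Definition sl2_reach n := iter n (fun s => undup (flatten (map sl2_moves s))) [:: (1, 0, 0, 1)%N].

Lemma sl2_reach_rep n q : q \in sl2_reach n ->
  let: (i, j, k, m) := q in hessian_rep i j k m.
Proof.
elim: n q => [|n IHn] q; first by rewrite inE => /eqP->; exact: hessian_rep1.
rewrite /= mem_undup => /flattenP[s /mapP[[[[i j] k] m] /IHn h ->]].
rewrite !inE => /or3P[] /eqP -> //.
  by apply/hessian_rep_mod; rewrite !modn_mod -hessian_rep_mod; apply: hessian_rep_fourier.
by apply/hessian_rep_mod; rewrite !modn_mod -hessian_rep_mod; apply: hessian_rep_shear.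
Qed.

Lemma hessian_rep_sl2 i j k m : (i * m = j * k + 1 %[mod 3])%N -> hessian_rep i j k m.
Proof.
move=> h; apply/hessian_rep_mod; move: h.
rewrite -modnMm -[in RHS]modnDml -[in RHS]modnMm.
move: (ltn_pmod i (isT : 0 < 3)%N) (ltn_pmod j (isT : 0 < 3)%N).
move: (ltn_pmod k (isT : 0 < 3)%N) (ltn_pmod m (isT : 0 < 3)%N).
move: (i %% 3)%N (j %% 3)%N (k %% 3)%N (m %% 3)%N => {}i {}j {}k {}m hk hm hi hj /eqP h.
(* Eight steps reach all 24 matrices. *)
suff /sl2_reach_rep : (i, j, k, m) \in sl2_reach 8 by [].
have /allP/(_ i)/[!mem_iota]/(_ hi) : all (fun i => all (fun j => all (fun k =>
    all (fun m => ((i * m) %% 3 == (j * k %% 3 + 1) %% 3)%N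
                    ==> ((i, j, k, m) \in sl2_reach 8))
  (iota 0 3)) (iota 0 3)) (iota 0 3)) (iota 0 3) by vm_compute.
move/allP/(_ j)/[!mem_iota]/(_ hj)/allP/(_ k)/[!mem_iota]/(_ hk).
by move/allP/(_ m)/[!mem_iota]/(_ hm)/implyP; apply.
Qed.

End HessianGroup.

(** ** Flexes as a projective frame *)

Section FlexFrame.
Variable C : numClosedFieldType.
Local Notation o := (flex0 C).
Local Notation w := (omega C).

Lemma omegaX_inj m n : w ^+ m = w ^+ n -> (m = n %[mod 3])%N.
Proof.
have w3 := omega_cube C; rewrite -(expr_mod m w3) -(expr_mod n w3).
have w1 := omega_neq1 C; have w0 := omega_neq0 C.
have w21 : w ^+ 2 != 1.
  apply: contraNneq w1 => w2; by rewrite -w3 exprS w2 mulr1.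
have w2w : w ^+ 2 != w.
  by apply: contraNneq w1 => w2; apply/eqP/(mulfI w0); rewrite -expr2 w2 mulr1.
move: (ltn_pmod m (isT : 0 < 3)%N) (ltn_pmod n (isT : 0 < 3)%N).
by case: (m %% 3)%N => [|[|[|//]]] _; case: (n %% 3)%N => [|[|[|//]]] _ //= /eqP;
  rewrite ?expr0 ?expr1 1?eq_sym ?(negPf w1) ?(negPf w21) ?(negPf w2w) // eq_sym
    ?(negPf w1) ?(negPf w21) ?(negPf w2w).
Qed.

(** Three distinct eigenvectors in a plane make the matrix scalar there, so it
    is scalar on the plane [x = 0]; two flexes of the line [z = 0] then suffice
    for the remaining coordinate. *)
Lemma flexes_scalar (M : 'M[C]_3) :
  (forall i j, exists a, o *m heis C i j *m M = a *: (o *m heis C i j)) ->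
  exists a, M = a%:M.
Proof.
have w2 := omega_sqr C; have w0 := omega_neq0 C.
have w1 : 1 - w != 0 by rewrite subr_eq0 eq_sym omega_neq1.
have flexA j : o *m heis C 1 j = row3 1 (- w ^+ j) 0.
  rewrite mulmx_heis expr1 shiftE; elim: j => [|j IHj]; first by rewrite !expr0 mulmx1.
  by rewrite exprSr -mulmxE mulmxA IHj clockE [w ^+ j.+1]exprS; congr row3; ring.
rewrite [M]mat3_eta; move: (row i0 M) (row i1 M) (row i2 M) => {M}.
elim/row3P=> k00 k01 k02; elim/row3P=> k10 k11 k12; elim/row3P=> k20 k21 k22 h.
have cancel x : x = w * x -> x = 0.
  by move=> e; apply: (mulfI w1); rewrite mulr0 mulrBl mul1r -e subrr.
have [a0] := h 0%N 0%N; rewrite flex0_clock muln0 !expr0 row3_mat3 !row3Z !row3D.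
case/row3_inj=> e00 e01 e02.
have [a1] := h 0%N 1%N; rewrite flex0_clock muln1 !expr1 row3_mat3 !row3Z !row3D.
case/row3_inj=> e10 e11 e12.
have [a2] := h 0%N 2%N; rewrite flex0_clock row3_mat3 !row3Z !row3D.
case/row3_inj=> e20 e21 e22.
have k1020 : k10 = k20 by apply/eqP; rewrite -subr_eq0; apply/eqP; rewrite -(mulr0 a0) -e00; ring.
have k20_0 : k20 = 0.
  apply: cancel; apply: (mulfI w0); apply/eqP; rewrite -subr_eq0; apply/eqP.
  by rewrite -(mulr0 a1) -e10 k1020; ring.
have {}k1020 : k10 = 0 by rewrite k1020.
have a0E : a0 = k11 - k21 by rewrite -[a0]mulr1 -e01; ring.
have a1E : a1 = k11 - w * k21.
  by apply: (mulfI w0); rewrite [LHS]mulrC -e11; ring.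
have a2E : a2 = k11 - w ^+ 2 * k21.
  apply: (mulfI (expf_neq0 2 w0)); rewrite [LHS]mulrC -e21; ring: w2.
have k12_0 : k12 = 0.
  apply: (mulfI (three_neq0 C)); rewrite mulr0.
  transitivity ((0 * k02 + 1 * k12 + -1 * k22) + w ^+ 2 * (0 * k02 + w * k12 + - w ^+ 2 * k22)
    + w * (0 * k02 + w ^+ 2 * k12 + - w ^+ (2 * 2) * k22)); first by ring: w2.
  by rewrite e02 e12 e22 a0E a1E a2E; ring: w2.
have k22a : k22 = a0 by rewrite -[a0]opprK -[- a0]mulrN1 -e02 k12_0; ring.
have k21_0 : k21 = 0.
  apply: cancel; apply: (@addrI _ (- k11)); apply: oppr_inj.
  transitivity a1; last by rewrite a1E; ring.
  transitivity a0; first by rewrite a0E; ring.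
  apply: (mulIf (expf_neq0 2 w0)); rewrite -k22a -[RHS]opprK -mulrN -e12 k12_0; ring.
have [b0] := h 1%N 0%N; rewrite flexA expr0 row3_mat3 !row3Z !row3D.
case/row3_inj=> f00 f01 f02.
have [b1] := h 1%N 1%N; rewrite flexA expr1 row3_mat3 !row3Z !row3D.
case/row3_inj=> f10 f11 _.
have b0E : b0 = k00 by rewrite -[b0]mulr1 -f00 k1020; ring.
have b1E : b1 = k00 by rewrite -[b1]mulr1 -f10 k1020; ring.
have k01E : k01 = k11 - k00.
  by rewrite -b0E -[b0]opprK -[- b0]mulrN1 -f01; ring.
have k01_0 : k01 = 0.
  apply: cancel; rewrite {2}k01E mulrBr -{1}b1E -[w * b1]mulrC -[b1 * w]opprK -mulrN -f11; ring.
have k11E : k11 = k00 by apply/eqP; rewrite -subr_eq0 -k01E k01_0.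
have k02_0 : k02 = 0.
  by rewrite -(mulr0 b0) -f02 k12_0; ring.
exists k00; rewrite -scalemx1 [X in _ = _ *: X]mat3_eta.
apply: eq_mx3 => x y z; rewrite -scalemxAr -mat3_eta mulmx1 row3_mat3 !row3Z !row3D.
rewrite k1020 k20_0 k12_0 k21_0 k01_0 k02_0 k22a a0E k21_0 k11E.
by congr row3; ring.
Qed.

End FlexFrame.

(** * The Hessian and base change *)

Section HessianForm.

Lemma dhomog_mderiv (K : fieldType) n d (p : {mpoly K[n]}) i :
  p \is d.+1.-homog -> p^`M(i) \is d.-homog.
Proof.
move=> /dhomogP hp; apply/dhomogP => m; rewrite mcoeff_msupp mcoeff_mderiv => h.
have /hp /= : (m + U_(i))%MM \in msupp p.
  by rewrite mcoeff_msupp; apply: contraNneq h => ->; rewrite mul0rn.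
by rewrite mdegD mdeg1 addn1 => -[].
Qed.

Lemma dhomog_hessian (K : fieldType) (F : {mpoly K[3]}) :
  F \is 3.-homog -> hessian F \is 3.-homog.
Proof.
move=> hF; rewrite /hessian /determinant; apply: rpred_sum => s _.
have h i j : (2%:R : K)^-1 *: (F^`M(i))^`M(j) \is 1.-homog.
  by apply: dhomogZ; do 2!apply: dhomog_mderiv.
have p3 (t : 'I_3 -> 'I_3) :
    \prod_i (\matrix_(i < 3, j < 3) ((2%:R : K)^-1 *: (F^`M(i))^`M(j))) i (t i)
      \is 3.-homog.
  rewrite !big_ord_recl big_ord0 mulr1 !mxE.
  by apply: (@dhomogM _ _ _ 1 _ 2); rewrite ?h //; apply: (@dhomogM _ _ _ 1 _ 1); rewrite h.
by case: (perm.odd_perm s); rewrite ?expr1 ?expr0 ?mul1r ?mulN1r ?dhomogN; apply: p3.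
Qed.

Lemma map_mpoly_mderiv (K L : fieldType) (f : {rmorphism K -> L}) n
  (p : {mpoly K[n]}) i : map_mpoly f (p^`M(i)) = (map_mpoly f p)^`M(i).
Proof.
by apply/mpolyP => m; rewrite mcoeff_map_mpoly !mcoeff_mderiv mcoeff_map_mpoly; exact: rmorphMn.
Qed.

Lemma map_mpoly_hessian (K L : fieldType) (f : {rmorphism K -> L}) (F : {mpoly K[3]}) :
  map_mpoly f (hessian F) = hessian (map_mpoly f F).
Proof.
rewrite /hessian -det_map_mx; congr (\det _); apply/matrixP => i j; rewrite !mxE /=.
by rewrite map_mpolyZ !map_mpoly_mderiv fmorphV rmorph_nat.
Qed.

Lemma dhomog_map_mpoly (K L : fieldType) (f : {rmorphism K -> L}) n d (p : {mpoly K[n]}) :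
  p \is d.-homog -> map_mpoly f p \is d.-homog.
Proof.
move=> /dhomogP hp; apply/dhomogP => m; rewrite mcoeff_msupp mcoeff_map_mpoly => h.
by apply: hp; rewrite mcoeff_msupp; apply: contraNneq h => ->; apply/eqP; exact: rmorph0.
Qed.

Lemma fval_map (K L : fieldType) (f : {rmorphism K -> L}) (F : {mpoly K[3]}) v :
  fval (map_mpoly f F) (map_mx f v) = f (fval F v).
Proof.
rewrite /fval !mevalE (perm_big _ (msupp_map_mpoly _ (fmorph_inj f))) /= rmorph_sum.
apply: eq_bigr => m _; rewrite mcoeff_map_mpoly rmorphM rmorph_prod; congr (_ * _).
by apply: eq_bigr => i _; rewrite mxE rmorphXn.
Qed.

End HessianForm.

(** * Members of the pencil have the same 3-torsion *)

Section SameTorsion.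
Variables (C : numClosedFieldType) (F F' : {mpoly C[3]}) (M : 'M[C]_3) (a c a' c' : C).
Variable O : P2 C.
Hypotheses (hF : F \is 3.-homog) (hF' : F' \is 3.-homog).
Hypotheses (hM : hesse_frame F M a c) (hM' : hesse_frame F' M a' c').
Hypothesis hO : coords O =~ flex0 C *m M.
Let E := PointedCubic F O.
Let E' := PointedCubic F' O.

Lemma same_torsion P : torsion3 E P <-> torsion3 E' P.
Proof. by rewrite (frame_torsion hF hM hO) (frame_torsion hF' hM' hO). Qed.

Lemma same_add P Q R : torsion3 E P -> torsion3 E Q -> ec_add E P Q R -> ec_add E' P Q R.
Proof.
move=> /(frame_torsion hF hM hO)[i [j hP]] /(frame_torsion hF hM hO)[k [m hQ]].
move/(frame_add hF hM hO _ hP hQ) => [_ hR].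
by apply/(frame_add hF' hM' hO _ hP hQ); split=> //; exact: cubes_flex.
Qed.

Lemma same_weil P Q : torsion3 E P -> torsion3 E Q -> exists z, weil3 E P Q z /\ weil3 E' P Q z.
Proof.
move=> /(frame_torsion hF hM hO)[i [j hP]] /(frame_torsion hF hM hO)[k [m hQ]].
exists (omega C ^+ (j * k) / omega C ^+ (i * m)); split.
  exact: (frame_weil hF hM hO hP hQ).
exact: (frame_weil hF' hM' hO hP hQ).
Qed.

End SameTorsion.

Section NumberField.
Variables (k : fieldExtType rat) (iota : {rmorphism k -> algC}).
Implicit Types (E : pointed_cubic k) (F : {mpoly k[3]}) (t : option k).
Local Notation bar := (map_mpoly iota).
Local Notation o := (flex0 algC).

Lemma elliptic_frame E : elliptic iota E ->
  exists M a c, hesse_frame (bar (cubic_form E)) M a c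
    /\ coords (map_P2 iota (origin E)) =~ o *m M.
Proof. by case=> hF ns fl; apply: hesse_frame_exists; first exact: dhomog_map_mpoly. Qed.

Definition pencil_coef t : k * k := if t is Some s then (1, s) else (0, 1).

Lemma fval_pencil E t v : fval (bar (cubic_form (pencil E t))) v =
  iota (pencil_coef t).1 * fval (bar (cubic_form E)) v
  + iota (pencil_coef t).2 * fval (hessian (bar (cubic_form E))) v.
Proof.
case: t => [s|] /=; last by rewrite map_mpoly_hessian rmorph0 rmorph1 mul0r add0r mul1r.
by rewrite rmorphD /= map_mpolyZ map_mpoly_hessian /fval mevalD mevalZ rmorph1 mul1r.
Qed.

Lemma dhomog_pencil E t : cubic_form E \is 3.-homog -> cubic_form (pencil E t) \is 3.-homog.
Proof.
move=> hF; case: t => [s|] /=; last exact: dhomog_hessian.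
by rewrite rpredD // dhomogZ // dhomog_hessian.
Qed.

Lemma pencil_frame E t M a c : cubic_form E \is 3.-homog ->
  hesse_frame (bar (cubic_form E)) M a c ->
  nonsingular (bar (cubic_form (pencil E t))) ->
  exists a' c', hesse_frame (bar (cubic_form (pencil E t))) M a' c'.
Proof.
move=> hF hM ns; have [uM _ _ _] := hM.
have [a' [b' h]] := pencil_cubes (iota (pencil_coef t).1) (iota (pencil_coef t).2)
  (dhomog_map_mpoly iota hF) hM.
apply: (@cubes_frame _ _ _ a' b') => //.
  by apply/nonsingularP => //; apply/dhomog_map_mpoly/dhomog_pencil.
by move=> v; rewrite fval_pencil h.
Qed.

Lemma pencil_elliptic E t : elliptic iota E ->
  nonsingular (bar (cubic_form (pencil E t))) -> elliptic iota (pencil E t).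
Proof.
move=> hE ns; have [hF _ _] := hE; have [M [a [c [hM hO]]]] := elliptic_frame hE.
have [a' [c' hM']] := pencil_frame hF hM ns.
have hG := dhomog_map_mpoly iota (dhomog_pencil t hF).
split=> //; first exact: dhomog_pencil.
have [l hl] := cuts_origin hM'; have [l' hl'] := frame_section_exists hG hM' hO hO hO hl.
by exists l'.
Qed.

Lemma pencil_symplectic E t : elliptic iota E ->
  nonsingular (bar (cubic_form (pencil E t))) -> symplectic_iso3 iota E (pencil E t) id.
Proof.
move=> hE ns; have [hF0 _ _] := hE; have [M [a [c [hM hO]]]] := elliptic_frame hE.
have [a' [c' hM']] := pencil_frame hF0 hM ns.
have hG := dhomog_map_mpoly iota (dhomog_pencil t hF0).
have hF := dhomog_map_mpoly iota hF0.
have tor P := same_torsion hF hG hM hM' hO P.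
split=> //.
- split=> [P /tor|//|P /tor hP] //; by exists P.
- by move=> P Q R hP hQ _; exact: (same_add hF hG hM hM' hO hP hQ).
- by move=> P Q hP hQ; exact: (same_weil hF hG hM hM' hO hP hQ).
Qed.

End NumberField.

(** * Symplectic isomorphisms are linear *)

Section LinearIso.
Variables (C : numClosedFieldType) (F F' : {mpoly C[3]}) (O O' : P2 C).
Variables (M M1 : 'M[C]_3) (a c a1 c1 : C) (phi : P2 C -> P2 C).
Hypotheses (hF : F \is 3.-homog) (hF' : F' \is 3.-homog) (nsF' : nonsing (fval F')).
Hypotheses (hM : hesse_frame F M a c) (hM1 : hesse_frame F' M1 a1 c1).
Hypotheses (hO : coords O =~ flex0 C *m M) (hO' : coords O' =~ flex0 C *m M1).
Let E := PointedCubic F O.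
Let E' := PointedCubic F' O'.
Hypothesis phi_tor : forall P, torsion3 E P -> torsion3 E' (phi P).
Hypothesis phi_add : forall P Q R, torsion3 E P -> torsion3 E Q -> torsion3 E R ->
  ec_add E P Q R -> ec_add E' (phi P) (phi Q) (phi R).
Hypothesis phi_weil : forall P Q, torsion3 E P -> torsion3 E Q ->
  exists z, weil3 E P Q z /\ weil3 E' (phi P) (phi Q) z.
Local Notation o := (flex0 C).
Local Notation w := (omega C).

(** As [phi] preserves the Weil pairing, the images of the two basis points
    have coordinates with determinant 1 modulo 3 in any frame of the second
    curve; the Hessian group changes the frame so that they become the basis
    points. *)
Lemma symplectic_frame : exists M' a' c',
  [/\ hesse_frame F' M' a' c', coords O' =~ o *m M',
      forall P, coords P =~ o *m heis C 1 0 *m M -> coords (phi P) =~ o *m heis C 1 0 *m M'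
    & forall P, coords P =~ o *m heis C 0 1 *m M -> coords (phi P) =~ o *m heis C 0 1 *m M'].
Proof.
have [uM1 a10 c11 F'E] := hM1.
pose P1 := proj (o *m heis C 1 0 *m M); have hP1 := frame_proj hM (flex_neq0 C 1 0).
pose Q1 := proj (o *m heis C 0 1 *m M); have hQ1 := frame_proj hM (flex_neq0 C 0 1).
rewrite -/P1 in hP1; rewrite -/Q1 in hQ1.
have uniq (P Q : P2 C) v : coords P =~ v -> coords Q =~ v -> P = Q.
  by move=> hP hQ; apply/coords_sim/(sim_trans hP)/sim_sym.
have t1 : torsion3 E P1 by apply/(frame_torsion hF hM hO); exists 1%N, 0%N.
have t2 : torsion3 E Q1 by apply/(frame_torsion hF hM hO); exists 0%N, 1%N.
have [i [j h1]] := (frame_torsion hF' hM1 hO' _).1 (phi_tor t1).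
have [k [m h2]] := (frame_torsion hF' hM1 hO' _).1 (phi_tor t2).
have [z [/(frame_weil_val hF hM hO hP1 hQ1) -> /(frame_weil_val hF' hM1 hO' h1 h2)]] :=
  phi_weil t1 t2.
rewrite mul0n mul1n expr0 expr1 => hz.
have w0 := omega_neq0 C; have wim := omegaX_neq0 C (i * m).
have /omegaX_inj/(hessian_rep_sl2 C) : w ^+ (i * m) = w ^+ (j * k + 1).
  have e : w ^+ (i * m) * w * (1 / w) = w ^+ (i * m) by field.
  rewrite -e hz exprD expr1; field. exact: wim.
case=> R [uR cR oR AR BR].
have [a' [b' h']] := cR 1 (- 3 * c1).
have uRM : R *m M1 \in unitmx by rewrite unitmx_mul uR.
have [|a2 [c2 hM']] := @cubes_frame _ F' (R *m M1) (a1 * a') (a1 * b') uRM nsF'.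
  by move=> v; rewrite mulmxA F'E /hesse h' /cubes; ring.
exists (R *m M1), a2, c2; split=> //.
- by rewrite mulmxA; apply: sim_trans hO' (sim_mulr _ (sim_sym oR)).
- move=> P hP; rewrite (uniq _ _ _ hP hP1); apply: sim_trans h1 _; apply: sim_sym.
  rewrite mulmxA; apply: sim_mulr; rewrite -mulmxA; apply: sim_trans (sim_mull o AR) _.
  by rewrite mulmxA; apply: sim_mulr.
move=> P hP; rewrite (uniq _ _ _ hP hQ1); apply: sim_trans h2 _; apply: sim_sym.
rewrite mulmxA; apply: sim_mulr; rewrite -mulmxA; apply: sim_trans (sim_mull o BR) _.
by rewrite mulmxA; apply: sim_mulr.
Qed.

(** The points on which the matrix and [phi] agree form a subgroup containing
    a basis. *)
Lemma symplectic_linear : exists M' a' c',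
  [/\ hesse_frame F' M' a' c', coords O' =~ o *m M'
    & forall P, torsion3 E P -> coords (phi P) =~ coords P *m invmx M *m M'].
Proof.
have [M' [a' [c' [hM' hO'' h10 h01]]]] := symplectic_frame.
exists M', a', c'; split=> //; have [uM _ _ _] := hM.
pose good i j := forall P, coords P =~ o *m heis C i j *m M ->
  coords (phi P) =~ o *m heis C i j *m M'.
have tor i j P : coords P =~ o *m heis C i j *m M -> torsion3 E P.
  by move=> hP; apply/(frame_torsion hF hM hO); exists i, j.
have goodD i j k m : good i j -> good k m -> good (i + k)%N (j + m)%N.
  move=> g1 g2 P hP; have hX := frame_proj hM (flex_neq0 C i j).
  have hY := frame_proj hM (flex_neq0 C k m).
  have hs M2 : o *m heis C i j *m heis C k m *m M2 =~ o *m heis C (i + k) (j + m) *m M2.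
    by apply: sim_mulr; rewrite -mulmxA; apply/sim_mull/heis_sim.
  have hadd : ec_add E (proj (o *m heis C k m *m M)) (proj (o *m heis C i j *m M)) P.
    apply/(frame_add hF hM hO _ hY hX); split; first exact: cubes_flex.
    by apply: sim_trans hP _; apply: sim_sym.
  have := phi_add (tor _ _ _ hY) (tor _ _ _ hX) (tor _ _ _ hP) hadd.
  move/(frame_add hF' hM' hO'' _ (g2 _ hY) (g1 _ hX)) => [_ h].
  exact: sim_trans h (hs _).
have g00 : good 0%N 0%N.
  by rewrite /good -[heis C 0 0]/(heis C (3 %% 3) (0 %% 3)) heis_mod; apply: (goodD 1 0 2 0)%N => //; apply: (goodD 1 0 1 0)%N.
have gA i : good i 0%N by elim: i => // i IHi; apply: (goodD 1 0 i 0)%N.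
have gB j : good 0%N j by elim: j => // j IHj; apply: (goodD 0 1 0 j)%N.
have gAB i j : good i j by rewrite -[i]addn0; apply: (goodD i 0 0 j)%N.
move=> P /(frame_torsion hF hM hO)[i [j hP]].
apply: sim_trans (gAB _ _ _ hP) _; apply: sim_mulr; apply: sim_sym.
by have := sim_mulr (invmx M) hP; rewrite mulmxK.
Qed.

End LinearIso.

(** * Descent to the ground field *)

Section RationalIso.
Variables (k : fieldExtType rat) (iota : {rmorphism k -> algC}).
Implicit Types (E : pointed_cubic k) (F : {mpoly k[3]}) (sigma : {rmorphism algC -> algC}).
Local Notation bar := (map_mpoly iota).
Local Notation o := (flex0 algC).

Lemma map_mx_sim (K L : fieldType) (f : {rmorphism K -> L}) m (v v' : 'M[K]_(m, 3)) :
  v =~ v' -> map_mx f v =~ map_mx f v'.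
Proof. by case=> a a0 ->; exists (f a); rewrite ?fmorph_eq0 // map_mxZ. Qed.

Lemma fval_galois F sigma v : sigma \o iota =1 iota ->
  fval (bar F) (map_mx sigma v) = sigma (fval (bar F) v).
Proof.
move=> fs; rewrite -fval_map; congr (fval _ _); apply/mpolyP => m.
by rewrite !mcoeff_map_mpoly; exact/esym/fs.
Qed.

Lemma galois_inv sigma : sigma \o iota =1 iota -> algC_invaut sigma \o iota =1 iota.
Proof. by move=> fs a /=; rewrite -{1}(fs a) /= algC_autK. Qed.

Lemma map_mx_invaut sigma (v : 'rV[algC]_3) :
  map_mx sigma (map_mx (algC_invaut sigma) v) = v.
Proof. by apply/rowP => i; rewrite !mxE algC_invautK. Qed.

Lemma torsion_galois E sigma P : elliptic iota E -> sigma \o iota =1 iota ->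
  torsion3 (base_change iota E) P -> torsion3 (base_change iota E) (map_P2 sigma P).
Proof.
move=> hE fs; have [hF _ _] := hE; have [M [a [c [hM hO]]]] := elliptic_frame hE.
have hF' := dhomog_map_mpoly iota hF.
move/(frame_torsion_hessian hF' hM hO); rewrite -map_mpoly_hessian /on_curve => -[/eqP h1 /eqP h2].
apply/(frame_torsion_hessian hF' hM hO); rewrite -map_mpoly_hessian /on_curve /=.
rewrite -2![_.@[_ 0]]/(fval _ (map_mx sigma (coords P))) !fval_galois //.
by rewrite /fval h1 h2 rmorph0.
Qed.

(** A matrix inducing a Galois-equivariant map on the flexes is, up to a
    scalar, defined over [k]: its conjugates induce the same map. *)
Lemma rational_matrix E (N : 'M[algC]_3) (phi : P2 algC -> P2 algC) :
  elliptic iota E -> N \in unitmx ->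
  (forall sigma, sigma \o iota =1 iota -> forall P, torsion3 (base_change iota E) P ->
     phi (map_P2 sigma P) = map_P2 sigma (phi P)) ->
  (forall P, torsion3 (base_change iota E) P -> coords (phi P) =~ coords P *m N) ->
  exists n : 'M[k]_3, map_mx iota n =~ N.
Proof.
move=> hE uN phiG phiN; have [hF _ _] := hE; have [M [a [c [hM hO]]]] := elliptic_frame hE.
have hF' := dhomog_map_mpoly iota hF; have [uM _ _ _] := hM.
have conjN sigma : sigma \o iota =1 iota -> exists b, map_mx sigma N = b *: N.
  move=> fs; have [b hb] : exists b, M *m map_mx sigma N *m invmx N *m invmx M = b%:M.
    apply: flexes_scalar => i j; have hQ := frame_proj hM (flex_neq0 algC i j).
    set Q := proj _ in hQ.
    have tQ : torsion3 (base_change iota E) Q.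
      by apply/(frame_torsion hF' hM hO); exists i, j.
    pose P := map_P2 (algC_invaut sigma) Q.
    have tP : torsion3 (base_change iota E) P by apply: torsion_galois => //; exact: galois_inv.
    have sP : map_P2 sigma P = Q by apply: coords_inj; exact: map_mx_invaut.
    have h1 := phiN _ tQ.
    have h2 : coords (map_P2 sigma (phi P)) =~ coords (map_P2 sigma P) *m map_mx sigma N.
      by have := map_mx_sim sigma (phiN _ tP); rewrite map_mxM.
    rewrite -(phiG _ fs _ tP) sP in h2.
    have [b b0 e] := sim_trans (sim_sym h2) h1.
    have [d d0 hQ'] := hQ; exists b.
    have e' : o *m heis algC i j *m M *m map_mx sigma N = b *: (o *m heis algC i j *m M *m N).
      by apply: (scalerI d0); rewrite scalemxAl -hQ' e hQ' -scalemxAl !scalerA mulrC.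
    by rewrite !mulmxA e' -!scalemxAl mulmxK // mulmxK.
  exists b; have : M *m map_mx sigma N = b *: (M *m N).
    by rewrite -[LHS](mulmxKV uN) -[X in X *m N](mulmxKV uM) hb mul_scalar_mx -scalemxAl.
  by move/(congr1 (mulmx (invmx M))); rewrite -scalemxAr !mulKmx.
have [i [j nij]] : exists i j, N i j != 0.
  have : N != 0 by apply: contraTneq uN => ->; rewrite unitmxE det0 unitr0.
  by move=> /matrix0Pn.
have rat_entry i' j' : exists y, iota y = N i' j' / N i j.
  apply: galois_fixed => sigma fs; have [b hb] := conjN sigma fs.
  have e x y : sigma (N x y) = b * N x y by have /matrixP/(_ x y) := hb; rewrite !mxE.
  have b0 : b != 0 by apply: contraNneq nij => b0; rewrite -(fmorph_eq0 sigma) e b0 mul0r.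
  by rewrite rmorphM fmorphV !e /= -mulf_div divff // mul1r.
exists (\matrix_(i', j') sval (sig_eqW (rat_entry i' j'))), (N i j)^-1.
  by rewrite invr_eq0.
by apply/matrixP => i' j'; rewrite !mxE; case: (sig_eqW _) => y /= ->; rewrite mulrC.
Qed.

(** The coefficients are unique by [pencil_inj], hence fixed by Galois. *)
Lemma rational_coefs E M a c (f : 'rV[algC]_3 -> algC) la mu :
  cubic_form E \is 3.-homog -> hesse_frame (bar (cubic_form E)) M a c ->
  (forall sigma, sigma \o iota =1 iota -> forall v, f (map_mx sigma v) = sigma (f v)) ->
  (forall v, f v = la * fval (bar (cubic_form E)) v + mu * fval (hessian (bar (cubic_form E))) v) ->
  exists l m, la = iota l /\ mu = iota m.
Proof.
move=> hF hM fG fE; have hF' := dhomog_map_mpoly iota hF.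
have fix_coef sigma : sigma \o iota =1 iota -> sigma la = la /\ sigma mu = mu.
  move=> fs; apply: (pencil_inj hF' hM) => v; rewrite -fE.
  rewrite -(map_mx_invaut sigma v); move: (map_mx _ v) => u; rewrite fG // fE -map_mpoly_hessian !fval_galois //.
  by rewrite rmorphD !rmorphM.
have [l lE] : exists y, iota y = la by apply: galois_fixed => s /fix_coef[].
have [m mE] : exists y, iota y = mu by apply: galois_fixed => s /fix_coef[].
by exists l, m.
Qed.

(** ** Linear isomorphisms *)

Definition linear_map (N : 'M[algC]_3) (P : P2 algC) : P2 algC := proj (coords P *m N).

Lemma linear_mapE N P : N \in unitmx -> coords (linear_map N P) =~ coords P *m N.
Proof. by move=> uN; apply/coords_proj/mulmx_neq0/coords_neq0. Qed.

Lemma linear_mapK N N' P : N \in unitmx -> N' \in unitmx -> N *m N' = 1%:M ->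
  linear_map N' (linear_map N P) = P.
Proof.
move=> uN uN' NN; apply: coords_sim; apply: sim_trans (linear_mapE _ uN') _.
apply: sim_trans (sim_mulr _ (linear_mapE _ uN)) _.
by rewrite -mulmxA NN mulmx1; exact: sim_refl.
Qed.

Lemma linear_morphism E E' (n : 'M[k]_3) : cubic_form E' \is 3.-homog -> n \in unitmx ->
  (forall v, fval (bar (cubic_form E)) v = 0 ->
     fval (bar (cubic_form E')) (v *m map_mx iota n) = 0) ->
  is_morphism iota E E' (linear_map (map_mx iota n)).
Proof.
move=> hF' un h P /eqP cP; have uN : map_mx iota n \in unitmx by rewrite map_unitmx.
have cE' := fval_cubic (dhomog_map_mpoly iota hF').
split.
  have [b b0 e] := linear_mapE P uN.
  by apply/eqP; rewrite -[LHS]/(fval _ _) e cubicZ // h ?mulr0.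
pose f i : {mpoly k[3]} := \sum_j n j i *: 'X_j.
have fE Q : eval_forms iota f Q = coords Q *m map_mx iota n.
  apply/rowP => i; rewrite !mxE.
  have -> : bar (f i) = \sum_j iota (n j i) *: 'X_j.
    by rewrite raddf_sum; apply: eq_bigr => j _; rewrite /= map_mpolyZ map_mpolyX.
  by rewrite raddf_sum; apply: eq_bigr => j _; rewrite /= mevalZ mevalXU mxE mulrC.
exists 1%N, f; split.
- by move=> i; apply: rpred_sum => j _; rewrite dhomogZ // dhomogX /= mdeg1.
- by rewrite fE mulmx_neq0 ?coords_neq0.
move=> Q _ _; have [b b0 e] := sim_sym (linear_mapE Q uN); exists b.
by rewrite fE e.
Qed.

Lemma linear_isomorphic E E' (n : 'M[k]_3) l :
  cubic_form E \is 3.-homog -> cubic_form E' \is 3.-homog -> n \in unitmx -> l != 0 ->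
  (forall v, fval (bar (cubic_form E)) (v *m map_mx iota n) =
             l * fval (bar (cubic_form E')) v) ->
  coords (map_P2 iota (origin E')) *m map_mx iota n =~ coords (map_P2 iota (origin E)) ->
  isomorphic iota E E'.
Proof.
move=> hF hF' un l0 h hO; have uN : map_mx iota n \in unitmx by rewrite map_unitmx.
have un' : invmx n \in unitmx by rewrite unitmx_inv.
have uN' : map_mx iota (invmx n) \in unitmx by rewrite map_unitmx.
have NN : map_mx iota n *m map_mx iota (invmx n) = 1%:M.
  by rewrite -map_mxM mulmxV // map_mx1.
have N'N : map_mx iota (invmx n) *m map_mx iota n = 1%:M.
  by rewrite -map_mxM mulVmx // map_mx1.
exists (linear_map (map_mx iota (invmx n))), (linear_map (map_mx iota n)); split.
- apply: linear_morphism => // v fv; apply: (mulfI l0).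
  by rewrite -h -mulmxA N'N mulmx1 fv mulr0.
- by apply: linear_morphism => // v fv; rewrite h fv mulr0.
- by move=> P _; apply: linear_mapK.
- by move=> P _; apply: linear_mapK.
apply: coords_sim; apply: sim_trans (linear_mapE _ uN') _.
apply: sim_trans (sim_mulr _ (sim_sym hO)) _.
by rewrite -mulmxA NN mulmx1; exact: sim_refl.
Qed.

(** The matrix of [symplectic_linear] pulls the second curve back to a cubic of
    the form [cubes] in the Hesse coordinates of the first one, hence to a
    combination of the first cubic and its Hessian; the matrix and the
    coefficients descend to [k]. *)
Lemma symplectic_pencil E0 E phi : elliptic iota E0 -> elliptic iota E ->
  symplectic_iso3 iota E0 E phi ->
  exists t : option k, elliptic iota (pencil E0 t) /\ isomorphic iota E (pencil E0 t).
Proof.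
move=> hE0 hE [[phi_tor _ _] phi_add phiG phi_weil].
have [hF0 _ _] := hE0; have [M [a [c [hM hO]]]] := elliptic_frame hE0.
have [hF1 ns1 _] := hE; have [M1 [a1 [c1 [hM1 hO1]]]] := elliptic_frame hE.
have hF := dhomog_map_mpoly iota hF0; have hF' := dhomog_map_mpoly iota hF1.
have nsF' := (nonsingularP hF').1 ns1.
have [M' [a' [c' [hM' hO' phiN]]]] :=
  symplectic_linear hF hF' nsF' hM hM1 hO hO1 phi_tor phi_add phi_weil.
have [uM a0 _ _] := hM; have [uM' a0' _ F'E] := hM'.
have uN : invmx M *m M' \in unitmx by rewrite unitmx_mul unitmx_inv uM.
have [n nN] : exists n, map_mx iota n =~ invmx M *m M'.
  by apply: (rational_matrix hE0 uN phiG) => P /phiN; rewrite mulmxA.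
have [b b0 nE] := nN.
have uNn : map_mx iota n \in unitmx by rewrite nE unitmxZ ?unitfE.
have un : n \in unitmx by rewrite -(map_unitmx iota).
have cF' := fval_cubic hF'.
have [la0 [mu0 h0]] := cubes_pencil (a' : algC) (a' * (- 3 * c')) hF hM.
pose f v := fval (bar (cubic_form E)) (v *m map_mx iota n).
have fE v : f v = b ^+ 3 * la0 * fval (bar (cubic_form E0)) v
                + b ^+ 3 * mu0 * fval (hessian (bar (cubic_form E0))) v.
  rewrite /f nE -scalemxAr cubicZ // mulmxA F'E -2!mulrA -mulrDr; congr (_ * _).
  have := h0 (v *m invmx M); rewrite mulmxKV // => ->.
  by rewrite /hesse /cubes; ring.
have fG sigma : sigma \o iota =1 iota -> forall v, f (map_mx sigma v) = sigma (f v).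
  move=> fs v; rewrite /f -fval_galois // map_mxM; congr (fval _ (_ *m _)).
  by apply/matrixP => i j; rewrite !mxE; exact/esym/fs.
have [l [m [lE mE]]] := rational_coefs hF0 hM fG fE.
have nsf : nonsing f.
  apply: nonsing_ext (@nonsing_mul _ _ (map_mx iota n) 1 uNn (oner_neq0 _) nsF') => v /=.
  by rewrite mul1r.
have [t [s s0 ft]] : exists t, exists2 s, s != 0
    & forall v, f v = s * fval (bar (cubic_form (pencil E0 t))) v.
  have [l0|l0] := eqVneq l 0.
    exists None, (iota m); last first.
      by move=> v; rewrite fval_pencil fE lE mE l0 /= !rmorph0 !rmorph1 !mul0r !add0r mul1r.
    rewrite fmorph_eq0; apply/eqP => m0.
    have f0 v : f v = 0 by rewrite fE lE mE l0 m0 !rmorph0 !mul0r addr0.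
    have [||x] := nsf (row3 1 0 0); rewrite ?row3_neq0 ?oner_neq0 //.
    by rewrite /pol !f0 !addr0 !subr0 eqxx.
  exists (Some (m / l)), (iota l); first by rewrite fmorph_eq0.
  move=> v; rewrite fval_pencil fE lE mE /= rmorph1 mul1r mulrDr mulrA.
  by rewrite -rmorphM mulrCA mulfV ?mulr1.
have uN1 := uNn.
have nst : nonsingular (bar (cubic_form (pencil E0 t))).
  apply/nonsingularP; first by apply/dhomog_map_mpoly/dhomog_pencil.
  have si : s^-1 != 0 by rewrite invr_eq0.
  apply: nonsing_ext (@nonsing_mul _ f 1%:M s^-1 (unitmx1 _ _) si nsf) => v /=.
  by rewrite mulmx1 ft mulKf.
exists t; split; first exact: pencil_elliptic.
apply: (@linear_isomorphic _ _ n s) => //; first exact: dhomog_pencil.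
apply: sim_trans (sim_sym hO'); apply: sim_trans (sim_mull _ nN) _.
apply: sim_trans (sim_mulr _ hO) _.
by rewrite mulmxA mulmxK //; exact: sim_refl.
Qed.

End RationalIso.

Theorem theorem4p2 (k : fieldExtType rat) (iota : {rmorphism k -> algC})
    (E0 : pointed_cubic k) (hE0 : elliptic iota E0) :
  (forall t : option k,
     nonsingular (cubic_form (base_change iota (pencil E0 t))) ->
     elliptic iota (pencil E0 t) /\
     symplectic_iso3 iota E0 (pencil E0 t) id) /\
  (forall (E : pointed_cubic k) (phi : P2 algC -> P2 algC),
     elliptic iota E -> symplectic_iso3 iota E0 E phi ->
     exists t : option k,
       elliptic iota (pencil E0 t) /\ isomorphic iota E (pencil E0 t)).
Proof.
split=> [t ns|E phi]; first by split; [exact: pencil_elliptic|exact: pencil_symplectic].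
exact: symplectic_pencil.
Qed.
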